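(* Let $P_k$ and $Q_k$ be homogeneous polynomials of degree $k$ and suppose that there exist a constant $C>0$ and an exponent $p$ with $0<p\le k$ such that, for all homogeneous polynomials $q_m$ of degree $m\ge0$, $$\|Q_k(D)(P_kq_m)\|_{rF}\ge Cm^p\|q_m\|_{rF}.$$ Let $0\le k_0<k$ be an integer, $R>0$ a positive number, $a_\alpha(x)$ functions in $A(B_R)$ for every multi-index $\alpha\in\mathbb{N}_0^n$ with $|\alpha|\le k_0$, and $$L=Q_k(D)+\sum_{|\alpha|\le k_0}a_\alpha(x)D^\alpha .$$ If $k_0<p$, then the operator $q\mapsto L(P_kq)$ is a bijection from $A(B_R)$ onto $A(B_R)$. If $k_0=p$ (in particular $p<k$), then there exists $r>0$ such that $L(P_kq)=f$ has a unique solution $q\in A(B_r)$ for every $f\in A(B_R)$.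
   Context: Polynomials are in $n$ variables with complex coefficients. $B_R:=\{x\in\mathbb{R}^n:|x|<R\}$. $A(B_R)$ is the algebra of all infinitely differentiable functions $f:B_R\to\mathbb{C}$ such that for any compact subset $K\subset B_R$ the homogeneous Taylor series $\sum_{m=0}^\infty f_m(x)$ converges absolutely and uniformly to $f$ on $K$, where $f_m(x)=\sum_{|\alpha|=m}\frac{1}{\alpha!}\frac{\partial^\alpha f}{\partial x^\alpha}(0)x^\alpha$. $D^\alpha=\partial^{|\alpha|}/\partial x_1^{\alpha_1}\cdots\partial x_n^{\alpha_n}$, and $Q_k(D)$ is the constant coefficient operator obtained from the polynomial $Q_k$ by substituting $\partial/\partial x_j$ for the $j$-th variable. The real Fischer norm of a polynomial $f$ is $\|f\|_{rF}=\left(\int_{\mathbb{R}^n}|f(x)|^2e^{-|x|^2}dx\right)^{1/2}$.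
   Formalization: It is additionally assumed that the constant Q_k(D)P_k is nonzero: for m=0 the estimate reads ≥0 and gives nothing, and if Q_k(D)P_k=0 then L(P_kq) always vanishes at 0, so the claim fails; also n≥1. *)

(* Defs.v *)
From HB Require Import structures.
From mathcomp Require Import all_boot all_order all_algebra.
From mathcomp Require Export complex.
(* The notations of multinomials clash with those of MathComp-Analysis. *)
From mathcomp Require Export -(notations) mpoly.
From mathcomp Require Import all_classical all_reals all_analysis.
Set Implicit Arguments.
Unset Strict Implicit.
Unset Printing Implicit Defensive.
Import Order.TTheory GRing.Theory Num.Theory.
Import numFieldNormedType.Exports.
Local Open Scope classical_set_scope.
Local Open Scope complex_scope.
Local Open Scope ring_scope.

(* Lebesgue measure on R^n, carried by n.-tuple: the image of the n-fold
   product of the Lebesgue measure on the line. *)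
Section lebesgue_Rn.
Context {R : realType}.
Local Notation T := (measurableTypeR R).

Definition tuple_cons n (x : T * n.-tuple T) : n.+1.-tuple T :=
  [tuple of x.1 :: x.2].

Lemma measurable_tuple_cons n : measurable_fun [set: T * n.-tuple T] (@tuple_cons n).
Proof.
by apply: (@measurable_cons _ _ (T * n.-tuple T)%type T fst n snd);
  [exact: measurable_fst|exact: measurable_snd].
Qed.

Section step.
Context n (mu : {sigma_finite_measure set (n.-tuple T) -> \bar R}).

Definition lebesgue_step : set (n.+1.-tuple T) -> \bar R :=
  pushforward (lebesgue_measure \x mu)%E (@tuple_cons n).

Let lebesgue_step0 : lebesgue_step set0 = 0%E.
Proof. by rewrite /lebesgue_step /pushforward preimage_set0 measure0. Qed.

Let lebesgue_step_ge0 A : (0 <= lebesgue_step A)%E.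
Proof. by rewrite /lebesgue_step /pushforward; apply: measure_ge0. Qed.

Let lebesgue_step_sigma_additive : semi_sigma_additive lebesgue_step.
Proof.
move=> F mF tF mUF; rewrite /lebesgue_step /pushforward preimage_bigcup.
apply: measure_semi_sigma_additive.
- by move=> k; rewrite -[X in measurable X]setTI; exact: measurable_tuple_cons.
- apply/trivIsetP => /= i j _ _ ij; rewrite -preimage_setI.
  by move/trivIsetP : tF => /(_ _ _ _ _ ij) ->//; rewrite preimage_set0.
- by rewrite -preimage_bigcup -[X in measurable X]setTI; exact: measurable_tuple_cons.
Qed.

HB.instance Definition _ := isMeasure.Build _ _ _
  lebesgue_step lebesgue_step0 lebesgue_step_ge0 lebesgue_step_sigma_additive.

Let lebesgue_step_sigma_finite : sigma_finite setT lebesgue_step.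
Proof.
have /sigma_finiteP[F [TF ndF Foo]] := sigma_finiteT (@lebesgue_measure R).
have /sigma_finiteP[G [TG ndG Goo]] := sigma_finiteT mu.
pose g (t : n.+1.-tuple T) : T * n.-tuple T := (thead t, [tuple of behead t]).
have consK : cancel (@tuple_cons n) g.
  by case=> x t; rewrite /g /tuple_cons/= theadE; congr pair; exact/val_inj.
have mg : measurable_fun setT g.
  apply/measurable_fun_pairP; split;
    [exact: (@measurable_tnth _ T _ ord0)|exact: (@measurable_behead _ T n)].
exists (fun k => g @^-1` (F k `*` G k)).
  rewrite -preimage_bigcup (_ : \bigcup_k _ = setT) ?preimage_setT//.
  rewrite -subTset => -[x t] _.
  have [i _ Fix] : (\bigcup_k F k) x by rewrite -TF.
  have [j _ Gjt] : (\bigcup_k G k) t by rewrite -TG.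
  exists (maxn i j) => //; split => /=.
    by move: x Fix; exact/subsetPset/ndF/leq_maxl.
  by move: t Gjt; exact/subsetPset/ndG/leq_maxr.
move=> k; have [mF Fk] := Foo k; have [mG Gk] := Goo k; split.
  by rewrite -[X in measurable X]setTI; apply: mg => //; exact: measurableX.
rewrite /lebesgue_step /pushforward -comp_preimage.
rewrite (_ : g \o _ = id); last by apply/funext => x /=; rewrite consK.
by rewrite preimage_id product_measure1E// lte_mul_pinfty// ge0_fin_numE.
Qed.

HB.instance Definition _ := Measure_isSigmaFinite.Build _ _ _
  lebesgue_step lebesgue_step_sigma_finite.
End step.

Fixpoint lebesgue_Rn n : {sigma_finite_measure set (n.-tuple T) -> \bar R} :=
  match n with
  | 0 => \d_([tuple] : 0.-tuple T)
  | n'.+1 => lebesgue_step (lebesgue_Rn n')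
  end.
End lebesgue_Rn.

Section polynomials.
Context {R : realType} {n : nat}.
Implicit Types p q : mpoly n R[i].

Definition homogeneous (k : nat) p : Prop := p \is ishomog1 k mdeg.

(* q(D) p, for polynomials *)
Definition poly_diff q p : mpoly n R[i] :=
  \sum_(alpha <- msupp q) mcoeff alpha q *: mderivm alpha p.

Definition real_fischer_norm p : R :=
  Num.sqrt (\int[lebesgue_Rn n]_t
    (Normc.normc (meval (fun i => (tnth t i : R)%:C) p) ^+ 2 *
     expR (- \sum_(i < n) (tnth t i : R) ^+ 2)))%R.
End polynomials.

Section functions.
Context {R : realType} {n : nat}.
Implicit Types (f u q : 'rV[R]_n -> R[i]) (x : 'rV[R]_n) (P Q : mpoly n R[i]).

(* The norm of the library on 'rV[R]_n is the sup norm. *)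
Definition eball (rho : R) : set 'rV[R]_n :=
  [set x | Num.sqrt (\sum_(i < n) x 0 i ^+ 2) < rho].

Definition polyfun P x : R[i] := meval (fun i => (x 0 i)%:C) P.

Definition pderiv (i : 'I_n) f x : R[i] :=
  'D_(delta_mx 0 i) (fun y => complex.Re (f y)) x +i*
  'D_(delta_mx 0 i) (fun y => complex.Im (f y)) x.

(* D^alpha, with the order of differentiation of mderivm *)
Definition Dmulti (alpha : multinom n) f : 'rV[R]_n -> R[i] :=
  foldr (fun i => iter (alpha i) (pderiv i)) f (enum 'I_n).

(* C^oo on an open set: all iterated partial derivatives are (totally)
   differentiable, hence continuous. *)
Definition smooth_on (U : set 'rV[R]_n) f : Prop :=
  forall (s : seq 'I_n) x, U x ->
    differentiable (fun y => complex.Re (foldr pderiv f s y)) x /\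
    differentiable (fun y => complex.Im (foldr pderiv f s y)) x.

(* The homogeneous part of degree m of the Taylor series at 0; bmultinom n b is
   the finite type of the multi-indices of degree < b. *)
Definition taylor f (m : nat) x : R[i] :=
  \sum_(alpha : bmultinom n m.+1 | mdeg alpha == m)
    (\prod_(i < n) (alpha i)`!)%:R^-1 * Dmulti alpha f 0 *
    \prod_(i < n) (x 0 i)%:C ^+ alpha i.

(* The algebra A(B_rho).  A function on B_rho is represented by its extension
   by 0 to the whole space, so that equality in [Aball rho] is equality of
   functions on B_rho. *)
Definition Aball (rho : R) : set ('rV[R]_n -> R[i]) :=
  [set f | [/\ smooth_on (eball rho) f,
    forall K : set 'rV[R]_n, compact K -> K `<=` eball rho ->
      (forall x, K x -> cvgn (series (fun m => Normc.normc (taylor f m x)))) /\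
      {uniform K, (fun N x => \sum_(0 <= m < N) taylor f m x : R[i]^o) @ \oo
        --> (f : 'rV[R]_n -> R[i]^o)} &
    forall x, ~ eball rho x -> f x = 0]].

Definition poly_diffop Q f x : R[i] :=
  \sum_(alpha <- msupp Q) mcoeff alpha Q * Dmulti alpha f x.

(* Q(D) + \sum_(|alpha| <= k0) a_alpha D^alpha; the value is only meaningful on
   the ball on which f and the a_alpha are given. *)
Definition Lop Q (k0 : nat) (a : multinom n -> 'rV[R]_n -> R[i]) f x : R[i] :=
  poly_diffop Q f x +
  \sum_(alpha : bmultinom n k0.+1) a alpha x * Dmulti alpha f x.
End functions.

(* Main.v *)
(* Expand q, P_k q, the coefficients a_alpha and f in homogeneous parts. In degree m the
   equation L(P_k q) = f reads T q_m = f_m - (terms in q_j with j < m), where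
   T q = Q_k(D)(P_k q). The Fischer estimate makes T injective, hence bijective, on the
   finite-dimensional space of homogeneous polynomials of degree m, so there is exactly one
   formal solution; what remains is its convergence.

   Divide the square of the real Fischer norm in degree m by Gamma(m + n/2) / Gamma(n/2): this
   gives a multiple N_m of the L^2 norm on the unit sphere, comparable with the supremum on the
   sphere up to a factor polynomial in m. A partial derivative costs a factor O(m) in N_m (a
   Bernstein inequality), and multiplication by a homogeneous polynomial costs its supremum on
   the sphere. With b_m = N_m(q_m) r^m this yields C m^p b_m <= F + K m^k0 max_(j < m) b_j. If
   k0 < p, then K m^k0 <= C m^p / 2 for large m, and the b_m are bounded for every r < R; if
   k0 = p, the factor K is of order r, and the same bound holds for small r.

   The spherical facts are proved algebraically: the Gaussian integral of polynomials is the
   functional E with E(x_i g) = E(d_i g) / 2. *)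
From HB Require Import structures.
Require Import Defs.
From mathcomp Require Import all_boot all_order all_algebra.
From mathcomp Require Import all_classical all_reals all_analysis.
From mathcomp Require Import measurable_realfun.
From mathcomp Require Import ring lra zify.
From mathcomp Require Import -(notations) ssrcomplements.
From mathcomp Require polyrcf.
Import Order.TTheory GRing.Theory Num.Theory.
Import numFieldNormedType.Exports.
Local Open Scope classical_set_scope.
Local Open Scope complex_scope.
Local Open Scope ring_scope.
Set Implicit Arguments.
Unset Strict Implicit.
Unset Printing Implicit Defensive.

(** * Gaussian integrals *)

Section gaussian_moments.
Context {R : realType}.
Local Notation mu := (@lebesgue_measure R).

(** The Gamma quotient is what keeps the count of powers of m exact. In the undivided norm,
    multiplication by a homogeneous polynomial of degree j costs a factor that grows with m like
    m^(j/2), and the coefficients have parts of every degree j; after the division it costs a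
    constant. T preserves the degree, so the hypothesis on T survives the division unchanged, and
    only the derivatives, at most k0 of them, lose powers of m. The factor r in the case k0 = p
    comes from a gap of degrees: q_l enters degree m through D^alpha(P_k q_l) times a coefficient
    part of degree j, with m = l + (k - |alpha|) + j, so r^m contains r^l and at least one further
    factor r. In degree m = 0 the estimate is empty, since 0^p = 0. There T multiplies constants by
    Q_k(D)P_k, and [hQP] makes it injective. The inequalities between norms all come from E being
    nonnegative on polynomials that are nonnegative on R^n; radial moments and invariance under
    orthogonal maps follow from the integration by parts rule. *)

Definition gmono (j : nat) (x : R) : R := x ^+ j * expR (- x ^+ 2).

(** Half of the Gaussian is spent on the power: the exponential of y = x^2/2 is at least 1 +
    y^(j+1)/(j+1)!. The constant is chosen so that [C] times this is at least 1 + x^(2j+2), which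
    dominates |x|^j. *)
Lemma gmono_bound j : exists2 C, 0 <= C &
  forall x, `|gmono j x| <= C * expR (- x ^+ 2 / 2).
Proof.
pose C : R := 1 + 2 ^+ j.+1 * (j.+1)`!%:R.
have C0 : 0 <= C by rewrite addr_ge0// mulr_ge0// exprn_ge0.
exists C => // x.
rewrite /gmono normrM normrX (ger0_norm (expR_ge0 _)).
have -> : expR (- x ^+ 2) = expR (- x ^+ 2 / 2) * expR (- x ^+ 2 / 2).
  by rewrite -expRD; congr expR; field.
rewrite mulrA ler_wpM2r ?expR_ge0//.
rewrite mulNr expRN ler_pdivrMr ?expR_gt0//.
have y0 : 0 <= x ^+ 2 / 2 by rewrite mulr_ge0// sqr_ge0.
have h := expR_ge1Dxn j y0.
apply: le_trans (_ : C * (1 + (x ^+ 2 / 2) ^+ j.+1 / (j.+1)`!%:R) <= _); last first.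
  by rewrite ler_wpM2l.
have z0 : 0 <= (x ^+ 2) ^+ j.+1 by rewrite exprn_ge0// sqr_ge0.
apply: le_trans (_ : 1 + (x ^+ 2) ^+ j.+1 <= _).
  have [x1|x1] := leP `|x| 1.
    by rewrite (le_trans (exprn_ile1 j (normr_ge0 x) x1))// lerDl.
  rewrite -(real_normK (num_real x)) -exprM.
  rewrite (le_trans (_ : _ <= `|x| ^+ (2 * j.+1)%N))// ?lerDr//.
  by apply: ler_weXn2l; [exact: ltW|lia].
rewrite /C mulrDr mulr1 lerD//.
  by rewrite lerDl mulr_ge0// exprn_ge0.
rewrite expr_div_n.
set a := (x ^+ 2) ^+ j.+1; set b : R := 2 ^+ j.+1; set c : R := (j.+1)`!%:R.
have b0 : b != 0 by rewrite expf_neq0.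
have c0 : c != 0 by rewrite pnatr_eq0 -lt0n fact_gt0.
have -> : (1 + b * c) * (a / b / c) = a + a / b / c.
  rewrite mulrDl mul1r addrC; congr (_ + _).
  by rewrite -(mulrA a) -invfM mulrCA divff ?mulr1// mulf_neq0.
by rewrite lerDl !mulr_ge0// invr_ge0 ?exprn_ge0.
Qed.

Lemma continuous_gmono j : continuous (gmono j).
Proof.
move=> x; rewrite /gmono; apply: cvgM; first exact: exprn_continuous.
apply: (continuous_comp (f := fun x : R => - x ^+ 2)); last exact: continuous_expR.
by apply: cvgN; exact: exprn_continuous.
Qed.

Lemma measurable_gmono j : measurable_fun [set: R] (gmono j).
Proof. by apply: continuous_measurable_fun; exact: continuous_gmono. Qed.

Lemma integrable_half_gauss :
  mu.-integrable [set: R] (EFin \o (fun x : R => expR (- x ^+ 2 / 2))).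
Proof.
have := @integrable_normal_pdf R 0 1.
move=> h.
have k0 : normal_peak 1 != 0 :> R by rewrite gt_eqF// normal_peak_gt0// oner_neq0.
have := integrableZl measurableT (normal_peak 1)^-1 h.
apply: eq_integrable => // x _ /=.
by rewrite normal_pdfE ?oner_neq0// /= /normal_fun -EFinM mulrA mulVf// mul1r subr0 expr1n.
Qed.

Lemma integrable_gmono j : mu.-integrable [set: R] (EFin \o gmono j).
Proof.
have [C C0 h] := gmono_bound j.
have := integrableZl measurableT C integrable_half_gauss.
apply: le_integrable => //.
  by apply/measurable_EFinP; exact: measurable_gmono.
move=> x _ /=; rewrite lee_fin (le_trans (h x))// ler_norm//.
Qed.

Definition gmoment j : R := \int[mu]_x gmono j x.

Lemma is_derive_gmono j (x : R) :
  is_derive x 1 (gmono j) (j%:R * gmono j.-1 x - 2 * gmono j.+1 x).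
Proof.
have hX i : is_derive x 1 (fun y : R => y ^+ i) (i%:R * x ^+ i.-1).
  have := is_derive_poly ('X^i) x; rewrite derivXn hornerMn hornerXn mulr_natl.
  by congr (is_derive _ _ _ _); apply/funext => y; rewrite hornerXn.
have hN : is_derive x 1 (fun y : R => - y ^+ 2) (- (2 * x)).
  exact: (is_deriveN (hX 2)).
have hE := @is_derive1_comp R (@expR R) (fun y : R => - y ^+ 2) x _ _ (is_derive_expR _) hN.
have := is_deriveM (hX j) hE; congr (is_derive _ _ _ _).
rewrite /gmono /= (exprS x j) /GRing.scale/=; ring.
Qed.

Lemma cvg_gmono j (e : R) : `|e| = 1 ->
  (fun N : nat => gmono j (e * N.+1%:R)) @ \oo --> (0 : R).
Proof.
move=> e1; have [C C0 h] := gmono_bound j.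
apply: norm_cvg0.
apply: (@squeeze_cvgr _ _ _ _ (cst 0) (fun N : nat => C * harmonic N)).
- near=> N; rewrite normr_ge0/= (le_trans (h _))// ler_wpM2l//.
  rewrite mulNr expRN /harmonic lef_pV2 ?posrE ?expR_gt0 ?ltr0n//.
  apply: le_trans (expR_ge1Dx _).
  rewrite exprMn -(real_normK (num_real e)) e1 expr1n mul1r.
  have := sqr_ge0 (N.+1%:R - 1 : R); lra.
- exact: cvg_cst.
- rewrite -(mulr0 C); apply: cvgM; first exact: cvg_cst.
  exact: cvg_harmonic.
Unshelve. all: by end_near. Qed.

(** Integration by parts: the difference of the two sides is the integral of the derivative of
    [gmono j], computed on growing intervals by the fundamental theorem and passed to the limit by
    dominated convergence. For j = 0 the truncated predecessor is harmless, being multiplied by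
    0. *)
Lemma gmoment_rec j : j%:R * gmoment j.-1 = 2 * gmoment j.+1.
Proof.
pose f x : R := j%:R * gmono j.-1 x - 2 * gmono j.+1 x.
have cf : continuous f.
  move=> x; apply: cvgB; apply: cvgMr; exact: continuous_gmono.
have if1 : mu.-integrable setT (EFin \o (fun x => j%:R * gmono j.-1 x)).
  exact: (integrableZl measurableT j%:R (integrable_gmono j.-1)).
have if2 : mu.-integrable setT (EFin \o (fun x => 2 * gmono j.+1 x)).
  exact: (integrableZl measurableT 2 (integrable_gmono j.+1)).
have if0 : mu.-integrable setT (EFin \o f) by exact: (integrableB measurableT if1 if2).
have fint : \int[mu]_x f x = j%:R * gmoment j.-1 - 2 * gmoment j.+1.
  by rewrite RintegralB// !RintegralZl//; exact: integrable_gmono.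
apply/eqP; rewrite -subr_eq0 -fint; apply/eqP.
have mf : measurable_fun setT (EFin \o f).
  by apply/measurable_EFinP; exact: continuous_measurable_fun.
pose I (N : nat) : set R := [set` `[- N.+1%:R, N.+1%:R]].
have mI N : measurable (I N) by exact: measurable_itv.
have mfI N : measurable_fun setT (EFin \o (f \_ (I N))).
  apply/measurable_EFinP; apply/(measurable_restrict _ _ _).1 => //.
  by apply: measurable_funTS; exact: continuous_measurable_fun.
have cfI : {ae mu, forall x, setT x -> (fun n => (EFin \o (f \_ (I n))) x) @ \oo --> (EFin \o f) x}.
  apply: aeW => x _; apply: cvg_near_cst.
  near=> N; rewrite /= patchE ifT// inE /I /= in_itv/= -ler_norml.
  rewrite (le_trans (ltW (archi_boundP (normr_ge0 x))))// ler_nat.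
  by apply: leqW; near: N; exact: nbhs_infty_ge.
have bfI : {ae mu, forall x n, setT x -> (`|(EFin \o (f \_ (I n))) x| <= `|f x|%:E)%E}.
  apply: aeW => x N _; rewrite /= lee_fin patchE; case: ifP => // _.
  by rewrite normr0.
have [_ _] := @dominated_convergence _ _ _ mu setT measurableT
  (fun N => EFin \o (f \_ (I N))) (EFin \o f) (fun x => `|f x|%:E) mfI mf cfI
  (integrable_norm if0) bfI.
move=> cI; apply/eqP.
have intf : (\int[mu]_x (EFin \o f) x = 0)%E.
  apply: (cvg_unique _ cI) => //.
  have -> : [sequence (\int[mu]_x (EFin \o (f \_ (I N))) x)%E]_N =
      (fun N => (gmono j (1 * N.+1%:R) - gmono j (- 1 * N.+1%:R))%:E)%E.
    apply/funext => N /=.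
    transitivity (\int[mu]_(x in I N) (f x)%:E)%E.
      rewrite [RHS]integral_mkcond; apply: eq_integral => x _ /=.
      by rewrite !patchE; case: ifP.
    rewrite (@continuous_FTC2 _ f (gmono j)).
    - by rewrite mul1r mulN1r.
    - by rewrite -subr_gt0 opprK addr_gt0// ltr0n.
    - by apply: continuous_subspaceT.
    - split.
      + by move=> x _; have [] := is_derive_gmono j x.
      + exact/cvg_at_right_filter/continuous_gmono.
      + exact/cvg_at_left_filter/continuous_gmono.
    - by move=> x _; rewrite derive1E; have := is_derive_gmono j x; move/(@derive_val _ _ _ _ _ _ _).
  apply/cvg_EFin; first exact: nearW.
  rewrite -(subr0 0); apply: cvgB; apply: cvg_gmono.
    by rewrite normr1.
  by rewrite normrN normr1.
by rewrite /Rintegral intf.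
Unshelve. all: by end_near.
Qed.

Lemma gmoment0_gt0 : 0 < gmoment 0.
Proof.
rewrite /gmoment (_ : gmono 0 = gauss_fun); last first.
  by apply/funext => x; rewrite /gmono /gauss_fun expr0 mul1r.
rewrite /Rintegral integralT_gauss/=.
by rewrite sqrtr_gt0 pi_gt0.
Qed.

End gaussian_moments.

(** * Gaussian integrals of monomials over R^n *)

Section gaussian_Rn.
Context {R : realType}.
Local Notation T := (measurableTypeR R).
Local Notation mu := (@lebesgue_measure R).

Definition gmonon n (m : 'I_n -> nat) (t : n.-tuple T) : R :=
  (\prod_(i < n) gmono (m i) (tnth t i : R))%R.

Lemma measurable_gmonon n m : measurable_fun setT (@gmonon n m).
Proof.
apply: measurable_prod => i _.
apply: measurableT_comp; first exact: measurable_gmono.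
exact: measurable_tnth.
Qed.

Lemma gmonon_cons n (m : 'I_n.+1 -> nat) (x : T * n.-tuple T) :
  gmonon m (tuple_cons x) = gmono (m ord0) x.1 * gmonon (fun i => m (lift ord0 i)) x.2.
Proof.
rewrite /gmonon big_ord_recl; congr (gmono _ _ * _).
by apply: eq_bigr => i _; rewrite tnthS.
Qed.

(** Fubini along the inductive construction of [lebesgue_Rn]. Integrability and value are carried
    through the induction together, because the value in dimension n + 1 needs the integrability in
    dimension n. *)
Lemma integral_gmonon n (m : 'I_n -> nat) :
  (lebesgue_Rn n).-integrable setT (EFin \o gmonon m) /\
  (\int[lebesgue_Rn n]_t (gmonon m t)%:E = (\prod_(i < n) gmoment (m i))%:E)%E.
Proof.
elim: n m => [|n IH] m.
  split.
    apply/integrableP; split; first by apply/measurable_EFinP; exact: measurable_gmonon.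
    rewrite integral_dirac//=; last first.
      apply/measurable_EFinP; apply: measurableT_comp => //.
    exact: measurable_gmonon.
    by rewrite diracT mul1e ltry.
  rewrite integral_dirac//; last by apply/measurable_EFinP; exact: measurable_gmonon.
  by rewrite diracT mul1e /gmonon !big_ord0.
have [IH1 IH2] := IH (fun i => m (lift ord0 i)).
pose g (x : T * n.-tuple T) : \bar R :=
  (gmono (m ord0) x.1 * gmonon (fun i => m (lift ord0 i)) x.2)%:E.
have mg : measurable_fun setT g.
  apply/measurable_EFinP; apply: measurable_funM.
    apply: measurableT_comp; [exact: measurable_gmono|exact: measurable_fst].
  apply: measurableT_comp; [exact: measurable_gmonon|exact: measurable_snd].
have ig : (mu \x lebesgue_Rn n)%E.-integrable setT g.
  apply/(integrable12ltyP _ _ mg).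
  pose c := (\int[lebesgue_Rn n]_y `|(gmonon (fun i => m (lift ord0 i)) y)%:E|)%E.
  have /integrableP[_ c_oo] := IH1.
  have c_fin : c \is a fin_num.
    by rewrite ge0_fin_numE ?integral_ge0.
  rewrite [X in (X < _)%E](_ : _ = (\int[mu]_x (`|(gmono (m ord0) x)%:E| * c))%E).
    rewrite ge0_integralZr//.
    - have /integrableP[_ h] := @integrable_gmono R (m ord0).
      by rewrite lte_mul_pinfty// ?integral_ge0// ge0_fin_numE ?integral_ge0.
    - apply/measurable_EFinP; apply: measurableT_comp => //.
      exact: measurable_gmono.
    - exact: integral_ge0.
  apply: eq_integral => x _; rewrite -ge0_integralZl//.
  - by apply: eq_integral => y _; rewrite /g/= -EFinM normrM.
  - apply/measurable_EFinP; apply: measurableT_comp => //.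
    exact: measurable_gmonon.
have gE : (EFin \o gmonon m) \o @tuple_cons R n = g.
  by apply/funext => x; rewrite /= gmonon_cons.
have mm : measurable_fun setT (EFin \o @gmonon n.+1 m).
  by apply/measurable_EFinP; exact: measurable_gmonon.
split.
  apply: integrable_pushforward => //; first exact: measurable_tuple_cons.
  by rewrite gE preimage_setT.
rewrite [LHS](@integral_pushforward _ _ _ _ _ _ (@measurable_tuple_cons R n) _ setT (EFin \o gmonon m)) //.
  rewrite gE preimage_setT -integral12_prod_meas1//.
  transitivity (\int[mu]_x ((gmono (m ord0) x)%:E * (\prod_(i < n) gmoment (m (lift ord0 i)))%:E))%E.
    by apply: eq_integral => x _; rewrite -IH2 -integralZl.
  rewrite integralZr//; last exact: integrable_gmono.
  rewrite big_ord_recl EFinM; congr (_ * _)%E.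
  rewrite /gmoment /Rintegral fineK//.
  by apply: integrable_fin_num => //; exact: integrable_gmono.
by rewrite gE preimage_setT.
Qed.

End gaussian_Rn.

(** * The real Fischer inner product *)

(** Peels off one variable at a time; suited to multiplicative maps such as [rot] and [line], which
    are known on the variables. *)
Lemma mnm_ind n (Pm : multinom n -> Prop) :
  Pm (@mnm0 n) -> (forall i m, Pm m -> Pm (mnm_add (mnm1 i) m)) -> forall m, Pm m.
Proof.
move=> P0 PS m; have [d] := ubnP (mdeg m); elim: d m => // d IH m hm.
have [/eqP|m0] := boolP (mdeg m == 0)%N.
  by move/eqP; rewrite mdeg_eq0 => /eqP ->.
have [i mi] : exists i, (0 < m i)%N.
  apply/existsP; apply: contraR m0; rewrite negb_exists => /forallP h.
  rewrite mdegE big1// => i _; apply/eqP.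
  by have := h i; rewrite -eqn0Ngt.
have -> : m = mnm_add (mnm1 i) (mnm_sub m (mnm1 i)).
  apply/mnmP => j; rewrite mnmDE mnmBE mnm1E.
  by case: eqP => [<-|_]; [rewrite subnKC|rewrite subn0].
apply: PS; apply: IH.
have : mdeg m = (1 + mdeg (mnm_sub m (mnm1 i)))%N.
  rewrite -(mdeg1 i) -mdegD; congr mdeg; apply/mnmP => j; rewrite mnmDE mnmBE mnm1E.
  by case: eqP => [<-|_]; [rewrite subnKC|rewrite subn0].
by move=> h; move: hm; rewrite h add1n.
Qed.

HB.lock Definition ev {R : realType} {n : nat} (p : mpoly n R[i]) (v : 'I_n -> R) : R[i] :=
  meval (fun i => (v i)%:C) p.

HB.lock Definition cj {R : realType} {n : nat} (p : mpoly n R[i]) : mpoly n R[i] :=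
  map_mpoly (@conjc R) p.

(** The Gaussian integral of [p], defined through its moments so that it can be computed
    algebraically; [integral_gint] ties it to the true integral. *)
HB.lock Definition gE {R : realType} {n : nat} (p : mpoly n R[i]) : R[i] :=
  \sum_(m <- msupp p) mcoeff m p * (\prod_(i < n) gmoment (m i))%:C.

HB.lock Definition rot {R : realType} {n : nat} (O : 'M[R]_n) (p : mpoly n R[i]) : mpoly n R[i] :=
  comp_mpoly [tuple \sum_(j < n) (O i j)%:C *: mpolyX R[i] (mnm1 j) | i < n] p.

HB.lock Definition ip {R : realType} {n : nat} (p q : mpoly n R[i]) : R[i] :=
  gE (p * cj q).

HB.lock Definition sq {R : realType} {n : nat} (p : mpoly n R[i]) : R :=
  complex.Re (ip p p).

Section gaussian_functional.
Context {R : realType} {n : nat}.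
Local Notation C := R[i].
Local Notation "x ^*" := (conjc x) : ring_scope.
Local Notation M := (mpoly n C).
Implicit Types (p q f g : M) (i : 'I_n).

Lemma ReD (x y : C) : complex.Re (x + y) = complex.Re x + complex.Re y.
Proof. by case: x y => [a b] [c d]. Qed.
Lemma ReB (x y : C) : complex.Re (x - y) = complex.Re x - complex.Re y.
Proof. by case: x y => [a b] [c d]. Qed.
Lemma ReZ (x : R) (y : C) : complex.Re (x%:C * y) = x * complex.Re y.
Proof. by case: y => [c d] /=; rewrite mul0r subr0. Qed.
Lemma conjcD (x y : C) : (x + y)^* = x^* + y^*.
Proof. exact: (rmorphD (@conjc R)). Qed.
Lemma conjcM (x y : C) : (x * y)^* = x^* * y^*.
Proof. exact: (rmorphM (@conjc R)). Qed.

Lemma mcoeff_cj m p : mcoeff m (cj p) = (mcoeff m p)^*.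
Proof. by rewrite cj.unlock mcoeff_map_mpoly. Qed.
Lemma cjM p q : cj (p * q) = cj p * cj q. Proof. by rewrite cj.unlock rmorphM. Qed.
Lemma cjD p q : cj (p + q) = cj p + cj q. Proof. by rewrite cj.unlock rmorphD. Qed.
Lemma cjB p q : cj (p - q) = cj p - cj q. Proof. by rewrite cj.unlock rmorphB. Qed.
Lemma cjZ c p : cj (c *: p) = c^* *: cj p. Proof. by rewrite cj.unlock map_mpolyZ. Qed.
Lemma cjX (m : multinom n) : cj (mpolyX C m) = mpolyX C m. Proof. by rewrite cj.unlock map_mpolyX. Qed.
Lemma cj0 : cj (0 : M) = 0. Proof. by rewrite cj.unlock rmorph0. Qed.

Lemma cjK p : cj (cj p) = p.
Proof. by apply/mpolyP => m; rewrite !mcoeff_cj conjcK. Qed.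

Lemma mderiv_cj i p : mderiv i (cj p) = cj (mderiv i p).
Proof.
by apply/mpolyP => m; rewrite mcoeff_cj !mcoeff_deriv mcoeff_cj rmorphMn.
Qed.

Lemma evM p q v : ev (p * q) v = ev p v * ev q v. Proof. by rewrite ev.unlock mevalM. Qed.
Lemma evD p q v : ev (p + q) v = ev p v + ev q v. Proof. by rewrite ev.unlock mevalD. Qed.
Lemma evB p q v : ev (p - q) v = ev p v - ev q v. Proof. by rewrite ev.unlock mevalB. Qed.
Lemma evZ c p v : ev (c *: p) v = c * ev p v. Proof. by rewrite ev.unlock mevalZ. Qed.

Lemma ev0 v : ev (0 : M) v = 0. Proof. by rewrite ev.unlock meval0. Qed.
Lemma evX m v : ev (mpolyX C m) v = (\prod_(i < n) v i ^+ m i)%:C.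
Proof.
rewrite ev.unlock mevalX rmorph_prod; apply: eq_bigr => i _.
by rewrite rmorphXn.
Qed.
Lemma evC c v : ev (mpolyC n c : M) v = c. Proof. by rewrite ev.unlock mevalC. Qed.

Lemma ev_cj p v : ev (cj p) v = (ev p v)^*.
Proof.
elim/mpolyind: p => [|c m p _ _ IH]; first by rewrite cj0 ev0 conjc0.
by rewrite cjD cjZ cjX !evD !evZ IH conjcD conjcM !evX conjc_real.
Qed.

(** Replaces the support of [p] by an index set that several polynomials can share, as linearity
    requires. *)
Lemma gE_wide p (k : nat) : (msize p <= k)%N ->
  gE p = \sum_(m : bmultinom n k) mcoeff m p * (\prod_(i < n) gmoment (m i))%:C.
Proof.
move=> le_pk; rewrite gE.unlock (big_mksub (bmultinom n k)) ?msupp_uniq//=; last first.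
  by move=> x /msize_mdeg_lt /leq_trans; apply.
by rewrite big_rmcond//= => m /memN_msupp_eq0 ->; rewrite mul0r.
Qed.

Lemma gE_is_linear : linear_for *%R (gE : M -> C).
Proof.
move=> c p q; pose k := maxn (msize (c *: p + q)) (maxn (msize p) (msize q)).
rewrite !(@gE_wide _ k) ?leq_max ?leqnn ?orbT//.
rewrite mulr_sumr -big_split/=; apply: eq_bigr => m _.
by rewrite mcoeffD mcoeffZ; ring.
Qed.

HB.instance Definition _ := GRing.isLinear.Build C M C _ (@gE R n) gE_is_linear.

Lemma gED p q : gE (p + q) = gE p + gE q. Proof. exact: linearD. Qed.
Lemma gEB p q : gE (p - q) = gE p - gE q. Proof. exact: linearB. Qed.
Lemma gEZ c p : gE (c *: p) = c * gE p. Proof. exact: linearZ. Qed.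
Lemma gE0 : gE (0 : M) = 0. Proof. exact: linear0. Qed.

Lemma gE_X m : gE (mpolyX C m) = (\prod_(i < n) gmoment (m i))%:C.
Proof. by rewrite gE.unlock msuppX big_seq1 mcoeffX eqxx mul1r. Qed.

(** On a monomial this is [gmoment_rec] in the i-th factor; the other factors agree on both
    sides. *)
Lemma gE_XM i p : gE (mpolyX C (mnm1 i) * p) = 2^-1 * gE (mderiv i p).
Proof.
elim/mpolyind: p => [|c m p _ _ IH]; first by rewrite mulr0 mderiv0 !gE0 mulr0.
rewrite mulrDr !linearD/= mulrDr -IH; congr (_ + _).
rewrite -scalerAr !linearZ/= -mpolyXD mderivX linearZ/= mulrCA; congr (_ * _).
rewrite !gE_X (bigD1 i)//= [in RHS](bigD1 i)//=.
rewrite mnmDE mnmBE !mnm1E eqxx add1n subn1.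
have -> : gmoment (m i).+1 = 2^-1 * ((m i)%:R * gmoment (m i).-1) :> R.
  by rewrite gmoment_rec mulrA mulVf ?pnatr_eq0// mul1r.
have -> : \prod_(j < n | j != i) gmoment (mnm_add (mnm1 i) m j) =
   \prod_(j < n | j != i) gmoment (mnm_sub m (mnm1 i) j) :> R.
  apply: eq_bigr => j ji; rewrite mnmDE mnmBE mnm1E eq_sym (negbTE ji).
  by rewrite add0n subn0.
by rewrite !rmorphM fmorphV !rmorph_nat/= !mulrA.
Qed.

Lemma gE_cj p : gE (cj p) = (gE p)^*.
Proof.
elim/mpolyind: p => [|c m p _ _ IH]; first by rewrite cj0 linear0 conjc0.
rewrite cjD cjZ cjX !gED !gEZ conjcD conjcM.
by rewrite !gE_X conjc_real IH.
Qed.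

Definition gint p (t : n.-tuple (measurableTypeR R)) : R :=
  complex.Re (ev p (fun i => tnth t i)) * expR (- \sum_(i < n) (tnth t i : R) ^+ 2).

Lemma gint_sum p t :
  gint p t = \sum_(m <- msupp p) complex.Re (mcoeff m p) * gmonon (fun i => m i) t.
Proof.
rewrite /gint ev.unlock mevalE raddf_sum mulr_suml; apply: eq_bigr => m _.
have -> : \prod_(i < n) (tnth t i : R)%:C ^+ m i = (\prod_(i < n) (tnth t i : R) ^+ m i)%:C.
  by rewrite rmorph_prod; apply: eq_bigr => i _; rewrite rmorphXn.
rewrite /gmonon /gmono big_split/= -expR_sum sumrN.
by case: (mcoeff m p) => a b /=; rewrite mulr0 subr0 mulrA.
Qed.

Lemma integral_gint p : (lebesgue_Rn n).-integrable setT (EFin \o gint p) /\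
  \int[lebesgue_Rn n]_t gint p t = complex.Re (gE p).
Proof.
have -> : gint p = fun t => \sum_(m <- msupp p) complex.Re (mcoeff m p) * gmonon (fun i => m i) t.
  by apply/funext => t; rewrite gint_sum.
rewrite gE.unlock raddf_sum.
elim: (msupp p) => [|m s [IH1 IH2]].
  split.
    under eq_fun do rewrite big_nil.
    exact: integrable0.
  rewrite big_nil; under eq_Rintegral do rewrite big_nil.
  by rewrite Rintegral_cst// mul0r.
have [h1 h2] := @integral_gmonon R n (fun i => m i).
have h3 := integrableZl measurableT (complex.Re (mcoeff m p)) h1.
split.
  have -> : EFin \o (fun t => \sum_(j <- m :: s) complex.Re (mcoeff j p) * gmonon (fun i => j i) t)%R =
    ((EFin \o (fun t => complex.Re (mcoeff m p) * gmonon (fun i => m i) t)%R) \+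
    (EFin \o (fun t => \sum_(j <- s) complex.Re (mcoeff j p) * gmonon (fun i => j i) t)%R))%E.
    by apply/funext => t; rewrite /= big_cons EFinD.
  exact: integrableD.
under eq_Rintegral do rewrite big_cons.
rewrite RintegralD// IH2 big_cons RintegralZl//; congr (_ + _).
rewrite /Rintegral h2/=.
by case: (mcoeff m p) => a b /=; rewrite mulr0 subr0.
Qed.

(** Apart from [real_fischer_normE], this is all that is drawn from the true integral. Later
    estimates apply it to suitable nonnegative polynomials. *)
Lemma gE_ge0 p : (forall v, 0 <= complex.Re (ev p v)) -> 0 <= complex.Re (gE p).
Proof.
move=> h; have [_ <-] := integral_gint p.
by apply: Rintegral_ge0 => t _; rewrite mulr_ge0// expR_ge0.
Qed.

Lemma ip_conj p q : ip q p = (ip p q)^*.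
Proof. by rewrite ip.unlock -gE_cj cjM cjK mulrC. Qed.

Lemma ipDl p q r : ip (p + q) r = ip p r + ip q r.
Proof. by rewrite ip.unlock mulrDl gED. Qed.
Lemma ipDr p q r : ip r (p + q) = ip r p + ip r q.
Proof. by rewrite ip.unlock cjD mulrDr gED. Qed.
Lemma ipBl p q r : ip (p - q) r = ip p r - ip q r.
Proof. by rewrite ip.unlock mulrBl gEB. Qed.
Lemma ipBr p q r : ip r (p - q) = ip r p - ip r q.
Proof. by rewrite ip.unlock cjB mulrBr gEB. Qed.
Lemma ipZl c p r : ip (c *: p) r = c * ip p r.
Proof. by rewrite ip.unlock -scalerAl gEZ. Qed.
Lemma ipZr c p r : ip r (c *: p) = c^* * ip r p.
Proof. by rewrite ip.unlock cjZ -scalerAr gEZ. Qed.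
Lemma ip0l p : ip 0 p = 0.
Proof. by rewrite ip.unlock mul0r gE0. Qed.

Lemma ip_sq p : ip p p = (sq p)%:C.
Proof.
rewrite sq.unlock; have := ip_conj p p; case: (ip p p) => a b [] h /=.
by congr (_ +i* _); lra.
Qed.

Lemma normc_sqr (z : C) : Normc.normc z ^+ 2 = complex.Re (z * z^*).
Proof.
by case: z => a b /=; rewrite sqr_sqrtr ?addr_ge0 ?sqr_ge0//; ring.
Qed.

Lemma normc_ge0 (z : C) : 0 <= Normc.normc z.
Proof. by case: z => a b; exact: sqrtr_ge0. Qed.

Lemma normc_real (x : R) : Normc.normc x%:C = `|x|.
Proof. by rewrite /= expr0n /= addr0 sqrtr_sqr. Qed.

Lemma sq_ge0 p : 0 <= sq p.
Proof.
rewrite sq.unlock ip.unlock; apply: gE_ge0 => v; rewrite evM ev_cj -normc_sqr; exact: sqr_ge0.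
Qed.

Lemma real_fischer_normE p : real_fischer_norm p = Num.sqrt (sq p).
Proof.
rewrite /real_fischer_norm sq.unlock ip.unlock; congr Num.sqrt.
have [_ <-] := integral_gint (p * cj p).
apply: eq_Rintegral => t _; rewrite /gint evM ev_cj -normc_sqr.
by rewrite ev.unlock.
Qed.

Lemma sqD p q : sq (p + q) = sq p + sq q + 2 * complex.Re (ip p q).
Proof.
rewrite {1}sq.unlock ipDl !ipDr (ip_conj p q) sq.unlock.
by case: (ip p p) (ip p q) (ip q q) => [a b] [c d] [e f] /=; ring.
Qed.

Lemma sqB p q : sq (p - q) = sq p + sq q - 2 * complex.Re (ip p q).
Proof.
rewrite {1}sq.unlock ipBl !ipBr (ip_conj p q) sq.unlock.
by case: (ip p p) (ip p q) (ip q q) => [a b] [c d] [e f] /=; ring.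
Qed.

Lemma sqZ c p : sq (c *: p) = Normc.normc c ^+ 2 * sq p.
Proof.
rewrite {1}sq.unlock ipZl ipZr ip_sq mulrA normc_sqr.
by case: c => a b /=; ring.
Qed.

Lemma sq0 : sq (0 : M) = 0. Proof. by rewrite sq.unlock ip0l. Qed.

(** * Derivatives, their adjoints and the Bernstein inequality *)

Lemma homog_deriv i m p : homogeneous m.+1 p -> homogeneous m (mderiv i p).
Proof.
move=> /dhomogP hp; apply/dhomogP => a; rewrite mcoeff_msupp mcoeff_deriv => h.
have : mnm_add a (mnm1 i) \in msupp p.
  by rewrite mcoeff_msupp; apply: contraNneq h => ->; rewrite mul0rn.
by move/hp; rewrite /= mdegD mdeg1 addn1 => -[].
Qed.

Lemma homog0C p : homogeneous 0 p -> p = mpolyC n (mcoeff (@mnm0 n) p).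
Proof.
move=> /dhomogP hp; apply/mpolyP => a; rewrite mcoeffC.
have [->|a0] := eqVneq a (@mnm0 n); first by rewrite mulr1.
rewrite mulr0; apply/eqP; rewrite -[_ == 0]negbK -mcoeff_msupp.
by apply: contra a0 => /hp /= h; rewrite -mdeg_eq0 h.
Qed.

Lemma homog0_deriv i p : homogeneous 0 p -> mderiv i p = 0.
Proof. by move=> /homog0C ->; rewrite mderivC. Qed.

(** The creation operator of the Hermite polynomials; it does not preserve homogeneity. *)
Definition adj i p : M := 2 *: (mpolyX C (mnm1 i) * p) - mderiv i p.

Lemma ip_adj i p q : ip (mderiv i p) q = ip p (adj i q).
Proof.
rewrite ip.unlock /adj cjB cjZ cjM cjX -mderiv_cj conjc_nat mulrBr gEB.
rewrite -scalerAr gEZ mulrCA gE_XM mulrA divff ?pnatr_eq0// mul1r.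
by rewrite mderivM gED addrK.
Qed.

(** The canonical commutation relation, which drives the induction in [bernstein]. *)
Lemma mderiv_adj i p : mderiv i (adj i p) = adj i (mderiv i p) + 2 *: p.
Proof.
rewrite /adj mderivB mderivZ mderivM mderivX mnm1E eqxx scale1r.
have -> : mnm_sub (mnm1 i) (mnm1 i) = @mnm0 n by apply/mnmP => j; rewrite mnmBE subnn mnm0E.
by rewrite mpolyX0 mul1r scalerDr addrAC [RHS]addrAC addrC addrA.
Qed.

(** Put f = d_i p and g = [adj i f]. Then [sq f] is the real part of the pairing of p with g, while
    the commutation relation gives [sq g] = [sq (mderiv i f)] + 2 [sq f], which the induction
    hypothesis bounds by 2(m+1) [sq f]. *)
Lemma bernstein i m p : homogeneous m p -> sq (mderiv i p) <= 2 * m%:R * sq p.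
Proof.
elim: m p => [|m IH] p hp.
  by rewrite homog0_deriv// sq0 mulr0 mul0r.
set f := mderiv i p; set g := adj i f.
have hf : homogeneous m f by exact: homog_deriv.
have hS : complex.Re (ip p g) = sq f by rewrite sq.unlock -ip_adj.
have hg : sq g <= 2 * m.+1%:R * sq f.
  have -> : sq g = complex.Re (ip (mderiv i g) f) by rewrite sq.unlock (ip_adj i g f).
  rewrite mderiv_adj ipDl ipZl (ip_conj f) -ip_adj !ip_sq conjc_real ReD.
  rewrite -(rmorph_nat (real_complex R)) ReZ /=.
  have := IH _ hf; rewrite -natr1; lra.
(* Cauchy-Schwarz with a weight: for c = 2(m+1) the square expands to c^2 [sq p] - 2c [sq f] +
   [sq g], and [sq g] <= c [sq f] leaves exactly the claim. *)
have := sq_ge0 ((2 * m.+1%:R)%:C *: p - g).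
rewrite sqB sqZ ipZl ReZ hS normc_real real_normK ?num_real//.
have c0 : 0 < 2 * m.+1%:R :> R by rewrite mulr_gt0.
move=> h; rewrite -(ler_pM2l c0); move: h hg; set c := 2 * m.+1%:R; lra.
Qed.

Lemma mderiv_eq0C p : (forall i, mderiv i p = 0) -> p = mpolyC n (mcoeff (@mnm0 n) p).
Proof.
move=> h; apply/mpolyP => a; rewrite mcoeffC.
have [->|a0] := eqVneq a (@mnm0 n); first by rewrite mulr1.
rewrite mulr0; have [i ai] : exists i, (0 < a i)%N.
  apply/existsP; apply: contraR a0; rewrite negb_exists => /forallP a0.
  apply/eqP/mnmP => j; apply/eqP; rewrite mnm0E.
  by have := a0 j; rewrite -eqn0Ngt.
have := congr1 (mcoeff (mnm_sub a (mnm1 i))) (h i).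
rewrite mcoeff_deriv mcoeff0.
have -> : mnm_add (mnm_sub a (mnm1 i)) (mnm1 i) = a.
  apply/mnmP => j; rewrite mnmDE mnmBE mnm1E.
  by case: eqP => [<-|_]; [rewrite subnK|rewrite subn0 addn0].
by move/eqP; rewrite mulrn_eq0 => /eqP.
Qed.

Lemma sq_C c : sq (mpolyC n c : M) = Normc.normc c ^+ 2 * gmoment 0 ^+ n.
Proof.
rewrite -[mpolyC n c]mulr1 mul_mpolyC sqZ; congr (_ * _).
rewrite sq.unlock ip.unlock -{1}(mpolyX0 n C) -(mpolyX0 n C) cjX -mpolyXD gE_X /=.
by under eq_bigr do rewrite mnmDE mnm0E; rewrite prodr_const card_ord.
Qed.

(** By [bernstein] all first derivatives have [sq] zero, so they vanish by induction on the degree;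
    then [p] is constant, and zero because its degree is positive. *)
Lemma sq_eq0 m p : homogeneous m p -> sq p = 0 -> p = 0.
Proof.
elim: m p => [|m IH] p hp p0.
  have e := homog0C hp; move: p0; rewrite e sq_C => /eqP.
  rewrite mulf_eq0 expf_eq0 /= expf_eq0 (gt_eqF gmoment0_gt0) andbF orbF.
  by move/eqP/Normc.eq0_normc => ->; rewrite mpolyC0.
have d0 i : mderiv i p = 0.
  apply: IH (homog_deriv i hp) _; apply/eqP; rewrite eq_le sq_ge0 andbT.
  by rewrite (le_trans (bernstein i hp))// p0 mulr0.
have e := mderiv_eq0C d0; rewrite e.
suff -> : mcoeff (@mnm0 n) p = 0 by rewrite mpolyC0.
apply/eqP; rewrite -[_ == 0]negbK -mcoeff_msupp.
by apply/negP => /(dhomogP _ _ _ hp) /=; rewrite mdeg0.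
Qed.

Lemma cauchy_schwarz m p q : homogeneous m q ->
  Normc.normc (ip p q) ^+ 2 <= sq p * sq q.
Proof.
move=> hq; have [q0|q0] := eqVneq (sq q) 0.
  by rewrite (sq_eq0 hq q0) ip_conj ip0l conjc0 Normc.normc0 expr0n sq0 mulr0.
have q1 : 0 < sq q by rewrite lt_def q0 sq_ge0.
have := sq_ge0 ((sq q)%:C *: p - (ip p q) *: q).
have e : complex.Re ((ip p q)^* * ip p q) = Normc.normc (ip p q) ^+ 2.
  by rewrite normc_sqr mulrC.
rewrite sqB !sqZ ipZl ReZ ipZr e normc_real real_normK ?num_real//.
set A := Normc.normc _ ^+ 2 => h.
rewrite -(ler_pM2l q1).
by move: h; clearbody A; move: (sq q) (sq p) => x y; nra.
Qed.

(** * Powers of |x|^2 and the Gamma weights *)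

Lemma euler m p : homogeneous m p ->
  \sum_(i < n) mpolyX C (mnm1 i) * mderiv i p = m%:R *: p.
Proof.
move=> /dhomogP hp; rewrite [in LHS](mpolyE p) [in RHS](mpolyE p).
rewrite scaler_sumr.
under eq_bigr do rewrite raddf_sum mulr_sumr.
rewrite exchange_big/= !big_seq; apply: eq_bigr => a /hp /= ha.
transitivity (\sum_(i < n) (a i)%:R *: (mcoeff a p *: mpolyX C a)).
  apply: eq_bigr => i _; rewrite mderivZ mderivX -!scalerAr -mpolyXD.
  have [ai|ai] := posnP (a i); first by rewrite ai !scale0r scaler0.
  rewrite !scalerA mulrC; congr (_ *: mpolyX C _).
  apply/mnmP => j; rewrite mnmDE mnmBE mnm1E.
  by case: eqP => [<-|_]; [rewrite subnKC|rewrite subn0].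
by rewrite -scaler_suml -natr_sum -mdegE ha.
Qed.

Definition r2 : M := \sum_(i < n) mpolyX C (mnm1 i) * mpolyX C (mnm1 i).

Lemma ev_r2 v : ev r2 v = (\sum_(i < n) v i ^+ 2)%:C.
Proof.
rewrite /r2 ev.unlock [LHS]raddf_sum rmorph_sum; apply: eq_bigr => i _.
by rewrite /= mevalM mevalXU expr2 rmorphM.
Qed.

(** Takes the place of radial integration: integrating by parts in one factor x_i of each x_i^2
    gives p + x_i d_i p, and the sum over i is evaluated by Euler's identity. *)
Lemma gE_r2 d p : homogeneous d p ->
  gE (r2 * p) = (n%:R / 2 + d%:R / 2)%:C * gE p.
Proof.
move=> hp; rewrite /r2 mulr_suml.
transitivity (\sum_(i < n) 2^-1 * gE (p + mpolyX C (mnm1 i) * mderiv i p)).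
  rewrite [LHS]raddf_sum; apply: eq_bigr => i _ /=.
  rewrite -mulrA gE_XM mderivM mderivX mnm1E eqxx scale1r.
  have -> : mnm_sub (mnm1 i) (mnm1 i) = @mnm0 n by apply/mnmP => j; rewrite mnmBE subnn mnm0E.
  by rewrite mpolyX0 mul1r.
rewrite -mulr_sumr; under eq_bigr do rewrite gED.
rewrite big_split/= -[X in _ + X](raddf_sum (@gE R n)) /= (euler hp) gEZ.
rewrite sumr_const card_ord -[gE p *+ n]mulr_natl -mulrDl mulrA; congr (_ * _).
by rewrite -mulrDl rmorphM rmorphD fmorphV !rmorph_nat mulrC.
Qed.

Lemma r2_homog j : homogeneous (2 * j)%N (r2 ^+ j).
Proof.
elim: j => [|j IH]; first exact: dhomog1.
rewrite exprS mulnS; apply: dhomogM => //.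
apply: rpred_sum => i _; rewrite -mpolyXD dhomogX.
by rewrite /= mdegD !mdeg1.
Qed.

(* [wt m] is the Gamma quotient [Gamma (m + n/2) / Gamma (n/2)]. *)
Definition wt (m : nat) : R := \prod_(l < m) (n%:R / 2 + l%:R).

(** Each further factor |x|^2 contributes the next factor of [wt], since the degree of [r2 ^+ j * p]
    is 2(j + d). The cross-multiplied form avoids dividing by [wt d]. *)
Lemma gE_r2n d j p : homogeneous (2 * d)%N p ->
  (wt d)%:C * gE (r2 ^+ j * p) = (wt (d + j))%:C * gE p.
Proof.
move=> hp; elim: j => [|j IH]; first by rewrite addn0 mul1r.
rewrite exprS -mulrA (gE_r2 (d := (2 * j + 2 * d)%N)); last exact: dhomogM (r2_homog j) hp.
rewrite mulrCA IH mulrA addnS /wt big_ord_recr/= -/(wt _) rmorphM [in RHS]mulrC.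
rewrite [in RHS]mulrC; congr (_ * _); rewrite [RHS]mulrC; congr (_%:C * _).
by rewrite -mulnDr natrM addnC; field.
Qed.

Lemma wt_gt0 m : (0 < n)%N -> 0 < wt m.
Proof.
move=> n0; apply: prodr_gt0 => l _; rewrite ltr_wpDr// divr_gt0// ltr0n//.
Qed.

Definition enorm (v : 'I_n -> R) : R := Num.sqrt (\sum_(i < n) v i ^+ 2).

Lemma enorm_ge0 v : 0 <= enorm v. Proof. exact: sqrtr_ge0. Qed.

Lemma enorm_sqr v : enorm v ^+ 2 = \sum_(i < n) v i ^+ 2.
Proof. by rewrite sqr_sqrtr// sumr_ge0// => i _; exact: sqr_ge0. Qed.

Lemma homog_cj d p : homogeneous d p -> homogeneous d (cj p).
Proof.
move=> /dhomogP hp; apply/dhomogP => a; rewrite mcoeff_msupp mcoeff_cj => h.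
apply: hp; rewrite mcoeff_msupp; apply: contraNneq h => ->.
by rewrite conjc0.
Qed.

Lemma ev_sqr p v : ev (p * cj p) v = (Normc.normc (ev p v) ^+ 2)%:C.
Proof.
rewrite evM ev_cj normc_sqr; case: (ev p v) => a b /=; apply/eqP.
by rewrite eq_complex /=; apply/andP; split; apply/eqP; ring.
Qed.

Lemma ev_r2n j v : ev (r2 ^+ j) v = (enorm v ^+ (2 * j))%:C.
Proof.
elim: j => [|j IH]; first by rewrite expr0 muln0 expr0 -mpolyC1 evC.
by rewrite exprS evM IH ev_r2 -rmorphM mulnS exprD enorm_sqr.
Qed.

(** Integrates the pointwise inequality |fg|^2 <= s^2 |x|^(2j) |g|^2, whose right side is a
    polynomial with integral known from [gE_r2n]. *)
Lemma sq_mul_le m j (s : R) f g : (0 < n)%N -> 0 <= s -> homogeneous m g ->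
  (forall v, Normc.normc (ev f v) <= s * enorm v ^+ j) ->
  wt m * sq (f * g) <= s ^+ 2 * wt (m + j) * sq g.
Proof.
move=> n0 s0 hg hf.
have hgg : homogeneous (2 * m)%N (g * cj g).
  by rewrite mul2n -addnn; apply: dhomogM => //; exact: homog_cj.
have e1 : wt m * complex.Re (gE (r2 ^+ j * (g * cj g))) = wt (m + j) * sq g.
  by rewrite -ReZ gE_r2n// ReZ sq.unlock ip.unlock.
rewrite -mulrA -e1 mulrCA ler_wpM2l ?(ltW (wt_gt0 _ _))//.
rewrite -ReZ -gEZ sq.unlock ip.unlock -subr_ge0 -ReB -gEB; apply: gE_ge0 => v.
rewrite evB ReB evZ ReZ evM ev_r2n !ev_sqr -rmorphM/= evM Normc.normcM subr_ge0.
have -> : enorm v ^+ (2 * j) = (enorm v ^+ j) ^+ 2 by rewrite mulnC exprM.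
rewrite [leLHS]exprMn [leRHS]mulrA ler_wpM2r ?sqr_ge0// -exprMn.
by rewrite lerXn2r ?nnegrE ?normc_ge0// mulr_ge0// exprn_ge0// enorm_ge0.
Qed.

Lemma sq1 : sq (1 : M) = gmoment 0 ^+ n.
Proof. by rewrite -mpolyC1 sq_C Normc.normc1 expr1n mul1r. Qed.

(** * Orthonormal bases of the homogeneous polynomials *)

Definition proj (e : seq M) p : M := \sum_(f <- e) ip p f *: f.

Lemma projD e p q : proj e (p + q) = proj e p + proj e q.
Proof. by rewrite /proj -big_split; apply: eq_bigr => f _; rewrite ipDl scalerDl. Qed.
Lemma projZ e c p : proj e (c *: p) = c *: proj e p.
Proof. by rewrite /proj scaler_sumr; apply: eq_bigr => f _; rewrite ipZl scalerA. Qed.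

(** Orthogonality of the list is expressed as [ip (proj e p) f = ip p f], which together with
    [sq f = 1] amounts to orthonormality. This is the form that the induction consumes: it makes
    [p - proj e p] orthogonal to [e]. *)
Lemma gram_schmidt d (s : seq M) : (forall p, p \in s -> homogeneous d p) ->
  exists e : seq M, [/\ (size e <= size s)%N,
    forall f, f \in e -> homogeneous d f /\ sq f = 1,
    forall p f, f \in e -> ip (proj e p) f = ip p f &
    forall p, p \in s -> proj e p = p].
Proof.
elim: s => [|p s IH] hs.
  by exists [::]; split => // ? ?; rewrite in_nil.
have [|e [se he1 he2 he3]] := IH; first by move=> q qs; apply: hs; rewrite inE qs orbT.
pose r := p - proj e p.
have hp : homogeneous d p by apply: hs; rewrite inE eqxx.
have hr : homogeneous d r.
  apply: rpredB => //; rewrite /proj big_seq; apply: rpred_sum => f fe.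
  by apply: rpredZ; exact: (he1 _ fe).1.
(* If the remainder vanishes, [p] already lies in the span and the list stays as it is; otherwise
   the normalized remainder is added. *)
have [r0|r0] := eqVneq r 0.
  exists e; split => //; first exact: leqW.
  move=> q; rewrite inE => /predU1P[->|]; last exact: he3.
  by apply/esym/eqP; rewrite -subr_eq0 -/r r0.
have sr : 0 < sq r.
  rewrite lt_def sq_ge0 andbT; apply: contraNneq r0 => /(sq_eq0 hr) ->.
  by [].
pose c := (Num.sqrt (sq r))^-1.
have c0 : c != 0 by rewrite invr_eq0 sqrtr_eq0 -ltNge.
have cc : c ^+ 2 * sq r = 1.
  by rewrite exprVn sqr_sqrtr ?ltW// mulVf// gt_eqF.
pose f0 := c%:C *: r.
have rf f : f \in e -> ip r f = 0 by move=> fe; rewrite ipBl he2// subrr.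
have ff0 f : f \in e -> ip f f0 = 0.
  by move=> fe; rewrite ipZr ip_conj rf// conjc0 mulr0.
have projf0 q : ip (proj e q) f0 = 0.
  rewrite /proj ip.unlock mulr_suml [LHS]raddf_sum big_seq big1//= => f fe.
  by have := ff0 _ fe; rewrite ip.unlock -scalerAl gEZ => ->; rewrite mulr0.
have pE q : proj (f0 :: e) q = ip q f0 *: f0 + proj e q by rewrite /proj big_cons.
have sqf0 : sq f0 = 1.
  by rewrite sqZ normc_real real_normK ?num_real.
exists (f0 :: e); split => //.
- move=> f; rewrite inE => /predU1P[->|]; last exact: he1.
  by split => //; exact: rpredZ.
- move=> q f; rewrite pE ipDl ipZl inE => /predU1P[->|fe].
    by rewrite ip_sq sqf0 mulr1 projf0 addr0.
  by rewrite he2// ipZl rf// mulr0 mulr0 add0r.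
- move=> q; rewrite pE inE => /predU1P[->|qs].
    have -> : ip p f0 = (c * sq r)%:C.
      have -> : p = r + proj e p by rewrite subrK.
      by rewrite ipDl projf0 addr0 ipZr conjc_real ip_sq -rmorphM.
    by rewrite scalerA -rmorphM mulrAC -expr2 cc rmorph1 scale1r subrK.
  have -> : ip q f0 = 0 by rewrite -(he3 _ qs) projf0.
  by rewrite scale0r add0r he3.
Qed.

(** Only polynomial growth in [d] matters: such factors disappear on passing to a slightly smaller
    radius. *)
Lemma card_bmultinom_le d : (#|{: bmultinom n d.+1}| <= d.+1 ^ n)%N.
Proof.
have leb (m : bmultinom n d.+1) i : (m i < d.+1)%N.
  apply: leq_ltn_trans (bmdeg m); rewrite mdegE (bigD1 i)//=; exact: leq_addr.
pose g (m : bmultinom n d.+1) : {ffun 'I_n -> 'I_d.+1} := [ffun i => Ordinal (leb m i)].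
have gi : injective g.
  move=> m1 m2 /ffunP h; apply/val_inj/mnmP => i.
  by have := h i; rewrite !ffunE => /(congr1 val).
by rewrite (leq_trans (leq_card _ gi))// card_ffun !card_ord.
Qed.

(* [e] plays the role of an orthonormal basis of the homogeneous polynomials of degree [d]. *)
Lemma homog_basis d : exists e : seq M, [/\ (size e <= d.+1 ^ n)%N,
    forall f, f \in e -> homogeneous d f,
    forall f, f \in e -> sq f = 1 &
    forall p, homogeneous d p -> proj e p = p].
Proof.
pose s := [seq mpolyX C (val m) | m : bmultinom n d.+1 <- enum (fun m : bmultinom n d.+1 => mdeg m == d)].
have [p /mapP[m hm ->]|e [se he1 he2 he3]] := @gram_schmidt d s.
  by rewrite /homogeneous dhomogX; move: hm; rewrite mem_enum.
exists e; split.
- by rewrite (leq_trans se)// size_map -cardE (leq_trans (max_card _))// card_bmultinom_le.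
- by move=> f /he1[].
- by move=> f /he1[].
move=> p /dhomogP hp; rewrite (mpolyE p) /proj.
have pr : {morph proj e : p q / p + q} by exact: projD.
have p0 : proj e 0 = 0 by rewrite /proj big1// => f _; rewrite ip0l scale0r.
rewrite -/(proj e _) (big_morph _ pr p0) !big_seq; apply: eq_bigr => m /hp /= hm.
rewrite projZ; congr (_ *: _); apply: he3.
have hm' : (mdeg m < d.+1)%N by rewrite hm.
by apply/mapP; exists (BMultinom hm') => //; rewrite mem_enum; apply/eqP.
Qed.

(** * Invariance under orthogonal maps *)

Section rotation.
Variable O : 'M[R]_n.
Implicit Types v : 'I_n -> R.

Definition rotv v : 'I_n -> R := fun i => \sum_(j < n) O i j * v j.

Lemma rotM p q : rot O (p * q) = rot O p * rot O q.
Proof. by rewrite rot.unlock rmorphM. Qed.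
Lemma rotD p q : rot O (p + q) = rot O p + rot O q.
Proof. by rewrite rot.unlock comp_mpolyD. Qed.
Lemma rotZ c p : rot O (c *: p) = c *: rot O p.
Proof. by rewrite rot.unlock comp_mpolyZ. Qed.
Lemma rot0 : rot O 0 = 0.
Proof. by rewrite rot.unlock comp_mpoly0. Qed.
Lemma rot1 : rot O 1 = 1.
Proof. by rewrite rot.unlock comp_mpoly1. Qed.
Lemma rotX i : rot O (mpolyX C (mnm1 i)) = \sum_(j < n) (O i j)%:C *: mpolyX C (mnm1 j).
Proof. by rewrite rot.unlock comp_mpolyXU -tnth_nth tnth_mktuple. Qed.

Lemma ev_rot p v : ev (rot O p) v = ev p (rotv v).
Proof.
rewrite ev.unlock rot.unlock comp_mpoly_meval; apply: meval_eq => i.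
rewrite tnth_mktuple raddf_sum /rotv rmorph_sum; apply: eq_bigr => j _ /=.
by rewrite mevalZ mevalXU rmorphM.
Qed.

Lemma rot_cj p : rot O (cj p) = cj (rot O p).
Proof.
elim/mpolyind: p => [|c m p _ _ IH]; first by rewrite cj0 rot0 cj0.
rewrite !(cjD, cjZ, rotD, rotZ) IH cjX; congr (_ *: _ + _).
elim/mnm_ind: m => [|i m IHm]; first by rewrite mpolyX0 rot1 -(mpolyX0 n C) cjX.
rewrite mpolyXD rotM cjM -IHm rotX; congr (_ * _).
rewrite (big_morph cj cjD cj0); apply: eq_bigr => j _.
by rewrite cjZ cjX conjc_real.
Qed.

Lemma rot_homog d p : homogeneous d p -> homogeneous d (rot O p).
Proof.
move=> /dhomogP hp; rewrite (mpolyE p) (big_morph (rot O) rotD rot0) big_seq.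
apply: rpred_sum => m /hp /= <-; rewrite rotZ; apply: rpredZ.
elim/mnm_ind: m => [|i m IHm]; first by rewrite mpolyX0 rot1 mdeg0; exact: dhomog1.
rewrite mpolyXD rotM mdegD mdeg1; apply: dhomogM => //.
rewrite rotX; apply: rpred_sum => j _; apply: rpredZ.
by rewrite dhomogX /= mdeg1.
Qed.

Lemma mderiv_rot j p : mderiv j (rot O p) = \sum_(l < n) (O l j)%:C *: rot O (mderiv l p).
Proof.
elim/mpolyind: p => [|c m p _ _ IH].
  by rewrite rot0 mderiv0 big1// => l _; rewrite mderiv0 rot0 scaler0.
rewrite rotD mderivD IH rotZ mderivZ.
transitivity (\sum_(l < n) (c *: ((O l j)%:C *: rot O (mderiv l (mpolyX C m))) +
   (O l j)%:C *: rot O (mderiv l p))); last first.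
  by apply: eq_bigr => l _; rewrite mderivD mderivZ rotD rotZ scalerDr scalerA mulrC -scalerA.
rewrite big_split/= -scaler_sumr; congr (_ *: _ + _).
elim/mnm_ind: m => [|i m IHm].
  rewrite mpolyX0 rot1 -mpolyC1 mderivC big1// => l _.
  by rewrite mderivC rot0 scaler0.
rewrite mpolyXD rotM mderivM IHm.
have e l : rot O (mderiv l (mpolyX C (mnm1 i) * mpolyX C m)) =
  (i == l)%:R *: rot O (mpolyX C m) + rot O (mpolyX C (mnm1 i)) * rot O (mderiv l (mpolyX C m)).
  rewrite mderivM rotD rotM; congr (_ + _).
  rewrite mderivX mnm1E; case: eqP => [->|_]; last by rewrite !scale0r mul0r rot0.
  rewrite !scale1r (_ : mnm_sub (mnm1 l) (mnm1 l) = @mnm0 n) ?mpolyX0 ?mul1r//.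
  by apply/mnmP => k; rewrite mnmBE subnn mnm0E.
transitivity (\sum_(l < n) ((O l j)%:C *: ((i == l)%:R *: rot O (mpolyX C m)) +
  rot O (mpolyX C (mnm1 i)) * ((O l j)%:C *: rot O (mderiv l (mpolyX C m))))); last first.
  by apply: eq_bigr => l _; rewrite e scalerDr scalerAr.
rewrite big_split/= -mulr_sumr; congr (_ + _).
rewrite (bigD1 i)//= eqxx scale1r big1 ?addr0; last first.
  by move=> l li; rewrite eq_sym (negbTE li) scale0r scaler0.
rewrite rotX raddf_sum/= (bigD1 j)//= big1 ?addr0; last first.
  move=> l li; rewrite mderivZ mderivX mnm1E (negbTE li) scale0r scaler0//.
rewrite mderivZ mderivX mnm1E eqxx scale1r.
rewrite (_ : mnm_sub (mnm1 j) (mnm1 j) = @mnm0 n) ?mpolyX0 -?scalerAl ?mul1r//.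
by apply/mnmP => k; rewrite mnmBE subnn mnm0E.
Qed.

Hypothesis hO : O *m O^T = 1%:M.

(** No change of variables in the integral: one variable is removed from a monomial by [gE_XM], the
    chain rule produces a double sum over entries of [O], and the orthonormal rows collapse it to
    the same rule for the unrotated monomial. The degree drops, so induction applies. *)
Lemma gE_rot p : gE (rot O p) = gE p.
Proof.
elim/mpolyind: p => [|c m p _ _ IH]; first by rewrite rot0.
rewrite rotD rotZ !gED !gEZ IH; congr (_ * _ + _).
have [d] := ubnP (mdeg m); elim: d m => // d IHd m hm.
have [/eqP|m0] := boolP (mdeg m == 0)%N.
  by move/eqP; rewrite mdeg_eq0 => /eqP ->; rewrite mpolyX0 rot1.
have [i [m' mE]] : exists i m', m = mnm_add (mnm1 i) m'.
  by elim/mnm_ind: m m0 {hm} => [|i m' _ _]; [rewrite mdeg0|exists i, m'].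
have dm : (mdeg m' < d)%N by move: hm; rewrite mE mdegD mdeg1 add1n ltnS.
rewrite mE mpolyXD rotM rotX mulr_suml gE_XM (raddf_sum (@gE R n)) /=.
transitivity (\sum_(j < n) \sum_(l < n) (2^-1 * (O i j * O l j)%:C * gE (rot O (mderiv l (mpolyX C m'))))).
  apply: eq_bigr => j _; rewrite -scalerAl gEZ gE_XM mderiv_rot (raddf_sum (@gE R n)) /= !mulr_sumr.
  by apply: eq_bigr => l _; rewrite gEZ rmorphM; ring.
rewrite exchange_big/=.
transitivity (\sum_(l < n) (2^-1 * (i == l)%:R * gE (rot O (mderiv l (mpolyX C m'))))).
  apply: eq_bigr => l _; rewrite -mulr_suml -mulr_sumr -(rmorph_sum (real_complex R)) /=.
  have := congr1 (fun A : 'M[R]_n => A i l) hO; rewrite !mxE => e.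
  rewrite (_ : \sum_j O i j * O l j = (i == l)%:R) ?rmorph_nat//.
  by rewrite -e; apply: eq_bigr => j _; rewrite mxE.
rewrite (bigD1 i)//= eqxx mulr1 big1 ?addr0; last first.
  by move=> l li; rewrite eq_sym (negbTE li) mulr0 mul0r.
congr (_ * _); rewrite mderivX rotZ !gEZ; congr (_ * _); apply: IHd.
apply: leq_ltn_trans dm; rewrite !mdegE; apply: leq_sum => k _.
by rewrite mnmBE leq_subr.
Qed.

Lemma sq_rot p : sq (rot O p) = sq p.
Proof. by rewrite sq.unlock ip.unlock -rot_cj -rotM gE_rot. Qed.

End rotation.

(** The Householder reflection in the hyperplane orthogonal to u = x - y. *)
Lemma reflection (x y : 'I_n -> R) : enorm x = enorm y ->
  exists2 O : 'M[R]_n, O *m O^T = 1%:M & rotv O x =1 y.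
Proof.
move=> exy.
have [xy|/existsNP[i0 xy]] := pselect (forall i, x i = y i).
  exists 1%:M; first by rewrite trmx1 mulmx1.
  move=> i; rewrite /rotv (bigD1 i)//= mxE eqxx mul1r big1 ?addr0// => j ji.
  by rewrite mxE eq_sym (negbTE ji) mul0r.
pose u i := x i - y i.
pose U : 'cV[R]_n := \col_i u i.
pose s := \sum_i u i ^+ 2.
have s0 : s != 0.
  rewrite psumr_neq0; last by move=> i _; exact: sqr_ge0.
  apply/hasP; exists i0; first exact: mem_index_enum.
  by rewrite /= lt_def sqr_ge0 andbT expf_eq0 /= subr_eq0; apply/eqP.
(* The equality of the lengths enters here: it makes |x - y|^2 equal to 2 (x - y).x, so that the
   reflection subtracts exactly u from x. *)
have sE : s = 2 * \sum_i u i * x i.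
  have : \sum_i x i ^+ 2 = \sum_i y i ^+ 2 by rewrite -!enorm_sqr exy.
  move=> h; apply/eqP; rewrite -subr_eq0 -[X in _ == X](subrr (\sum_i x i ^+ 2)) {1}h.
  rewrite mulr_sumr -!sumrB; apply/eqP; apply: eq_bigr => i _; rewrite /u; ring.
have UU : U^T *m U = s%:M.
  apply/matrixP => i j; rewrite !ord1 !mxE mulr1n; apply: eq_bigr => k _.
  by rewrite !mxE expr2.
pose O := 1%:M - (2 / s) *: (U *m U^T).
exists O.
  have -> : O^T = O by rewrite /O linearB linearZ/= trmx1 trmx_mul trmxK.
  rewrite /O mulmxBl mul1mx mulmxBr mulmx1 -scalemxAl -scalemxAr scalerA.
  rewrite -mulmxA (mulmxA U^T) UU mul_scalar_mx -scalemxAr scalerA.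
  have -> : 2 / s * (2 / s) * s = 2 / s + 2 / s by field.
  rewrite scalerDl; move: ((2 / s) *: _) => a.
  by rewrite [X in _ - X](_ : _ = - a) ?opprK ?subrK// opprD addrA subrr sub0r.
move=> i; rewrite /rotv.
transitivity (\sum_j ((i == j)%:R * x j - 2 / s * u i * (u j * x j))).
  apply: eq_bigr => j _; rewrite !mxE big_ord1 !mxE; ring.
rewrite sumrB -mulr_sumr (bigD1 i)//= eqxx mul1r big1 ?addr0; last first.
  by move=> j ji; rewrite eq_sym (negbTE ji) mul0r.
have -> : \sum_j u j * x j = s / 2 by rewrite sE mulrC mulKf ?pnatr_eq0.
by rewrite /u; field.
Qed.

(** * Comparison of the norm with the supremum on the sphere *)

Lemma ev_scale d p (t : R) v : homogeneous d p ->
  ev p (fun i => t * v i) = (t ^+ d)%:C * ev p v.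
Proof.
move=> /dhomogP hp; rewrite (mpolyE p).
have evs (w : 'I_n -> R) : ev (\sum_(m <- msupp p) mcoeff m p *: mpolyX C m) w =
    \sum_(m <- msupp p) mcoeff m p * (\prod_(i < n) w i ^+ m i)%:C.
  rewrite (big_morph (fun q => ev q w) (fun a b => evD a b w) (ev0 w)).
  by apply: eq_bigr => m _; rewrite evZ evX.
rewrite !evs mulr_sumr !big_seq; apply: eq_bigr => m /hp /= <-.
rewrite [RHS]mulrCA; congr (_ * _); rewrite -rmorphM; congr (_%:C).
under eq_bigr do rewrite exprMn.
by rewrite big_split/= prodrXr -mdegE.
Qed.

Lemma enorm_scale (t : R) v : enorm (fun i => t * v i) = `|t| * enorm v.
Proof.
rewrite /enorm; under eq_bigr do rewrite exprMn.
by rewrite -mulr_sumr sqrtrM ?sqr_ge0// sqrtr_sqr.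
Qed.

(* The reproducing kernel of the homogeneous polynomials of degree d is invariant under
   reflections, hence a multiple of |v|^(2d) on the diagonal; integrating it gives the
   dimension. *)
Lemma sup_le d p v : (0 < n)%N -> homogeneous d p ->
  wt d * gmoment 0 ^+ n * Normc.normc (ev p v) ^+ 2 <= (d.+1 ^ n)%:R * sq p * enorm v ^+ (2 * d).
Proof.
move=> n0 hp.
have [e [se he1 he2 he3]] := homog_basis d.
pose k v := \sum_(f <- e) Normc.normc (ev f v) ^+ 2.
(* [h v] is the kernel function at [v]: pairing with it evaluates at [v], as [iph] shows. Its value
   at [v] and its squared norm are both [k v]. *)
pose h v := \sum_(f <- e) (ev f v)^* *: f.
have evs (F : M -> C) w : ev (\sum_(f <- e) F f *: f) w = \sum_(f <- e) F f * ev f w.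
  rewrite (big_morph (fun q => ev q w) (fun a b => evD a b w) (ev0 w)).
  by apply: eq_bigr => m _; rewrite evZ.
have hh w : homogeneous d (h w).
  by rewrite /h big_seq; apply: rpred_sum => f fe; apply: rpredZ; exact: he1.
have iph q w : homogeneous d q -> ip q (h w) = ev q w.
  move=> hq; rewrite -[in RHS](he3 _ hq) evs.
  rewrite /h (big_morph (ip q) (fun a b => ipDr a b q) (_ : _ = 0)).
    by apply: eq_bigr => f _; rewrite ipZr conjcK mulrC.
  by rewrite ip_conj ip0l conjc0.
have evh w : ev (h w) w = (k w)%:C.
  rewrite evs /k rmorph_sum; apply: eq_bigr => f _ /=.
  by rewrite mulrC -ev_cj -evM ev_sqr.
have sqh w : sq (h w) = k w by rewrite sq.unlock iph// evh.
have k_ge0 w : 0 <= k w by apply: sumr_ge0 => f _; exact: sqr_ge0.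
have evk q w : homogeneous d q -> Normc.normc (ev q w) ^+ 2 <= sq q * k w.
  by move=> hq; rewrite -iph// -sqh; exact: (cauchy_schwarz _ (hh w)).
have k_eq (x y : 'I_n -> R) : x =1 y -> k x = k y.
  by move=> xy; congr k; apply/funext.
have k_rot x y : enorm x = enorm y -> k y <= k x.
  move=> /reflection [A hA xy]; rewrite -(k_eq _ _ xy).
  (* The rotated kernel function at y = Ax takes the value k(y) at x and has squared norm k(y); the
     bound [evk] reads k(y)^2 <= k(y) k(x). *)
  have := evk _ x (rot_homog A (hh (rotv A x))).
  rewrite sq_rot// sqh ev_rot evh normc_real real_normK ?num_real// expr2.
  have := k_ge0 (rotv A x); rewrite le_eqVlt => /predU1P[<- _|k0]; first exact: k_ge0.
  by rewrite ler_pM2l.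
pose u0 : 'I_n -> R := fun i => (i == Ordinal n0)%:R.
have u01 : enorm u0 = 1.
  rewrite /enorm (bigD1 (Ordinal n0))//= /u0 eqxx expr1n big1 ?addr0 ?sqrtr1// => i ii.
  by rewrite (negbTE ii) expr0n.
have kE w : k w = enorm w ^+ (2 * d) * k u0.
  transitivity (k (fun i => enorm w * u0 i)).
    have ee : enorm (fun i => enorm w * u0 i) = enorm w.
      by rewrite enorm_scale u01 mulr1 ger0_norm// enorm_ge0.
    by apply/eqP; rewrite eq_le !k_rot.
  rewrite /k mulr_sumr !big_seq; apply: eq_bigr => f fe.
  rewrite (ev_scale _ _ (he1 _ fe)) Normc.normcM exprMn normc_real.
  by rewrite real_normK ?num_real// mulnC exprM.
have key : (size e)%:R = k u0 * (wt d * gmoment 0 ^+ n).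
  pose K := \sum_(f <- e) f * cj f.
  have evK w : ev K w = (k w)%:C.
    rewrite /K (big_morph (fun q => ev q w) (fun a b => evD a b w) (ev0 w)).
    by rewrite /k rmorph_sum; apply: eq_bigr => f _; rewrite ev_sqr.
  have -> : (size e)%:R = complex.Re (gE K).
    rewrite /K (big_morph (@gE R n) gED gE0) (big_morph _ ReD (_ : _ = 0))//.
    rewrite -sum1_size natr_sum !big_seq; apply: eq_bigr => f fe.
    by rewrite -(he2 _ fe) sq.unlock ip.unlock.
  have gEr : gE (r2 ^+ d) = (wt d * gmoment 0 ^+ n)%:C.
    have := @gE_r2n 0 d 1 (dhomog1 _ _).
    rewrite /wt big_ord0 mul1r mulr1 add0n -/(wt d) => ->.
    rewrite rmorphM; congr (_ * _).
    transitivity (sq (1 : M))%:C; last by rewrite sq1.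
    by rewrite -ip_sq ip.unlock -(mpolyX0 n C) cjX mpolyX0 mulr1.
  have -> : k u0 * (wt d * gmoment 0 ^+ n) = complex.Re (gE ((k u0)%:C *: r2 ^+ d)).
    by rewrite gEZ gEr ReZ.
  (* The two polynomials are only known to agree as functions; positivity of [gE] applied to both
     differences gives equal integrals. *)
  apply/eqP; rewrite eq_le -subr_ge0 -ReB -gEB -[X in _ && X]subr_ge0 -[X in _ && (_ <= X)]ReB -gEB.
  by apply/andP; split; apply: gE_ge0 => w; rewrite evB ReB evK evZ ReZ ev_r2n /= (kE w) mulrC subrr.
have g0 : 0 <= wt d * gmoment 0 ^+ n by rewrite mulr_ge0 ?exprn_ge0 ?ltW ?wt_gt0 ?gmoment0_gt0.
apply: le_trans (ler_wpM2l g0 (evk p v hp)) _.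
rewrite kE [leLHS](_ : _ = (k u0 * (wt d * gmoment 0 ^+ n)) * (sq p * enorm v ^+ (2 * d))); last ring.
rewrite -key -mulrA ler_wpM2r ?ler_nat//.
by rewrite mulr_ge0 ?sq_ge0 ?exprn_ge0 ?enorm_ge0.
Qed.

(* [nrm d p] is, up to a constant factor, the L^2 norm of [p] on the unit sphere when [p]
   is homogeneous of degree [d]. *)
Definition nrm d p : R := Num.sqrt (sq p / wt d).

Lemma nrm_ge0 d p : 0 <= nrm d p. Proof. exact: sqrtr_ge0. Qed.

Hypothesis n0 : (0 < n)%N.

Lemma nrm_sqr d p : nrm d p ^+ 2 = sq p / wt d.
Proof. by rewrite sqr_sqrtr// divr_ge0 ?sq_ge0// ltW// wt_gt0. Qed.

Lemma nrm0 d : nrm d 0 = 0.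
Proof. by rewrite /nrm sq0 mul0r sqrtr0. Qed.

Lemma le_of_sqr (x y : R) : 0 <= y -> x ^+ 2 <= y ^+ 2 -> x <= y.
Proof. by move=> y0 h; rewrite leNgt; apply/negP => yx; nra. Qed.

Lemma nrmD d p q : homogeneous d q -> nrm d (p + q) <= nrm d p + nrm d q.
Proof.
move=> hq; have w0 := wt_gt0 d n0.
apply: le_of_sqr; first by rewrite addr_ge0 ?nrm_ge0.
rewrite sqrrD !nrm_sqr sqD.
have h : complex.Re (ip p q) / wt d <= nrm d p * nrm d q.
  rewrite (le_trans (ler_norm _))//.
  apply: le_of_sqr; first by rewrite mulr_ge0 ?nrm_ge0.
  rewrite exprMn !nrm_sqr real_normK ?num_real// expr_div_n mulf_div -expr2 ler_wpM2r ?invr_ge0 ?sqr_ge0//.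
  apply: le_trans (cauchy_schwarz p hq).
  case: (ip p q) => a b /=; rewrite sqr_sqrtr ?addr_ge0 ?sqr_ge0//.
  by rewrite lerDl sqr_ge0.
rewrite !mulrDl -mulrA; move: h; rewrite -mulr_natl; lra.
Qed.

Lemma nrm_sum d (I : Type) (s : seq I) (P : pred I) (F : I -> M) :
  (forall j : I, P j -> homogeneous d (F j)) ->
  nrm d (\sum_(i <- s | P i) F i) <= \sum_(i <- s | P i) nrm d (F i).
Proof.
move=> hF; elim: s => [|i s IH]; first by rewrite !big_nil nrm0.
rewrite !big_cons; case: ifP => // Pi.
rewrite (le_trans (nrmD _ _))// ?lerD2l//.
by apply: rpred_sum => j Pj; exact: hF.
Qed.

Lemma nrmZ d c p : nrm d (c *: p) = Normc.normc c * nrm d p.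
Proof.
by rewrite /nrm sqZ -mulrA sqrtrM ?sqr_ge0// sqrtr_sqr ger0_norm// normc_ge0.
Qed.

(** Two contributions of order [d] to the square: 2(d+1) from [bernstein], and n/2 + d from the
    change of weight between the degrees d + 1 and d. *)
Lemma nrm_deriv d i p : homogeneous d.+1 p ->
  nrm d (mderiv i p) <= 2 * (d + n).+1%:R * nrm d.+1 p.
Proof.
move=> hp; have w0 := wt_gt0 d n0.
apply: le_of_sqr; first by rewrite !mulr_ge0 ?nrm_ge0.
rewrite exprMn !nrm_sqr.
have -> : wt d.+1 = wt d * (n%:R / 2 + d%:R) by rewrite /wt big_ord_recr.
have a0 : 0 < n%:R / 2 + d%:R :> R by rewrite ltr_wpDr// divr_gt0// ltr0n.
rewrite ler_pdivrMr// (le_trans (bernstein i hp))//.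
have e (c x w z : R) : 0 < c -> 0 < w -> z * (x / (w * c)) * w = z / c * x.
  by move=> hc hw; field; rewrite !gt_eqF.
rewrite (e _ _ _ _ a0 w0).
rewrite ler_wpM2r ?sq_ge0// ler_pdivlMr//.
rewrite -(natr1 (d + n)) -(natr1 d) natrD.
have : 0 <= n%:R :> R by []. have : 0 <= d%:R :> R by [].
move: (n%:R : R) (d%:R : R) => x y y0 x0; have := mulr_ge0 x0 y0; nra.
Qed.

(** The purpose of the normalization: the weights in [sq_mul_le] cancel, and no power of the degree
    is lost. *)
Lemma nrmM m j (s : R) f g : 0 <= s -> homogeneous m g ->
  (forall v, Normc.normc (ev f v) <= s * enorm v ^+ j) ->
  nrm (m + j) (f * g) <= s * nrm m g.
Proof.
move=> s0 hg hf; apply: le_of_sqr; first by rewrite mulr_ge0 ?nrm_ge0.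
rewrite exprMn !nrm_sqr.
rewrite ler_pdivrMr ?wt_gt0// (_ : s ^+ 2 * _ * _ = s ^+ 2 * wt (m + j) * sq g / wt m); last ring.
rewrite ler_pdivlMr ?wt_gt0// mulrC.
exact: sq_mul_le.
Qed.

Lemma nrm_le_sup d (s : R) p : 0 <= s ->
  (forall v, Normc.normc (ev p v) <= s * enorm v ^+ d) ->
  nrm d p <= s * Num.sqrt (gmoment 0 ^+ n).
Proof.
move=> s0 hp; have := nrmM s0 (dhomog1 _ _) hp.
by rewrite add0n mulr1 {2}/nrm /wt big_ord0 divr1 sq1.
Qed.

Lemma sup_le_nrm d p v : homogeneous d p ->
  Normc.normc (ev p v) <= Num.sqrt ((d.+1 ^ n)%:R / gmoment 0 ^+ n) * nrm d p * enorm v ^+ d.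
Proof.
move=> hp; have g0 : 0 < gmoment 0 ^+ n :> R by rewrite exprn_gt0 ?gmoment0_gt0.
apply: le_of_sqr.
  by rewrite !mulr_ge0 ?nrm_ge0 ?exprn_ge0 ?enorm_ge0 ?sqrtr_ge0.
rewrite !exprMn nrm_sqr sqr_sqrtr ?divr_ge0 ?(ltW g0)// -exprM mulnC.
have := sup_le v n0 hp; rewrite mulrC -ler_pdivlMr ?mulr_gt0 ?wt_gt0// => /le_trans; apply.
rewrite le_eqVlt; apply/orP; left; apply/eqP; field.
by rewrite !gt_eqF ?wt_gt0 ?gmoment0_gt0.
Qed.

End gaussian_functional.

(** * Series of homogeneous polynomials *)

Section complex_series.
Context {R : realType}.
Local Notation C := R[i].
Local Notation normc := Normc.normc.
Implicit Types (c d : nat -> C) (s t : C) (K q : R).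

Definition is_sum c s := forall e : R, 0 < e ->
  exists N, forall k, (N <= k)%N -> normc (s - \sum_(m < k) c m) < e.

Lemma normcB (x y : C) : normc (x - y) = normc (y - x).
Proof. by rewrite -normcN opprB. Qed.

Lemma normc_tri (x y z : C) : normc (x - z) <= normc (x - y) + normc (y - z).
Proof. by rewrite (le_trans _ (le_normcD _ _))// addrA subrK. Qed.

Lemma normc_sum (I : Type) (r : seq I) (P : pred I) (F : I -> C) :
  normc (\sum_(i <- r | P i) F i) <= \sum_(i <- r | P i) normc (F i).
Proof.
elim/big_rec2: _ => [|i y x _ IH]; first by rewrite Normc.normc0.
by rewrite (le_trans (le_normcD _ _))// lerD2l.
Qed.

Lemma normc_re (z : C) : `|complex.Re z| <= normc z.
Proof.
case: z => a b /=; rewrite -(sqrtr_sqr a) ler_sqrt ?lerDl ?sqr_ge0//.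
by rewrite addr_ge0 ?sqr_ge0.
Qed.

Lemma normc_im (z : C) : `|complex.Im z| <= normc z.
Proof.
case: z => a b /=; rewrite -(sqrtr_sqr b) ler_sqrt ?lerDr ?sqr_ge0//.
by rewrite addr_ge0 ?sqr_ge0.
Qed.

Lemma normc_le_re_im (z : C) : normc z <= `|complex.Re z| + `|complex.Im z|.
Proof.
rewrite [in leLHS](complexE z) (le_trans (le_normcD _ _))// Normc.normcM !normc_real.
by rewrite /= expr0n expr1n add0r sqrtr1 mul1r.
Qed.

Lemma is_sum_unique c s t : is_sum c s -> is_sum c t -> s = t.
Proof.
move=> hs ht; apply/eqP; rewrite -subr_eq0; apply/eqP/Normc.eq0_normc.
apply/eqP; rewrite eq_le normc_ge0 andbT; apply/ler_addgt0Pr => e e0.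
have [N hN] := hs _ (divr_gt0 e0 (ltr0Sn R 1)); have [N' hN'] := ht _ (divr_gt0 e0 (ltr0Sn R 1)).
have h1 := hN _ (leq_maxl N N'); have h2 := hN' _ (leq_maxr N N').
have := normc_tri s (\sum_(m < maxn N N') c m) t.
rewrite (normcB (\sum_(m < _) _) t); lra.
Qed.

Lemma is_sumD c d s t : is_sum c s -> is_sum d t -> is_sum (fun m => c m + d m) (s + t).
Proof.
move=> hs ht e e0.
have [N hN] := hs _ (divr_gt0 e0 (ltr0Sn R 1)); have [N' hN'] := ht _ (divr_gt0 e0 (ltr0Sn R 1)).
exists (maxn N N') => k; rewrite geq_max => /andP[/hN h1 /hN' h2].
rewrite big_split/= opprD addrACA (le_lt_trans (le_normcD _ _))//; lra.
Qed.

Lemma is_sumZ a c s : is_sum c s -> is_sum (fun m => a * c m) (a * s).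
Proof.
move=> hs e e0.
have a0 : 0 < normc a + 1 by rewrite ltr_wpDl// normc_ge0.
have [N hN] := hs _ (divr_gt0 e0 a0); exists N => k /hN h.
rewrite -mulr_sumr -mulrBr Normc.normcM.
rewrite (@le_lt_trans _ _ ((normc a + 1) * normc (s - \sum_(m < k) c m)))//.
  by rewrite ler_wpM2r ?normc_ge0// lerDl.
by rewrite mulrC -ltr_pdivlMr.
Qed.

Lemma is_sum0 : is_sum (fun=> 0) 0.
Proof.
by move=> e e0; exists 0%N => k _; rewrite big1 ?subrr ?Normc.normc0.
Qed.

Lemma is_sum_sum (I : Type) (r : seq I) (P : pred I) (F : I -> nat -> C) (G : I -> C) :
  (forall i, P i -> is_sum (F i) (G i)) ->
  is_sum (fun m => \sum_(i <- r | P i) F i m) (\sum_(i <- r | P i) G i).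
Proof.
move=> h; elim: r => [|i r IH].
  rewrite big_nil (_ : (fun m => _) = fun=> 0); first exact: is_sum0.
  by apply/funext => m; rewrite big_nil.
rewrite big_cons; case: ifP => Pi.
  rewrite (_ : (fun m => _) = fun m => F i m + \sum_(j <- r | P j) F j m).
    by apply: is_sumD => //; exact: h.
  by apply/funext => m; rewrite big_cons Pi.
rewrite (_ : (fun m => _) = fun m => \sum_(j <- r | P j) F j m)//.
by apply/funext => m; rewrite big_cons Pi.
Qed.

Lemma is_sum_ext c d s : c =1 d -> is_sum c s -> is_sum d s.
Proof. by move=> /funext ->. Qed.

Lemma is_sum_shift c s : c 0%N = 0 -> is_sum (fun m => c m.+1) s -> is_sum c s.
Proof.
move=> c0 h e /h[N hN]; exists N.+1 => -[//|k] /hN.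
by rewrite big_ord_recl c0 add0r.
Qed.

Lemma is_sum_single c : (forall m, c m.+1 = 0) -> is_sum c (c 0%N).
Proof.
move=> h e e0; exists 1%N => -[//|k] _.
have e0' : \sum_(i < k) c (lift ord0 i) = 0 by apply: big1 => i _; exact: h.
by rewrite big_ord_recl e0' addr0 subrr Normc.normc0.
Qed.

Section geometric_domination.
Variables (K q : R).
Hypotheses (q0 : 0 <= q) (q1 : q < 1).

Definition dom c := forall m, normc (c m) <= K * q ^+ m.

Let K_ge0 c : dom c -> 0 <= K.
Proof. by move=> /(_ 0%N); rewrite expr0 mulr1; apply: le_trans; exact: normc_ge0. Qed.

Lemma dom_partial c k l : dom c -> (k <= l)%N ->
  normc (\sum_(m < l) c m - \sum_(m < k) c m) <= K * (q ^+ k - q ^+ l) / (1 - q).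
Proof.
move=> h; have q2 : 1 - q != 0 by rewrite subr_eq0 gt_eqF.
elim: l => [|l IH]; first by rewrite leqn0 => /eqP ->; rewrite !subrr Normc.normc0 mulr0 mul0r.
rewrite leq_eqVlt => /predU1P[->|]; first by rewrite !subrr Normc.normc0 mulr0 mul0r.
rewrite ltnS => /IH {}IH; rewrite big_ord_recr/= addrAC.
rewrite (le_trans (le_normcD _ _))//.
rewrite (le_trans (lerD IH (h l)))// le_eqVlt; apply/orP; left; apply/eqP.
by rewrite exprS; field.
Qed.

Lemma dom_partial' c k l : dom c -> (k <= l)%N ->
  normc (\sum_(m < l) c m - \sum_(m < k) c m) <= K * q ^+ k / (1 - q).
Proof.
move=> h kl; rewrite (le_trans (dom_partial h kl))//.
rewrite ler_wpM2r ?invr_ge0 ?subr_ge0 ?(ltW q1)//.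
by rewrite ler_wpM2l ?(K_ge0 h)// gerBl exprn_ge0.
Qed.

Lemma dom_tail c s k : dom c -> is_sum c s ->
  normc (s - \sum_(m < k) c m) <= K * q ^+ k / (1 - q).
Proof.
move=> h hs; apply/ler_addgt0Pr => e /hs[N hN].
have h1 := hN _ (leq_maxl N k); have h2 := dom_partial' h (leq_maxr N k).
have := normc_tri s (\sum_(m < maxn N k) c m) (\sum_(m < k) c m); lra.
Qed.

Lemma dom_sum_le c s : dom c -> is_sum c s -> normc s <= K / (1 - q).
Proof. by move=> h /(dom_tail 0 h); rewrite big_ord0 subr0 expr0 mulr1. Qed.

Lemma dom_cvg (f : C -> R) c : dom c -> (forall z, `|f z| <= normc z) ->
  cvgn (series (fun m => f (c m))).
Proof.
move=> h hf; apply: normed_cvg.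
apply: (@series_le_cvg _ _ (geometric K q)).
- by move=> m; exact: normr_ge0.
- by move=> m; rewrite /geometric /= mulr_ge0 ?(K_ge0 h)// exprn_ge0.
- by move=> m; rewrite (le_trans (hf _))// (le_trans (h m)).
- by apply: is_cvg_geometric_series; rewrite ger0_norm.
Qed.

Lemma dom_is_sum c : dom c -> exists s, is_sum c s.
Proof.
move=> h.
have /cvg_ex[/= x hx] := dom_cvg h normc_re; have /cvg_ex[/= y hy] := dom_cvg h normc_im.
exists (x +i* y) => e e0; have e2 := divr_gt0 e0 (ltr0Sn R 1).
have /cvgrPdist_lt /(_ _ e2) [N _ hN] := hx.
have /cvgrPdist_lt /(_ _ e2) [N' _ hN'] := hy.
exists (maxn N N') => k; rewrite geq_max => /andP[/hN h1 /hN' h2].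
rewrite (le_lt_trans (normc_le_re_im _))//.
move: h1 h2; rewrite /series /= !big_mkord.
have -> : \sum_(m < k) complex.Re (c m) = complex.Re (\sum_(m < k) c m) by rewrite raddf_sum.
have -> : \sum_(m < k) complex.Im (c m) = complex.Im (\sum_(m < k) c m) by rewrite raddf_sum.
by case: (\sum_(m < k) c m) => a b /=; lra.
Qed.

Lemma dom_is_sum_tail c s : (forall k, normc (s - \sum_(m < k) c m) <= K * q ^+ k) -> is_sum c s.
Proof.
move=> h e e0; have : (fun k => K * q ^+ k) @ \oo --> 0.
  by apply: cvg_geometric; rewrite ger0_norm.
move=> /cvgrPdist_lt /(_ _ e0) [N _ hN]; exists N => k /hN /=.
rewrite sub0r normrN; apply: le_lt_trans; exact: le_trans (h k) (ler_norm _).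
Qed.

End geometric_domination.

(** Each power of m + 1 is paid for by part of the ratio: q = p r with p halfway between q and 1,
    where Bernoulli's inequality for 1/r bounds (m+1) r^m and the induction hypothesis handles p. *)
Lemma poly_geom (k : nat) q : 0 <= q < 1 ->
  exists K, 0 <= K /\ forall m : nat, (m.+1)%:R ^+ k * q ^+ m <= K.
Proof.
elim: k q => [|k IH] q /andP[q0 q1].
  by exists 1; split => // m; rewrite expr0 mul1r exprn_ile1// ltW.
pose p := (1 + q) / 2.
have p0 : 0 < p by rewrite /p; lra.
have p1 : p < 1 by rewrite /p; lra.
have qp : q / p < 1 by rewrite ltr_pdivrMr// mul1r /p; lra.
have [|K [K0 hK]] := IH p; first by rewrite ltW.
have qp0 : 0 <= q / p by rewrite divr_ge0// ltW.
have [r0|r0] := eqVneq (q / p) 0.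
  exists K; split => // m; have q00 : q = 0.
    by move/eqP: r0; rewrite mulf_eq0 invr_eq0 (gt_eqF p0) orbF => /eqP.
  case: m => [|m]; last by rewrite q00 expr0n mulr0.
  by rewrite expr1n mul1r expr0 (le_trans _ (hK 0%N))// expr1n expr0 mul1r.
pose r := q / p.
have rgt : 0 < r by rewrite lt_def r0.
pose h := r^-1 - 1.
have h0 : 0 < h by rewrite subr_gt0 invf_gt1.
have bern m : 1 + m%:R * h <= r^-1 ^+ m.
  elim: m => [|m IHm]; first by rewrite mul0r addr0 expr0.
  rewrite exprS (le_trans _ (ler_wpM2l _ IHm)) ?invr_ge0//.
  have -> : r^-1 = 1 + h by rewrite /h addrC subrK.
  rewrite -natr1; have := mulr_ge0 (ler0n R m) (sqr_ge0 h); nra.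
have hr m : (m.+1)%:R * r ^+ m <= 1 + h^-1.
  have := bern m; rewrite exprVn -[_^-1]mul1r ler_pdivlMr ?exprn_gt0// => b.
  have rm0 : 0 <= r ^+ m by rewrite exprn_ge0.
  have rm1 : r ^+ m <= 1 by rewrite exprn_ile1// ltW.
  rewrite -natr1 mulrDl mul1r addrC lerD// -[_^-1]mul1r ler_pdivlMr//.
  by rewrite mulrAC; move: b; rewrite mulrDl mul1r; lra.
exists (K * (1 + h^-1)); split; first by rewrite mulr_ge0// addr_ge0// invr_ge0 ltW.
move=> m; rewrite exprS.
have -> : q = p * r by rewrite /r mulrCA divff ?mulr1 ?gt_eqF.
rewrite exprMn [leLHS](_ : _ = (m.+1%:R ^+ k * p ^+ m) * (m.+1%:R * r ^+ m)); last ring.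
by rewrite ler_pM// mulr_ge0// exprn_ge0// ltW.
Qed.

(** With a common geometric majorant the error after k terms is O((k+1) q^k), because every term of
    the regrouped sum has an error of order q^j q^(k-j). A ratio between q and 1 absorbs the factor
    k + 1. *)
Lemma is_sum_cauchy K q c d s t : 0 <= q -> q < 1 ->
  dom K q c -> dom K q d -> is_sum c s -> is_sum d t ->
  is_sum (fun m => \sum_(j < m.+1) c j * d (m - j)%N) (s * t).
Proof.
move=> q0 q1 hc hd hs ht.
have K0 : 0 <= K by have := hc 0%N; rewrite expr0 mulr1; apply: le_trans; exact: normc_ge0.
have D k : \sum_(m < k) \sum_(j < m.+1) c j * d (m - j)%N =
    \sum_(j < k) c j * \sum_(l < (k - j)%N) d l.
  elim: k => [|k IH]; first by rewrite !big_ord0.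
  rewrite big_ord_recr/= {}IH [in RHS]big_ord_recr/= [X in _ + X = _]big_ord_recr/=.
  rewrite subSnn subnn big_ord1 addrA; congr (_ + _).
  rewrite -big_split/=; apply: eq_bigr => j _.
  by rewrite -mulrDr (subSn (ltnW (ltn_ord j))) big_ord_recr.
pose T := normc t; pose L := (K * T + K ^+ 2) / (1 - q).
have q2 : 0 < 1 - q by rewrite subr_gt0.
have main k : normc (s * t - \sum_(m < k) \sum_(j < m.+1) c j * d (m - j)%N) <=
    L * (k.+1%:R * q ^+ k).
  rewrite D.
  have -> : s * t - \sum_(j < k) c j * \sum_(l < (k - j)%N) d l =
     (s - \sum_(m < k) c m) * t + \sum_(j < k) c j * (t - \sum_(l < (k - j)%N) d l).
    under [X in _ = _ + X]eq_bigr do rewrite mulrBr.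
    by rewrite sumrB -mulr_suml mulrBl addrA subrK.
  rewrite (le_trans (le_normcD _ _))//.
  have h1 := dom_tail q0 q1 k hc hs.
  have h2 : normc (\sum_(j < k) c j * (t - \sum_(l < (k - j)%N) d l)) <= k%:R * (K ^+ 2 * q ^+ k / (1 - q)).
    rewrite (le_trans (normc_sum _ _ _))//.
    rewrite mulr_natl -[X in _ <= _ *+ X]card_ord -sumr_const; apply: ler_sum => j _.
    rewrite Normc.normcM.
    have -> : K ^+ 2 * q ^+ k / (1 - q) = (K * q ^+ j) * (K * q ^+ (k - j) / (1 - q)).
      by rewrite -[in LHS](subnKC (ltnW (ltn_ord j))) exprD; ring.
    by rewrite ler_pM ?normc_ge0// (dom_tail q0 q1).
  rewrite Normc.normcM -/T.
  have T0 : 0 <= T by exact: normc_ge0.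
  have h3 := ler_wpM2r T0 h1.
  apply: le_trans (lerD h3 h2) _; rewrite -subr_ge0.
  rewrite [X in 0 <= X](_ : _ = q ^+ k / (1 - q) * (K * T * k%:R + K ^+ 2)).
    by rewrite mulr_ge0 ?divr_ge0 ?exprn_ge0 ?(ltW q2)// addr_ge0 ?mulr_ge0 ?sqr_ge0.
  by rewrite /L -natr1; ring.
pose p := (1 + q) / 2.
have p0 : 0 < p by rewrite /p; lra.
have p1 : p < 1 by rewrite /p; lra.
have [|K' [K'0 hK']] := @poly_geom 1 (q / p).
  by rewrite divr_ge0 ?(ltW p0)//= ltr_pdivrMr// mul1r /p; lra.
apply: (@dom_is_sum_tail (L * K') p) => [||k]; [exact: ltW|exact: p1|].
rewrite (le_trans (main k))// -mulrA ler_wpM2l//.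
  by rewrite /L divr_ge0 ?(ltW q2)// addr_ge0 ?mulr_ge0 ?sqr_ge0 ?normc_ge0.
have := hK' k; rewrite expr1 expr_div_n mulrA ler_pdivrMr ?exprn_gt0//.
Qed.

End complex_series.

(** * Graded power series and their growth *)

Section power_series.
Context {R : realType} {n : nat} (n0 : (0 < n)%N).
Local Notation C := R[i].
Local Notation normc := Normc.normc.
Local Notation M := (mpoly n C).
Implicit Types (u w : nat -> M) (v x y h : 'I_n -> R) (rho r : R).

Definition graded u := forall m, homogeneous m (u m).

(** The series counterpart of A(B_rho); [Aball_ser] and [ser_Aball] pass between the two. *)
Definition Gr rho u := graded u /\ forall r, 0 < r < rho ->
  exists2 K, 0 <= K & forall m, nrm m (u m) * r ^+ m <= K.

Definition sser u w : nat -> M := fun m => u m + w m.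
Definition zser (c : C) u : nat -> M := fun m => c *: u m.
Definition mser u w : nat -> M := fun m => \sum_(j < m.+1) u j * w (m - j)%N.
Definition dser (i : 'I_n) u : nat -> M := fun m => mderiv i (u m.+1).

Lemma GrD rho u w : Gr rho u -> Gr rho w -> Gr rho (sser u w).
Proof.
move=> [gu hu] [gw hw]; split; first by move=> m; apply: rpredD; [exact: gu|exact: gw].
move=> r hr; have [K K0 hK] := hu _ hr; have [K' K'0 hK'] := hw _ hr.
have r0 : 0 <= r by case/andP: hr => /ltW.
exists (K + K') => [|m]; first exact: addr_ge0.
apply: le_trans (lerD (hK m) (hK' m)).
by rewrite -mulrDl ler_wpM2r ?exprn_ge0// nrmD.
Qed.

Lemma GrZ rho c u : Gr rho u -> Gr rho (zser c u).
Proof.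
move=> [gu hu]; split; first by move=> m; apply: rpredZ; exact: gu.
move=> r hr; have [K K0 hK] := hu _ hr.
exists (normc c * K) => [|m]; first by rewrite mulr_ge0 ?normc_ge0.
by rewrite nrmZ -mulrA ler_wpM2l ?normc_ge0.
Qed.

Lemma Gr0 rho : Gr rho (fun=> 0).
Proof.
split; first by move=> m; exact: rpred0.
by move=> r hr; exists 0 => // m; rewrite nrm0 mul0r.
Qed.

Lemma Gr_sum rho (I : Type) (s : seq I) (P : pred I) (F : I -> nat -> M) :
  (forall i, P i -> Gr rho (F i)) -> Gr rho (fun m => \sum_(i <- s | P i) F i m).
Proof.
move=> hF; elim: s => [|i s IH].
  rewrite (_ : (fun m => _) = fun=> 0); first exact: Gr0.
  by apply/funext => m; rewrite big_nil.
case Pi : (P i).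
  rewrite (_ : (fun m => _) = sser (F i) (fun m => \sum_(i <- s | P i) F i m)).
    by apply: GrD => //; exact: hF.
  by apply/funext => m; rewrite big_cons Pi.
rewrite (_ : (fun m => _) = (fun m => \sum_(i <- s | P i) F i m))//.
by apply/funext => m; rewrite big_cons Pi.
Qed.

Lemma Gr_le rho rho' u : rho' <= rho -> Gr rho u -> Gr rho' u.
Proof.
move=> le [gu hu]; split => // r /andP[r0 r1]; apply: hu.
by rewrite r0 (lt_le_trans r1).
Qed.

Lemma mid_ex (a b : R) : a < b -> exists2 c, a < c & c < b.
Proof. by move=> ab; exists ((a + b) / 2); lra. Qed.

(** The loss of order m per derivative is absorbed by a radius [r1] strictly between [r] and
    [rho]. *)
Lemma Gr_deriv rho i u : Gr rho u -> Gr rho (dser i u).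
Proof.
move=> [gu hu]; split; first by move=> m; apply: homog_deriv; exact: gu.
move=> r /andP[r0 /mid_ex[r1 h1 h2]].
have r10 : 0 < r1 by exact: lt_trans h1.
have [|K K0 hK] := hu r1; first by rewrite r10.
have [|K' [K'0 hK']] := @poly_geom R 1 (r / r1).
  by rewrite divr_ge0 ?(ltW r10) ?(ltW r0)//= ltr_pdivrMr// mul1r.
exists (2 * n.+1%:R * K' * (K / r1)) => [|m].
  by rewrite !mulr_ge0 ?invr_ge0 ?(ltW r10).
rewrite /dser (le_trans (ler_wpM2r _ (nrm_deriv n0 i (gu m.+1))))//.
  by rewrite exprn_ge0// ltW.
rewrite [leLHS](_ : _ = 2 * (m + n).+1%:R * (r / r1) ^+ m * ((nrm m.+1 (u m.+1) * r1 ^+ m.+1) / r1)); last first.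
  rewrite expr_div_n exprS; field; by rewrite gt_eqF// gt_eqF ?exprn_gt0.
apply: ler_pM.
- by rewrite !mulr_ge0 ?exprn_ge0 ?divr_ge0 ?(ltW r0) ?(ltW r10).
- by rewrite divr_ge0 ?(ltW r10)// mulr_ge0 ?nrm_ge0// exprn_ge0// ltW.
- rewrite -!mulrA ler_wpM2l//.
  have := hK' m; rewrite expr1 => /(ler_wpM2l (ler0n R n.+1)); apply: le_trans.
  rewrite mulrA ler_wpM2r ?exprn_ge0 ?divr_ge0 ?(ltW r0) ?(ltW r10)//.
  by rewrite -natrM ler_nat; nia.
- by rewrite ler_wpM2r ?invr_ge0 ?(ltW r10).
Qed.

Lemma Gr_sup rho u r : Gr rho u -> 0 < r < rho ->
  exists2 K, 0 <= K & forall m v, normc (ev (u m) v) <= K * (enorm v / r) ^+ m.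
Proof.
move=> [gu hu] /andP[r0 /mid_ex[r1 h1 h2]].
have r10 : 0 < r1 by exact: lt_trans h1.
have [|K K0 hK] := hu r1; first by rewrite r10.
have [|K' [K'0 hK']] := @poly_geom R n (r / r1).
  by rewrite divr_ge0 ?(ltW r10) ?(ltW r0)//= ltr_pdivrMr// mul1r.
have g0 : 0 < gmoment 0 ^+ n :> R by rewrite exprn_gt0 ?gmoment0_gt0.
(* [G] dominates both 1 and the inverse of [gmoment 0 ^+ n], so that the square root below is at
   most (m+1)^n [G]. *)
pose G := 1 + 1 / gmoment 0 ^+ n : R.
have G1 : 1 <= G by rewrite lerDl divr_ge0// ltW.
exists (G * K' * K) => [|m v]; first by rewrite !mulr_ge0// (le_trans _ G1).
rewrite (le_trans (sup_le_nrm n0 v (gu m)))//.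
rewrite expr_div_n mulrA [leRHS]mulrAC ler_wpM2r ?exprn_ge0 ?enorm_ge0//.
rewrite ler_pdivlMr ?exprn_gt0//.
rewrite [leLHS](_ : _ = Num.sqrt ((m.+1 ^ n)%:R / gmoment 0 ^+ n) * (r / r1) ^+ m * (nrm m (u m) * r1 ^+ m)); last first.
  by rewrite expr_div_n; field; rewrite gt_eqF ?exprn_gt0.
rewrite ler_pM ?mulr_ge0 ?sqrtr_ge0 ?exprn_ge0 ?divr_ge0 ?nrm_ge0 ?(ltW r0) ?(ltW r10)//.
apply: le_trans (ler_wpM2l _ (hK' m)); last by rewrite (le_trans _ G1).
rewrite mulrA ler_wpM2r ?exprn_ge0 ?divr_ge0 ?(ltW r0) ?(ltW r10)//.
apply: le_of_sqr; first by rewrite mulr_ge0 ?exprn_ge0// (le_trans _ G1).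
rewrite sqr_sqrtr ?divr_ge0 ?(ltW g0)// -natrX exprMn expr2 mulrC.
have X1 : 1 <= (m.+1 ^ n)%:R :> R by rewrite ler1n expn_gt0.
have : (gmoment 0 ^+ n)^-1 <= G :> R by rewrite /G div1r lerDr.
have : 0 <= (gmoment 0 ^+ n)^-1 :> R by rewrite invr_ge0 ltW.
move: G1 X1; move: ((m.+1 ^ n)%:R) (gmoment 0 ^- n) G => X Y Z Z1 X1 Y0 YZ.
have X0 : 0 <= X by exact: le_trans X1.
have ZX : 1 <= Z * X by rewrite -[leLHS]mulr1 ler_pM.
apply: le_trans (ler_wpM2r X0 YZ) _.
by rewrite -expr2 -exprMn expr2 ler_peMl// (le_trans _ ZX).
Qed.

Lemma Gr_of_sup rho u : graded u ->
  (forall r, 0 < r < rho -> exists2 K, 0 <= K & forall m v, normc (ev (u m) v) <= K * (enorm v / r) ^+ m) ->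
  Gr rho u.
Proof.
move=> gu hu; split => // r hr; have [K K0 hK] := hu _ hr.
have r0 : 0 < r by case/andP: hr.
exists (K * Num.sqrt (gmoment 0 ^+ n)) => [|m]; first by rewrite mulr_ge0 ?sqrtr_ge0.
have := @nrm_le_sup R n n0 m (K / r ^+ m) (u m) _ _.
rewrite -ler_pdivlMr ?exprn_gt0// mulrAC; apply.
  by rewrite divr_ge0// exprn_ge0// ltW.
by move=> v; rewrite (le_trans (hK m v))// expr_div_n mulrAC mulrA.
Qed.

(** One factor is measured by its supremum and the other by [nrm], as [nrmM] demands; the m + 1
    terms of the Cauchy product are absorbed by a larger radius. *)
Lemma Gr_mul rho u w : Gr rho u -> Gr rho w -> Gr rho (mser u w).
Proof.
move=> hu hw; split.
  move=> m; apply: rpred_sum => j _.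
  by move: (dhomogM (hu.1 j) (hw.1 (m - j)%N)); rewrite subnKC// -ltnS.
move=> r hr; have /andP[r0 /mid_ex[r1 h1 h2]] := hr.
have r10 : 0 < r1 by exact: lt_trans h1.
have hr1 : 0 < r1 < rho by rewrite r10.
have [K K0 hK] := Gr_sup hu hr1.
have [K1 K10 hK1] := hw.2 _ hr1.
have [|K' [K'0 hK']] := @poly_geom R 1 (r / r1).
  by rewrite divr_ge0 ?(ltW r10) ?(ltW r0)//= ltr_pdivrMr// mul1r.
exists (K * K1 * K') => [|m]; first by rewrite !mulr_ge0.
have : nrm m (mser u w m) <= m.+1%:R * (K * K1 / r1 ^+ m).
  rewrite /mser (le_trans (nrm_sum n0 _ _))//.
    by move=> j _; move: (dhomogM (hu.1 j) (hw.1 (m - j)%N)); rewrite subnKC// -ltnS.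
  rewrite mulr_natl -[X in _ <= _ *+ X]card_ord -sumr_const; apply: ler_sum => j _.
  have jm : (j <= m)%N by rewrite -ltnS.
  have := @nrmM R n n0 (m - j) j (K / r1 ^+ j) (u j) (w (m - j)%N) _ (hw.1 _) _.
  rewrite subnK// => /(_ _ _)/le_trans; apply.
  - by rewrite divr_ge0// exprn_ge0// ltW.
  - by move=> v; rewrite (le_trans (hK j v))// expr_div_n mulrAC mulrA.
  - rewrite -!mulrA ler_wpM2l// -[in leRHS](subnK jm) exprD.
    have := hK1 (m - j)%N; rewrite -ler_pdivlMr ?exprn_gt0// => h.
    apply: le_trans (ler_wpM2l _ h) _; first by rewrite invr_ge0 exprn_ge0// ltW.
    by rewrite invfM mulrCA (mulrC (_ ^-1)).
move=> /(ler_wpM2r (exprn_ge0 m (ltW r0)))/le_trans; apply.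
have := ler_wpM2l (mulr_ge0 K0 K10) (hK' m); apply: le_trans.
by rewrite expr1 expr_div_n le_eqVlt; apply/orP; left; apply/eqP; ring.
Qed.

(** * Values of graded series *)

Definition hasval u v s := is_sum (fun m => ev (u m) v) s.

Lemma Gr_dom rho u r0 : Gr rho u -> 0 <= r0 < rho -> exists q K, [/\ 0 <= q, q < 1 &
  forall v, enorm v <= r0 -> dom K q (fun m => ev (u m) v)].
Proof.
move=> hu /andP[r00 /mid_ex[r h1 h2]].
have r1 : 0 < r by exact: le_lt_trans h1.
have [|K K0 hK] := Gr_sup (r := r) hu; first by rewrite r1.
exists (r0 / r), K; split; first by rewrite divr_ge0// ltW.
  by rewrite ltr_pdivrMr// mul1r.
move=> v hv m; rewrite (le_trans (hK m v))// ler_wpM2l//.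
rewrite lerXn2r ?nnegrE ?divr_ge0 ?enorm_ge0 ?(ltW r1)//.
by rewrite ler_wpM2r ?invr_ge0 ?(ltW r1).
Qed.

Lemma Gr_hasval rho u v : Gr rho u -> enorm v < rho -> exists s, hasval u v s.
Proof.
move=> hu hv; have [|q [K [q0 q1 h]]] := @Gr_dom rho u (enorm v) hu.
  by rewrite enorm_ge0.
exact: (dom_is_sum q0 q1 (h v (lexx _))).
Qed.

Lemma hasvalD u w v s t : hasval u v s -> hasval w v t -> hasval (sser u w) v (s + t).
Proof.
move=> hs ht; apply: is_sum_ext (is_sumD hs ht) => m.
by rewrite /sser evD.
Qed.

Lemma hasvalZ c u v s : hasval u v s -> hasval (zser c u) v (c * s).
Proof.
move=> hs; apply: is_sum_ext (is_sumZ c hs) => m.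
by rewrite /zser evZ.
Qed.

Lemma ev_sum (I : Type) (r : seq I) (Pr : pred I) (F : I -> M) v :
  ev (\sum_(i <- r | Pr i) F i) v = \sum_(i <- r | Pr i) ev (F i) v.
Proof. exact: (big_morph (fun q => ev q v) (fun a b => evD a b v) (ev0 v)). Qed.

Lemma hasval_sum (I : Type) (r : seq I) (P : pred I) (F : I -> nat -> M) (G : I -> C) v :
  (forall i, P i -> hasval (F i) v (G i)) ->
  hasval (fun m => \sum_(i <- r | P i) F i m) v (\sum_(i <- r | P i) G i).
Proof.
move=> h; apply: is_sum_ext (is_sum_sum r h) => m.
by rewrite ev_sum.
Qed.

Lemma hasvalM rho u w v s t : Gr rho u -> Gr rho w -> enorm v < rho ->
  hasval u v s -> hasval w v t -> hasval (mser u w) v (s * t).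
Proof.
move=> hu hw hv hs ht.
have vv : 0 <= enorm v < rho by rewrite enorm_ge0.
have [q [K [q0 q1 h]]] := Gr_dom hu vv; have [q' [K' [q'0 q'1 h']]] := Gr_dom hw vv.
have mono (A A' p p' : R) (c : nat -> C) : 0 <= p -> p <= p' -> A <= A' -> dom A p c -> dom A' p' c.
  move=> p0 pp AA hc m; have A0 : 0 <= A.
    by have := hc 0%N; rewrite expr0 mulr1; apply: le_trans; exact: normc_ge0.
  rewrite (le_trans (hc m))// ler_pM ?exprn_ge0//.
  by rewrite lerXn2r ?nnegrE// (le_trans p0).
pose qq := Num.max q q'; pose KK := Num.max K K'.
have d1 : dom KK qq (fun m => ev (u m) v).
  by apply: mono (h v (lexx _)); rewrite ?le_max ?lexx.
have d2 : dom KK qq (fun m => ev (w m) v).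
  by apply: mono (h' v (lexx _)); rewrite ?le_max ?lexx ?orbT.
have Q0 : 0 <= qq by rewrite le_max q0.
have Q1 : qq < 1 by rewrite gt_max q1.
apply: is_sum_ext (is_sum_cauchy Q0 Q1 d1 d2 hs ht) => m.
by rewrite /mser ev_sum; apply: eq_bigr => j _; rewrite evM.
Qed.

(** * Second order Taylor estimates along line segments *)

Definition line p x h : {poly C} :=
  mmap (@polyC C) (fun i => ((x i)%:C)%:P + (h i)%:C *: 'X) p.

Lemma line_X m x h : line (mpolyX C m) x h = \prod_(i < n) (((x i)%:C)%:P + (h i)%:C *: 'X) ^+ m i.
Proof. exact: mmapX. Qed.

Lemma lineD p q x h : line (p + q) x h = line p x h + line q x h.
Proof. exact: mmapD. Qed.
Lemma lineM p q x h : line (p * q) x h = line p x h * line q x h.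
Proof. exact: rmorphM. Qed.
Lemma line0 x h : line 0 x h = 0.
Proof. exact: mmap0. Qed.
Lemma lineZ c p x h : line (c *: p) x h = c *: line p x h.
Proof. by rewrite /line mmapZ mul_polyC. Qed.
Lemma line1 x h : line 1 x h = 1.
Proof. exact: rmorph1. Qed.

Lemma line_horner p x h (t : R) : (line p x h).[t%:C] = ev p (fun i => x i + t * h i).
Proof.
elim/mpolyind: p => [|c m p _ _ IH]; first by rewrite line0 ev0 horner0.
rewrite lineD lineZ hornerD hornerZ IH evD evZ; congr (_ * _ + _).
rewrite line_X evX horner_prod rmorph_prod; apply: eq_bigr => i _.
rewrite horner_exp hornerD hornerC hornerZ hornerX rmorphXn rmorphD rmorphM.
by rewrite [_ * t%:C]mulrC.
Qed.

Lemma line_deriv p x h : (line p x h)^`() = \sum_(i < n) (h i)%:C *: line (mderiv i p) x h.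
Proof.
elim/mpolyind: p => [|c m p _ _ IH].
  by rewrite line0 deriv0 big1// => i _; rewrite mderiv0 line0 scaler0.
transitivity (\sum_(i < n) (c *: ((h i)%:C *: line (mderiv i (mpolyX C m)) x h) + (h i)%:C *: line (mderiv i p) x h)); last first.
  by apply: eq_bigr => i _; rewrite mderivD mderivZ lineD lineZ scalerDr !scalerA [c * _]mulrC.
rewrite lineD lineZ derivD derivZ IH big_split/= -scaler_sumr; congr (_ *: _ + _).
elim/mnm_ind: m => [|i m IHm].
  by rewrite mpolyX0 line1 derivC big1// => i _; rewrite -mpolyC1 mderivC line0 scaler0.
rewrite mpolyXD lineM derivM IHm.
have lX : line (mpolyX C (mnm1 i)) x h = ((x i)%:C)%:P + (h i)%:C *: 'X.
  by rewrite /line mmapX mmap1U.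
transitivity (\sum_(j < n) ((h j)%:C *: ((i == j)%:R *: line (mpolyX C m) x h) +
   line (mpolyX C (mnm1 i)) x h * ((h j)%:C *: line (mderiv j (mpolyX C m)) x h))); last first.
  apply: eq_bigr => j _; rewrite mderivM lineD !lineM scalerDr -scalerAr; congr (_ *: _ + _).
  rewrite mderivX mnm1E lineZ -scalerAl; case: eqP => [->|_]; last by rewrite !scale0r.
  rewrite (_ : mnm_sub (mnm1 j) (mnm1 j) = @mnm0 n) ?mpolyX0 ?line1 ?mul1r//.
  by apply/mnmP => k; rewrite mnmBE subnn mnm0E.
rewrite big_split/= -mulr_sumr; congr (_ + _).
rewrite (bigD1 i)//= eqxx scale1r big1 ?addr0; last first.
  by move=> j ji; rewrite eq_sym (negbTE ji) scale0r scaler0.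
by rewrite lX derivD derivC add0r derivZ derivX -scalerAl mul1r.
Qed.

(** The mean value theorem needs real values, so it is applied to the image of [q] under a
    real-linear [f], in practice the real or imaginary part: once on [0, 1], and once to the
    derivative on [0, c]. *)
Lemma poly_taylor2 (f : C -> R) (q : {poly C}) (B : R) :
  f 0 = 0 -> (forall a b, f (a + b) = f a + f b) ->
  (forall (t : R) z, f (t%:C * z) = t * f z) -> (forall z, `|f z| <= normc z) ->
  (forall t : R, 0 <= t <= 1 -> normc (q^`()^`()).[t%:C] <= B) ->
  `|f q.[1] - f q.[0] - f (q^`()).[0]| <= B.
Proof.
move=> f0 fD fZ fle hB.
have fsum (p : {poly C}) (t : R) : (map_poly f p).[t] = f p.[t%:C].
  rewrite (horner_coef p) /map_poly horner_poly (big_morph f fD f0); apply: eq_bigr => i _.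
  by rewrite -rmorphXn mulrC [in RHS]mulrC fZ.
have fderiv (p : {poly C}) : (map_poly f p)^`() = map_poly f p^`().
  apply/polyP => i; rewrite coef_deriv !coef_map_id0// coef_deriv.
  by rewrite -[in RHS]mulr_natl -(rmorph_nat (real_complex R)) fZ mulr_natl.
pose g := map_poly f q.
have h01 : (0 : R) < 1 by [].
have e0 (p : {poly C}) : f p.[0] = (map_poly f p).[0] by rewrite fsum.
have e1 (p : {poly C}) : f p.[1] = (map_poly f p).[1] by rewrite fsum.
rewrite !e0 e1 -fderiv -/g.
have [c cI ->] := polyrcf.poly_mvt g h01.
rewrite subr0 mulr1.
move: cI; rewrite in_itv/= => /andP[c0 c1].
have [d dI ->] := polyrcf.poly_mvt g^`() c0.
move: dI; rewrite in_itv/= => /andP[d0 d1].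
rewrite subr0 normrM (ger0_norm (ltW c0)) !fderiv fsum.
have dB : normc (q^`()^`()).[d%:C] <= B.
  by apply: hB; rewrite !ltW// (lt_trans d1).
apply: le_trans dB; rewrite -[leRHS]mulr1 ler_pM ?(ltW c0) ?(ltW c1)//.
Qed.

(** The factor n^2 counts the second derivatives; the factor 2 comes from treating real and
    imaginary parts separately. *)
Lemma line_taylor2 p x h (B : R) :
  (forall t : R, 0 <= t <= 1 -> forall i j,
     normc (ev (mderiv j (mderiv i p)) (fun i => x i + t * h i)) <= B) ->
  normc (ev p (fun i => x i + h i) - ev p x - \sum_(i < n) (h i)%:C * ev (mderiv i p) x)
    <= 2 * n%:R ^+ 2 * B * enorm h ^+ 2.
Proof.
move=> hB.
have le_h i : `|h i| <= enorm h.
  rewrite -(sqrtr_sqr (h i)) ler_sqrt ?sumr_ge0//; last by move=> j _; exact: sqr_ge0.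
  by rewrite (bigD1 i)//= lerDl sumr_ge0// => j _; exact: sqr_ge0.
pose q := line p x h.
have hq (t : R) : 0 <= t <= 1 -> normc (q^`()^`()).[t%:C] <= n%:R ^+ 2 * B * enorm h ^+ 2.
  move=> ht; rewrite /q line_deriv raddf_sum horner_sum.
  rewrite (le_trans (normc_sum _ _ _))//.
  have -> : n%:R ^+ 2 * B * enorm h ^+ 2 = \sum_(i < n) (n%:R * (enorm h ^+ 2 * B)).
    by rewrite sumr_const card_ord -[RHS]mulr_natl; ring.
  apply: ler_sum => i _ /=; rewrite derivZ line_deriv hornerZ horner_sum.
  rewrite mulr_sumr (le_trans (normc_sum _ _ _))//.
  have -> : n%:R * (enorm h ^+ 2 * B) = \sum_(i < n) (enorm h ^+ 2 * B).
    by rewrite sumr_const card_ord -[RHS]mulr_natl.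
  apply: ler_sum => j _; rewrite hornerZ !Normc.normcM !normc_real line_horner mulrA expr2.
  by rewrite !ler_pM ?mulr_ge0 ?normc_ge0 ?normr_ge0// hB.
have ee : ev p (fun i => x i + h i) - ev p x - \sum_(i < n) (h i)%:C * ev (mderiv i p) x =
   q.[1] - q.[0] - (q^`()).[0].
  have -> : q.[1] = ev p (fun i => x i + h i).
    rewrite -[1](rmorph1 (real_complex R)) line_horner; congr ev.
    by apply/funext => i; rewrite mul1r.
  have e0 p' : (line p' x h).[0] = ev p' x.
    rewrite -[0](rmorph0 (real_complex R)) line_horner; congr ev.
    by apply/funext => i; rewrite mul0r addr0.
  rewrite e0 /q line_deriv horner_sum; congr (_ - _).
  by apply: eq_bigr => i _; rewrite hornerZ e0.
rewrite ee (le_trans (normc_le_re_im _))//.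
have hre := poly_taylor2 (f := @complex.Re R) _ ReD ReZ normc_re hq.
have ImD (a b : C) : complex.Im (a + b) = complex.Im a + complex.Im b.
  by case: a b => [? ?] [].
have ImZ (t : R) (z : C) : complex.Im (t%:C * z) = t * complex.Im z.
  by case: z => a b /=; rewrite mul0r addr0.
have him := poly_taylor2 (f := @complex.Im R) _ ImD ImZ normc_im hq.
have re : complex.Re (q.[1] - q.[0] - q^`().[0]) = complex.Re q.[1] - complex.Re q.[0] - complex.Re q^`().[0].
  by rewrite !ReB.
have im : complex.Im (q.[1] - q.[0] - q^`().[0]) = complex.Im q.[1] - complex.Im q.[0] - complex.Im q^`().[0].
  by case: (q.[1]) (q.[0]) (q^`().[0]) => [? ?] [? ?] [].
rewrite re im; apply: le_trans (lerD (hre _) (him _)) _ => //.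
by rewrite -subr_ge0 [X in 0 <= X](_ : _ = 0)//; ring.
Qed.

Lemma enormD x y : enorm (fun i => x i + y i) <= enorm x + enorm y.
Proof.
apply: le_of_sqr; first by rewrite addr_ge0 ?enorm_ge0.
have cs : (\sum_i x i * y i) <= enorm x * enorm y.
  apply: le_of_sqr; first by rewrite mulr_ge0 ?enorm_ge0.
  rewrite exprMn !enorm_sqr.
  (* Cauchy-Schwarz from Lagrange's identity. *)
  have : 0 <= \sum_i \sum_j (x i * y j - x j * y i) ^+ 2.
    by apply: sumr_ge0 => i _; apply: sumr_ge0 => j _; exact: sqr_ge0.
  have -> : \sum_i \sum_j (x i * y j - x j * y i) ^+ 2 =
    2 * ((\sum_i x i ^+ 2) * (\sum_i y i ^+ 2) - (\sum_i x i * y i) ^+ 2).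
    transitivity (\sum_i \sum_j (x i ^+ 2 * y j ^+ 2 + y i ^+ 2 * x j ^+ 2 - 2 * (x i * y i) * (x j * y j))).
      by apply: eq_bigr => i _; apply: eq_bigr => j _; ring.
    under eq_bigr do rewrite sumrB big_split/= -!mulr_sumr.
    rewrite sumrB big_split/= -!mulr_suml -mulr_sumr; ring.
  by rewrite pmulr_rge0// subr_ge0.
rewrite sqrrD !enorm_sqr.
have -> : \sum_i (x i + y i) ^+ 2 = \sum_i x i ^+ 2 + (\sum_i x i * y i) *+ 2 + \sum_i y i ^+ 2.
  by rewrite -sumrMnl -!big_split/=; apply: eq_bigr => i _; rewrite sqrrD.
by rewrite lerD2r lerD2l lerMn2r.
Qed.

(** Termwise differentiation: the second derivatives of the terms have a geometric majorant on a
    ball around 0 that contains the whole segment, so the quadratic remainders can be summed. *)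
Lemma ser_taylor rho u x : Gr rho u -> enorm x < rho ->
  exists K d : R, [/\ 0 < d, 0 <= K & forall h s s' (g : 'I_n -> C), enorm h < d ->
    hasval u x s -> hasval u (fun i => x i + h i) s' ->
    (forall i, hasval (dser i u) x (g i)) ->
    normc (s' - s - \sum_(i < n) (h i)%:C * g i) <= K * enorm h ^+ 2].
Proof.
move=> hu hx; have [r h1 h2] := mid_ex hx.
have rr : 0 <= r < rho by rewrite h2 andbT (le_trans (enorm_ge0 x))// ltW.
have unif : exists q K, [/\ 0 < q, q < 1, 0 <= K & forall i j m v, enorm v <= r ->
    normc (ev (mderiv j (mderiv i (u m))) v) <= K * q ^+ m].
  have [r' h3 h4] := mid_ex h2.
  have r0 : 0 < r by exact: le_lt_trans (enorm_ge0 x) h1.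
  have r'0 : 0 < r' by exact: lt_trans h3.
  have rr' : 0 < r' < rho by rewrite r'0.
  have hij (ij : 'I_n * 'I_n) : exists K, 0 <= K /\ forall m v,
     normc (ev (dser ij.2 (dser ij.1 u) m) v) <= K * (enorm v / r') ^+ m.
    have [K K0 hK] := Gr_sup (Gr_deriv ij.2 (Gr_deriv ij.1 hu)) rr'.
    by exists K.
  have [Kf hKf] := choice hij.
  pose q := r / r'; have q0 : 0 < q by rewrite divr_gt0.
  pose K := \sum_ij Kf ij; have K0 : 0 <= K by apply: sumr_ge0 => ij _; exact: (hKf ij).1.
  (* Two derivatives shift the index by two: the term of index m + 2 is bounded by K q^m, and those
     of index 0 and 1 vanish. *)
  exists q, (K / q ^+ 2); split => //.
  - by rewrite ltr_pdivrMr// mul1r.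
  - by rewrite divr_ge0// exprn_ge0// ltW.
  move=> i j m v hv.
  have C0 : 0 <= K / q ^+ 2 * q ^+ m.
    exact: mulr_ge0 (divr_ge0 K0 (exprn_ge0 2 (ltW q0))) (exprn_ge0 m (ltW q0)).
  case: m C0 => [|[|m]] C0.
  - by rewrite (homog0_deriv i (hu.1 0%N)) mderiv0 ev0 Normc.normc0.
  - by rewrite (homog0_deriv j (homog_deriv i (hu.1 1%N))) ev0 Normc.normc0.
  have -> : K / q ^+ 2 * q ^+ m.+2 = K * q ^+ m.
    by rewrite mulrAC -addn2 (exprD q m 2) mulrA mulfK// expf_neq0// gt_eqF.
  rewrite (le_trans ((hKf (i, j)).2 m v))// ler_pM ?(hKf _).1//.
  - by rewrite exprn_ge0// divr_ge0 ?enorm_ge0// ltW.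
  - by rewrite /K (bigD1 (i, j))//= lerDl sumr_ge0// => ij _; exact: (hKf ij).1.
  - rewrite lerXn2r ?nnegrE ?divr_ge0 ?enorm_ge0 ?(ltW r0) ?(ltW r'0)//.
    by rewrite ler_wpM2r// invr_ge0 ltW.
have [q [K [q0 q1 K0 hK]]] := unif.
exists (2 * n%:R ^+ 2 * K / (1 - q)), (r - enorm x); split.
- by rewrite subr_gt0.
- by rewrite divr_ge0 ?mulr_ge0 ?sqr_ge0 ?subr_ge0 ?(ltW q1).
move=> h s s' g hd hs hs' hg.
have hdom : dom (2 * n%:R ^+ 2 * K * enorm h ^+ 2) q (fun m => ev (u m) (fun i => x i + h i) - ev (u m) x - \sum_(i < n) (h i)%:C * ev (mderiv i (u m)) x).
  move=> m; rewrite [leRHS](_ : _ = 2 * n%:R ^+ 2 * (K * q ^+ m) * enorm h ^+ 2); last ring.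
  apply: line_taylor2 => t /andP[t0 t1] i j; apply: hK.
  rewrite (le_trans (enormD _ _))// enorm_scale ger0_norm//.
  have : t * enorm h <= enorm h by rewrite ler_piMl// enorm_ge0.
  move: hd; lra.
have := dom_sum_le (ltW q0) q1 hdom; rewrite [X in _ -> _ <= X](_ : _ = 2 * n%:R ^+ 2 * K * enorm h ^+ 2 / (1 - q)); last ring.
apply.
have hneg c (t : C) : is_sum c t -> is_sum (fun m => - c m) (- t).
  by move=> ht; rewrite -mulN1r; apply: is_sum_ext (is_sumZ _ ht) => m; rewrite mulN1r.
apply: is_sumD; first by apply: is_sumD => //; exact: hneg.
apply: hneg; apply: is_sum_sum => i _; apply: is_sumZ.
apply: is_sum_shift; last exact: hg.
by rewrite homog0_deriv ?ev0//; exact: hu.1.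
Qed.

End power_series.

(** * Functions represented by graded series *)

Section calculus.
Context {R : realType} {n : nat} (n0 : (0 < n)%N).
Local Notation C := R[i].
Local Notation normc := Normc.normc.
Local Notation M := (mpoly n C).
Implicit Types (f : 'rV[R]_n -> C) (x h : 'rV[R]_n).

Lemma coord_le x (i : 'I_n) : `|x 0 i| <= `|x|.
Proof.
rewrite /Num.norm/= mx_normrE.
by apply: (le_bigmax _ (fun ij => `|x ij.1 ij.2|) (0, i)).
Qed.

Lemma enorm_le_norm h : enorm (h 0) <= n%:R * `|h|.
Proof.
apply: le_of_sqr; first by rewrite mulr_ge0.
rewrite enorm_sqr exprMn.
apply: le_trans (_ : n%:R * `|h| ^+ 2 <= _); last first.
  rewrite ler_wpM2r ?sqr_ge0// expr2 ler_peMl// ler1n//.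
rewrite mulr_natl -[X in _ *+ X]card_ord -sumr_const; apply: ler_sum => i _.
by rewrite -real_normK ?num_real// lerXn2r ?nnegrE// coord_le.
Qed.

Lemma continuous_mul (T : topologicalType) (F G : T -> R) :
  continuous F -> continuous G -> continuous (fun t : T => F t * G t).
Proof. by move=> hF hG t; apply: cvgM; [exact: hF|exact: hG]. Qed.

Lemma differentiable_of_quadratic (V W : normedModType R) (F : V -> W)
    (L : {linear V -> W}) (y : V) (K : R) : 0 <= K -> continuous L ->
  (\forall k \near (0 : V), `|F (y + k) - F y - L k| <= K * `|k| ^+ 2) ->
  differentiable F y /\ 'd F y = L :> (V -> W).
Proof.
move=> K0 cL hF.
have key : F \o shift y = cst (F y) + L +o_ 0 id.
  apply/eqaddoP => e e0.
  have k1 : 0 < K + 1 by rewrite ltr_wpDl.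
  have he := @pseudometric_normed_Zmodule.nbhs0_le _ V _ (divr_gt0 e0 k1).
  near=> k.
  have hk : `|F (y + k) - F y - L k| <= K * `|k| ^+ 2 by near: k.
  have -> : (F \o shift y - (cst (F y) + L)) k = F (y + k) - F y - L k.
    by transitivity (F (k + y) - (F y + L k)) => //; rewrite opprD addrA (addrC k).
  apply: le_trans hk _; rewrite expr2 mulrA ler_wpM2r//.
  rewrite (@le_trans _ _ ((K + 1) * `|k|))// ?ler_wpM2r ?lerDl//.
  by rewrite mulrC -ler_pdivlMr//; near: k.
have dE := diff_unique cL key.
by split => //; apply/diff_locallyP; rewrite dE.
Unshelve. all: by end_near. Qed.

Lemma differentiable_of_taylor (F : 'rV[R]_n -> R) x (c : 'I_n -> R) (K d : R) :
  0 < d -> 0 <= K ->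
  (forall h, enorm (h 0) < d -> `|F (x + h) - F x - \sum_i h 0 i * c i| <= K * enorm (h 0) ^+ 2) ->
  differentiable F x /\ forall i, 'D_(delta_mx 0 i) F x = c i.
Proof.
move=> d0 K0 hF.
pose L h : R := \sum_i h 0 i * c i.
have linL : linear L.
  move=> a u v; rewrite /L scaler_sumr -big_split/=; apply: eq_bigr => i _.
  by rewrite !mxE mulrDl -mulrA.
pose Ll := HB.pack_for {linear 'rV[R]_n -> R} L (GRing.isLinear.Build _ _ _ _ L linL).
have cL : continuous (Ll : 'rV[R]_n -> R).
  change (continuous (fun h : 'rV[R]_n => \sum_i h 0 i * c i)).
  apply: continuous_big; first exact: add_continuous.
  by move=> i _; apply: continuous_mul; [exact: coord_continuous|exact: cst_continuous].
have n1 : 0 < n%:R + 1 :> R by rewrite ltr_wpDl.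
have he := @pseudometric_normed_Zmodule.nbhs0_lt _ 'rV[R]_n _ (divr_gt0 d0 n1).
have hq : \forall h \near (0 : 'rV[R]_n), `|F (x + h) - F x - Ll h| <= K * n%:R ^+ 2 * `|h| ^+ 2.
  near=> h.
  have hd : enorm (h 0) < d.
    rewrite (le_lt_trans (enorm_le_norm h))//.
    rewrite (@le_lt_trans _ _ ((n%:R + 1) * `|h|))// ?ler_wpM2r ?lerDl//.
    by rewrite mulrC -ltr_pdivlMr//; near: h.
  apply: le_trans (hF _ hd) _; rewrite -mulrA -exprMn ler_wpM2l//.
  by rewrite lerXn2r ?nnegrE ?enorm_ge0 ?mulr_ge0// enorm_le_norm.
have [dF dE] := differentiable_of_quadratic (mulr_ge0 K0 (sqr_ge0 n%:R)) cL hq.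
split => // i; rewrite deriveE// dE /= /L (bigD1 i)//= mxE !eqxx mul1r big1 ?addr0//.
by move=> j ji; rewrite mxE (negbTE ji) andbF mul0r.
Unshelve. all: by end_near. Qed.

Lemma pderiv_ser rho (u : nat -> M) f : Gr rho u ->
  (forall y, eball rho y -> hasval u (y 0) (f y)) ->
  forall x, eball rho x ->
  [/\ differentiable (fun y => complex.Re (f y)) x,
      differentiable (fun y => complex.Im (f y)) x &
      forall i, hasval (dser i u) (x 0) (pderiv i f x)].
Proof.
move=> hu hf x hx.
have [g hg] := choice (fun i => Gr_hasval n0 (Gr_deriv n0 i hu) hx).
have [K [d [d0 K0 hK]]] := ser_taylor n0 hu hx.
(* The second bound keeps x + h inside the ball, where [f] is the sum of the series. *)
pose d' := Num.min d (rho - enorm (x 0)).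
have d'0 : 0 < d' by rewrite lt_min d0 subr_gt0.
have main h : enorm (h 0) < d' ->
    normc (f (x + h) - f x - \sum_i (h 0 i)%:C * g i) <= K * enorm (h 0) ^+ 2.
  rewrite lt_min => /andP[h1 h2]; apply: hK => //; first exact: hf.
  have -> : (fun i => x 0 i + h 0 i) = (x + h) 0 by apply/funext => i; rewrite mxE.
  apply: hf; rewrite /eball /= -/(enorm ((x + h) 0)).
  have -> : (x + h) 0 = (fun i => x 0 i + h 0 i) by apply/funext => i; rewrite mxE.
  by rewrite (le_lt_trans (enormD _ _))// -ltrBrDl.
have [dre Dre] : differentiable (fun y => complex.Re (f y)) x /\
    forall i, 'D_(delta_mx 0 i) (fun y => complex.Re (f y)) x = complex.Re (g i).
  apply: (differentiable_of_taylor d'0 K0) => h hh.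
  apply: le_trans (main h hh); apply: le_trans (normc_re _).
  have -> : \sum_i h 0 i * complex.Re (g i) = complex.Re (\sum_i (h 0 i)%:C * g i).
    by rewrite raddf_sum; apply: eq_bigr => i _; exact/esym/ReZ.
  by rewrite !ReB.
have [dim Dim] : differentiable (fun y => complex.Im (f y)) x /\
    forall i, 'D_(delta_mx 0 i) (fun y => complex.Im (f y)) x = complex.Im (g i).
  apply: (differentiable_of_taylor d'0 K0) => h hh.
  apply: le_trans (main h hh); apply: le_trans (normc_im _).
  have ImB (a b : C) : complex.Im (a - b) = complex.Im a - complex.Im b by case: a b => [? ?] [].
  have -> : \sum_i h 0 i * complex.Im (g i) = complex.Im (\sum_i (h 0 i)%:C * g i).
    rewrite raddf_sum; apply: eq_bigr => i _ /=.
    by case: (g i) => a b /=; rewrite mul0r addr0.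
  by rewrite !ImB.
split => // i; rewrite /pderiv Dre Dim.
by have := hg i; case: (g i).
Qed.

Definition dsers (s : seq 'I_n) (u : nat -> M) := foldr (fun i => dser i) u s.

Lemma Gr_derivs rho s (u : nat -> M) : Gr rho u -> Gr rho (dsers s u).
Proof. by move=> hu; elim: s => // i s IH; apply: Gr_deriv. Qed.

Lemma foldr_pderiv rho (u : nat -> M) f s : Gr rho u ->
  (forall y, eball rho y -> hasval u (y 0) (f y)) ->
  forall y, eball rho y -> hasval (dsers s u) (y 0) (foldr pderiv f s y).
Proof.
move=> hu hf; elim: s => // i s IH y hy.
by have [_ _] := pderiv_ser (Gr_derivs s hu) IH hy; exact.
Qed.

Lemma ser_smooth rho (u : nat -> M) f : Gr rho u ->
  (forall y, eball rho y -> hasval u (y 0) (f y)) -> smooth_on (eball rho) f.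
Proof.
move=> hu hf s x hx.
by have [] := pderiv_ser (Gr_derivs s hu) (foldr_pderiv s hu hf) hx.
Qed.

(** Lists the single derivatives in the order used by [Dmulti] and [mderivm], so that facts proved
    by induction on sequences apply to both. *)
Definition mseq (alpha : multinom n) : seq 'I_n :=
  flatten [seq nseq (alpha i) i | i <- enum 'I_n].

Lemma Dmulti_foldr alpha f : Dmulti alpha f = foldr pderiv f (mseq alpha).
Proof.
rewrite /Dmulti /mseq; elim: (enum 'I_n) => //= i s ->.
by rewrite foldr_cat; elim: (alpha i) => //= m ->.
Qed.

Lemma size_mseq alpha : size (mseq alpha) = mdeg alpha.
Proof.
rewrite /mseq size_flatten /shape -map_comp mdegE sumnE big_map enumT.
by apply: eq_bigr => i _; rewrite /= size_nseq.
Qed.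

Lemma dsers_mderivm alpha (u : nat -> M) m :
  dsers (mseq alpha) u m = mderivm alpha (u (m + mdeg alpha)%N).
Proof.
have H s (w : nat -> M) k : dsers s w k = foldr (fun i => mderiv i) (w (k + size s)%N) s.
  elim: s w k => [|i s IH] w k /=; first by rewrite addn0.
  by rewrite /dser IH addSnnS.
by rewrite H mderivm_foldr size_mseq.
Qed.

Lemma ev_polyfun (p : M) x : polyfun p x = ev p (x 0).
Proof. by rewrite ev.unlock. Qed.

Definition taylor_poly f m : M :=
  \sum_(alpha : bmultinom n m.+1 | mdeg alpha == m)
    ((\prod_(i < n) (alpha i)`!)%:R^-1 * Dmulti alpha f 0) *: mpolyX C alpha.

Lemma taylor_polyE f m x : taylor f m x = ev (taylor_poly f m) (x 0).
Proof.
rewrite /taylor /taylor_poly ev_sum; apply: eq_bigr => alpha _.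
rewrite evZ evX; congr (_ * _); rewrite rmorph_prod; apply: eq_bigr => i _.
by rewrite rmorphXn.
Qed.

Lemma taylor_poly_homog f m : homogeneous m (taylor_poly f m).
Proof.
apply: rpred_sum => alpha /eqP h; apply: rpredZ.
by rewrite dhomogX /= h.
Qed.

Lemma eball0 rho : 0 < rho -> @eball R n rho 0.
Proof.
by move=> r0; rewrite /eball /= big1 ?sqrtr0// => i _; rewrite mxE expr0n.
Qed.

(** The coefficients are read off at the origin: the derivative of order [alpha] is again the sum of
    a graded series, of which only the constant term survives at 0. *)
Lemma ser_taylor_poly rho (u : nat -> M) f m : 0 < rho -> Gr rho u ->
  (forall y, eball rho y -> hasval u (y 0) (f y)) -> taylor_poly f m = u m.
Proof.
move=> rho0 hu hf.
have hD (alpha : multinom n) : Dmulti alpha f 0 = (\prod_(i < n) (alpha i)`!)%:R * mcoeff alpha (u (mdeg alpha)).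
  rewrite Dmulti_foldr.
  have h1 := foldr_pderiv (mseq alpha) hu hf (eball0 rho0).
  have h2 : hasval (dsers (mseq alpha) u) ((0 : 'rV[R]_n) 0) (ev (dsers (mseq alpha) u 0%N) ((0 : 'rV[R]_n) 0)).
    apply: is_sum_single => k.
    have -> : ((0 : 'rV[R]_n) 0 : 'I_n -> R) = (fun i => 0 * (0 : 'rV[R]_n) 0 i).
      by apply/funext => i; rewrite mxE mul0r.
    by rewrite (ev_scale _ _ ((Gr_derivs (mseq alpha) hu).1 _)) expr0n mul0r.
  rewrite (is_sum_unique h1 h2) (homog0C ((Gr_derivs (mseq alpha) hu).1 0%N)) evC.
  rewrite dsers_mderivm add0n mcoeff_mderivm mulr_natl.
  have -> : mnm_add alpha (@mnm0 n) = alpha by apply/mnmP => i; rewrite mnmDE mnm0E addn0.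
  by congr (_ *+ _); apply: eq_bigr => i _; rewrite ffactnn.
apply/mpolyP => beta; rewrite /taylor_poly raddf_sum.
have [bm|bm] := eqVneq (mdeg beta) m; last first.
  rewrite (dhomog_nemf_coeff (hu.1 m) bm) big1// => alpha /eqP am.
  rewrite /= mcoeffZ mcoeffX; case: eqP => [e|_]; last by rewrite mulr0.
  by move: bm; rewrite -e am eqxx.
have bb : (mdeg beta < m.+1)%N by rewrite bm.
rewrite (bigD1 (BMultinom bb)) /= ?bm ?eqxx// mcoeffZ mcoeffX eqxx mulr1 hD bm.
rewrite [X in _ + X]big1 ?addr0; last first.
  move=> alpha /andP[_ ne]; rewrite mcoeffZ mcoeffX; case: eqP => [e|_]; last by rewrite mulr0.
  by move: ne; rewrite -val_eqE /= e eqxx.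
rewrite mulKf// pnatr_eq0 -lt0n prodn_gt0// => i.
exact: fact_gt0.
Qed.

(** * The correspondence between A(B_rho) and graded series *)

Lemma normcE (z : C) : `|z| = (normc z)%:C.
Proof. by case: z. Qed.

Lemma uniformP (K : set 'rV[R]_n) (F : nat -> 'rV[R]_n -> C) f :
  {uniform K, (F : nat -> 'rV[R]_n -> C^o) @ \oo --> (f : 'rV[R]_n -> C^o)} <->
  forall e : R, 0 < e -> exists N, forall k, (N <= k)%N -> forall x, K x -> normc (f x - F k x) < e.
Proof.
split.
  move=> h e e0.
  have := h [set g : 'rV[R]_n -> C^o | forall y, K y -> ball (f y : C^o) e%:C (g y)].
  case.
    apply/uniform_nbhs; exists [set xy : C^o * C^o | ball xy.1 e%:C xy.2]; split.
      by rewrite -entourage_ballE; exists e%:C => //=; rewrite ltcR.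
    by [].
  move=> N _ hN; exists N => k /hN /= hk x Kx.
  by have := hk x Kx; rewrite -ball_normE /= normcE ltcR.
move=> h A /uniform_nbhs[E [entE EA]].
have [e /= e0 he] : exists2 e : C, 0 < e & [set xy : C^o * C^o | ball xy.1 e xy.2] `<=` E.
  by move: entE; rewrite -entourage_ballE => -[e e0 he]; exists e.
(* The radii of balls lie in [R[i]]; a positive one is real. *)
have [eI eR] : complex.Im e = 0 /\ 0 < complex.Re e.
  by move: e0; rewrite ltcE /= => /andP[/eqP -> ->].
have [N hN] := h _ eR; exists N => // k /= hk; apply: EA => y Ky; apply: he.
rewrite /= -ball_normE /= normcE.
have -> : e = (complex.Re e)%:C by case: e eI {e0 eR hN} => a b /= ->.
by rewrite ltcR; exact: hN.
Qed.

Lemma continuous_enorm : continuous (fun x : 'rV[R]_n => enorm (x 0)).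
Proof.
move=> x; apply: (@continuous_comp _ _ _ (fun x : 'rV[R]_n => \sum_(i < n) x 0 i ^+ 2) Num.sqrt).
  move: x; change (continuous (fun x : 'rV[R]_n => \sum_(i < n) x 0 i ^+ 2)).
  apply: continuous_big; first exact: add_continuous.
  by move=> i _; apply: continuous_mul; exact: coord_continuous.
exact: sqrt_continuous.
Qed.

Lemma compact_eball (K : set 'rV[R]_n) rho : 0 < rho -> compact K -> K `<=` eball rho ->
  exists2 r, 0 <= r < rho & forall x, K x -> enorm (x 0) <= r.
Proof.
move=> rho0 cK hK.
have [K0|/set0P K0] := eqVneq K set0.
  by exists 0; [rewrite lexx|move=> x; rewrite K0].
have [|c cK' hc] := compact_EVT_max K0 cK (f := fun x : 'rV[R]_n => enorm (x 0)).
  by apply: continuous_subspaceT; exact: continuous_enorm.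
exists (enorm (c 0)).
  by rewrite enorm_ge0; apply: hK; exact: set_mem.
by move=> x Kx; apply: hc; exact: mem_set.
Qed.

Lemma compact_closed_ball r : compact [set x : 'rV[R]_n | enorm (x 0) <= r].
Proof.
apply: bounded_closed_compact.
  exists r; split; first exact: num_real.
  move=> M rM x /= hx; apply: le_trans (ltW rM); apply: le_trans hx.
  rewrite /Num.norm/= mx_normrE; apply: bigmax_le => [|[i j] _ /=]; first exact: enorm_ge0.
  rewrite -(sqrtr_sqr (x i j)) ler_sqrt ?sumr_ge0//; last by move=> l _; exact: sqr_ge0.
  by rewrite ord1 (bigD1 j)//= lerDl sumr_ge0// => l _; exact: sqr_ge0.
apply: (@preimage_closed _ _ (fun x : 'rV[R]_n => enorm (x 0)) [set y | y <= r]).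
  by move=> x _; exact: continuous_enorm.
exact: closed_le.
Qed.

(** The growth comes from uniform convergence on the closed ball of radius r: a late term is the
    difference of two partial sums, each within 1 of [f], hence bounded by 2, and the finitely many
    early ones are bounded separately. Homogeneity carries the bound to all vectors. *)
Lemma Aball_ser rho f : 0 < rho -> Aball rho f ->
  Gr rho (taylor_poly f) /\ forall y, eball rho y -> hasval (taylor_poly f) (y 0) (f y).
Proof.
move=> rho0 [_ hf _]; split; last first.
  move=> y hy e e0.
  have [_ /uniformP hu] := hf [set x | enorm (x 0) <= enorm (y 0)]
    (compact_closed_ball (r := _)) (fun x (h : enorm (x 0) <= enorm (y 0)) => le_lt_trans h hy).
  have [N hN] := hu e e0; exists N => k /hN /(_ y (lexx _)).
  by rewrite big_mkord; under eq_bigr do rewrite taylor_polyE.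
apply: Gr_of_sup => //; first exact: taylor_poly_homog.
move=> r /andP[r0 rrho].
have [_ /uniformP hu] := hf [set x | enorm (x 0) <= r]
    (compact_closed_ball (r := _)) (fun x (h : enorm (x 0) <= r) => le_lt_trans h rrho).
have [N hN] := hu _ (@ltr01 R).
pose B m := Num.sqrt ((m.+1 ^ n)%:R / gmoment 0 ^+ n) * nrm m (taylor_poly f m) * r ^+ m.
have B0 m : 0 <= B m by rewrite !mulr_ge0 ?sqrtr_ge0 ?nrm_ge0 ?exprn_ge0// ltW.
pose K := 2 + \sum_(m < N) B m.
have K0 : 0 <= K by rewrite addr_ge0// sumr_ge0.
have onK m (v : 'I_n -> R) : enorm v <= r -> normc (ev (taylor_poly f m) v) <= K.
  move=> hv; have [mN|Nm] := ltnP m N.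
    rewrite (le_trans (sup_le_nrm n0 v (taylor_poly_homog f m)))//.
    rewrite (@le_trans _ _ (B m))//.
      by rewrite /B ler_wpM2l ?mulr_ge0 ?sqrtr_ge0 ?nrm_ge0// lerXn2r ?nnegrE ?enorm_ge0// ltW.
    rewrite /K (bigD1 (Ordinal mN))//= addrCA lerDl addr_ge0// sumr_ge0//.
  pose x : 'rV[R]_n := \row_i v i.
  have xv : x 0 = v :> ('I_n -> R) by apply/funext => i; rewrite mxE.
  have xr : enorm (x 0) <= r by rewrite xv.
  have h1 := hN _ Nm x xr; have h2 := hN _ (leqW Nm) x xr.
  pose S k := \sum_(0 <= j < k) taylor f j x.
  have eS : S m.+1 - S m = ev (taylor_poly f m) v.
    by rewrite /S big_nat_recr//= addrAC subrr add0r taylor_polyE xv.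
  have := normc_tri (S m.+1) (f x) (S m); rewrite eS (normcB (S m.+1)).
  have S0 : 0 <= \sum_(m < N) B m by rewrite sumr_ge0.
  move: h1 h2; rewrite /K -!/(S _).
  lra.
exists K => // m v.
(* The zero vector cannot be rescaled to length r; there only the term of degree 0 can be
   nonzero. *)
have [v0|v0] := eqVneq (enorm v) 0.
  rewrite v0 mul0r; case: m => [|m].
    by rewrite expr0 mulr1 onK// v0 ltW.
  have -> : v = (fun i => 0 * v i).
    apply/funext => i; rewrite mul0r; apply/eqP; rewrite -sqrf_eq0 eq_le sqr_ge0 andbT.
    apply: le_trans (_ : \sum_i v i ^+ 2 <= _); last by rewrite -enorm_sqr v0 expr0n.
    by rewrite (bigD1 i)//= lerDl sumr_ge0// => l _; exact: sqr_ge0.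
  by rewrite (ev_scale _ _ (taylor_poly_homog f _)) !exprS !mul0r Normc.normc0 mulr0.
have vp : 0 < enorm v by rewrite lt_def v0 enorm_ge0.
pose t := enorm v / r; have t0 : 0 < t by rewrite divr_gt0.
have -> : v = (fun i => t * (t^-1 * v i)) by apply/funext => i; rewrite mulVKf// gt_eqF.
rewrite (ev_scale _ _ (taylor_poly_homog f _)) Normc.normcM normc_real ger0_norm ?exprn_ge0 ?(ltW t0)//.
rewrite [X in X / r](_ : _ = enorm v); last first.
  by congr enorm; apply/funext => i; rewrite mulVKf// gt_eqF.
rewrite mulrC ler_wpM2r ?exprn_ge0 ?(ltW t0)// onK//.
by rewrite enorm_scale ger0_norm ?invr_ge0 ?(ltW t0)// /t invfM invrK mulrC mulrA divff// mul1r.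
Qed.

Lemma ser_Aball rho (u : nat -> M) f : 0 < rho -> Gr rho u ->
  (forall y, eball rho y -> hasval u (y 0) (f y)) -> (forall y, ~ eball rho y -> f y = 0) ->
  Aball rho f.
Proof.
move=> rho0 hu hf hf0; split => //; first exact: ser_smooth hu hf.
move=> K cK KB; have [r rr hr] := compact_eball rho0 cK KB.
have tE m x : taylor f m x = ev (u m) (x 0).
  by rewrite taylor_polyE (ser_taylor_poly m rho0 hu hf).
have [q [A [q0 q1 hdom]]] := Gr_dom n0 hu rr.
split.
  move=> x Kx; have h := hdom _ (hr _ Kx).
  have A0 : 0 <= A by have := h 0%N; rewrite expr0 mulr1; apply: le_trans; exact: normc_ge0.
  apply: (@series_le_cvg _ _ (geometric A q)).
  - by move=> m; exact: normc_ge0.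
  - by move=> m; rewrite /geometric /= mulr_ge0// exprn_ge0.
  - by move=> m; rewrite tE; exact: h.
  - by apply: is_cvg_geometric_series; rewrite ger0_norm.
apply/uniformP => e e0.
have : (fun k => A / (1 - q) * q ^+ k) @ \oo --> 0 by apply: cvg_geometric; rewrite ger0_norm.
move=> /cvgrPdist_lt /(_ _ e0) [N _ hN]; exists N => k /hN /= hk x Kx.
rewrite sub0r normrN in hk; apply: le_lt_trans hk; apply: le_trans (ler_norm _).
rewrite big_mkord; under eq_bigr do rewrite tE.
rewrite mulrAC; apply: (dom_tail q0 q1 k (hdom _ (hr _ Kx))).
by apply: hf; exact: KB.
Qed.

End calculus.

(** * The operator on formal series *)

Lemma homog_surj (K : fieldType) (n m : nat) (T : {linear mpoly n K -> mpoly n K}) :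
  (0 < n)%N ->
  (forall q, q \is @ishomog1 n K m mdeg -> T q \is @ishomog1 n K m mdeg) ->
  (forall q, q \is @ishomog1 n K m mdeg -> T q = 0 -> q = 0) ->
  forall g, g \is @ishomog1 n K m mdeg ->
  exists2 q, q \is @ishomog1 n K m mdeg & T q = g.
Proof.
case: n T => // n T _ hT iT g hg.
pose f (q : dhomog n.+1 K m) : dhomog n.+1 K m := DHomog (hT _ (dhomog_is_dhomog q)).
have lf : linear f by move=> a x y; apply: val_inj; rewrite /= linearP.
pose fl := HB.pack_for {linear dhomog n.+1 K m -> dhomog n.+1 K m} f
  (GRing.isLinear.Build _ _ _ _ f lf).
pose F : 'End(dhomog n.+1 K m) := linfun fl.
have kF : lker F == 0%VS.
  apply/lker0P => x y; rewrite !lfunE /= => /(congr1 val)/= e.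
  apply: val_inj; apply/eqP; rewrite -subr_eq0; apply/eqP; apply: iT.
    by apply: rpredB; exact: dhomog_is_dhomog.
  by rewrite linearB /= e subrr.
exists (val ((F^-1)%VF (DHomog hg))); first exact: dhomog_is_dhomog.
have := lker0_lfunVK kF (DHomog hg); rewrite lfunE => /(congr1 val).
by [].
Qed.

(** [B] is at least 2F and at least each of the first [N0] values, so F + B/2 <= B reproduces the
    bound at every later step. *)
Lemma half_bound (R : realType) (x : nat -> R) (F : R) (N0 : nat) :
  (forall m, 0 <= x m) -> 
  (forall m B, (N0 <= m)%N -> 0 <= B -> (forall j, (j < m)%N -> x j <= B) -> x m <= F + B / 2) ->
  exists2 B, 0 <= B & forall m, x m <= B.
Proof.
move=> x0 h.
pose B := `|2 * F| + \sum_(j < N0) x j.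
have B0 : 0 <= B by rewrite addr_ge0// sumr_ge0.
exists B => // m; have [d] := ubnP m; elim: d m => // d IH m hm.
have [mN|Nm] := ltnP m N0.
  by rewrite /B (bigD1 (Ordinal mN))//= addrCA lerDl addr_ge0// sumr_ge0.
apply: le_trans (h m B Nm B0 _) _.
  by move=> j jm; apply: IH; exact: leq_trans jm _.
have : 2 * F <= B by rewrite (le_trans (ler_norm _))// lerDl sumr_ge0.
lra.
Qed.

(** The degree l of the part of [u] that enters degree m: m - l = (k - a) + j with k - a > 0. This
    gap makes the system triangular and supplies the extra powers of r. *)
Lemma lower_index (m j a k0 k : nat) : (k0 < k)%N -> (a <= k0)%N -> (j <= m)%N ->
  (k <= m - j + a)%N ->
  (m - j + a - k < m)%N /\ m = (m - j + a - k + (k - a + j))%N.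
Proof. lia. Qed.

Lemma succ_le_mul (m a b : nat) : (0 < m)%N -> ((m + a + b).+1 <= (1 + a + b).+1 * m)%N.
Proof. nia. Qed.

Section formal_operator.
Context {R : realType} {n : nat} (n0 : (0 < n)%N).
Local Notation C := R[i].
Local Notation normc := Normc.normc.
Local Notation M := (mpoly n C).
Variables (k : nat) (P Q : M).
Hypotheses (hP : homogeneous k P) (hQ : homogeneous k Q).
Implicit Types (u : nat -> M) (alpha : multinom n).

Definition pser : nat -> M := fun m => if m == k then P else 0.

Lemma pser_homog : graded pser.
Proof. by move=> m; rewrite /pser; case: eqP => [->//|_]; exact: rpred0. Qed.

Lemma Gr_pser rho : Gr rho pser.
Proof.
split; first exact: pser_homog.
move=> r /andP[r0 _]; exists (nrm k P * r ^+ k) => [|m].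
  by rewrite mulr_ge0 ?nrm_ge0// exprn_ge0// ltW.
rewrite /pser; case: eqP => [->//|_]; rewrite nrm0 mul0r.
by rewrite mulr_ge0 ?nrm_ge0// exprn_ge0// ltW.
Qed.

Lemma hasval_pser v : hasval pser v (ev P v).
Proof.
move=> e e0; exists k.+1 => l kl.
rewrite (bigD1 (Ordinal kl))//= /pser eqxx big1 ?addr0 ?subrr ?Normc.normc0// => j.
by rewrite -val_eqE /= => /negbTE ->; rewrite ev0.
Qed.

Lemma mser_pser u m : mser pser u m = if (k <= m)%N then P * u (m - k)%N else 0.
Proof.
rewrite /mser; case: leqP => [km|mk].
  have km' : (k < m.+1)%N by [].
  rewrite (bigD1 (Ordinal km'))//= /pser eqxx big1 ?addr0// => j.
  by rewrite -val_eqE /= => /negbTE ->; rewrite mul0r.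
rewrite big1// => j _; rewrite /pser ifF ?mul0r//.
by apply/negbTE; rewrite neq_ltn (leq_ltn_trans _ mk)// -ltnS.
Qed.

Lemma graded_mser u w : graded u -> graded w -> graded (mser u w).
Proof.
move=> gu gw m; rewrite /mser; apply: rpred_sum => j _.
have jm : (j <= m)%N by rewrite -ltnS.
by have := dhomogM (gu j) (gw (m - j)%N); rewrite subnKC.
Qed.

Definition dm alpha u : nat -> M := dsers (mseq alpha) u.

Lemma dmE alpha u m : dm alpha u m = mderivm alpha (u (m + mdeg alpha)%N).
Proof. exact: dsers_mderivm. Qed.

Lemma Gr_dm rho alpha u : Gr rho u -> Gr rho (dm alpha u).
Proof. exact: Gr_derivs. Qed.

Definition fischer (q : M) : M := poly_diff Q (P * q).

Lemma fischer_linear : linear fischer.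
Proof.
move=> c x y; rewrite /fischer /poly_diff mulrDr scaler_sumr -big_split/=.
apply: eq_bigr => alpha _.
by rewrite mderivmD -scalerAr mderivmZ scalerDr !scalerA mulrC.
Qed.

Variables (k0 : nat) (ca : multinom n -> nat -> M).
Hypothesis (hk0 : (k0 < k)%N).
Hypothesis hca : forall alpha, (mdeg alpha <= k0)%N -> graded (ca alpha).

Definition qpart u : nat -> M :=
  fun m => \sum_(alpha <- msupp Q) zser (mcoeff alpha Q) (dm alpha (mser pser u)) m.

Definition low u : nat -> M :=
  fun m => \sum_(alpha : bmultinom n k0.+1) mser (ca alpha) (dm alpha (mser pser u)) m.

Definition Lser u : nat -> M := sser (qpart u) (low u).

Lemma qpartE u m : qpart u m = fischer (u m).
Proof.
rewrite /qpart /fischer /poly_diff !big_seq; apply: eq_bigr => alpha /(dhomogP _ _ _ hQ) /= ha.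
by rewrite /zser dmE mser_pser ha leq_addl addnK.
Qed.

Lemma lowE u m : low u m = \sum_(alpha : bmultinom n k0.+1) \sum_(j < m.+1)
  ca alpha j * mderivm alpha (if (k <= m - j + mdeg alpha)%N
    then P * u (m - j + mdeg alpha - k)%N else 0).
Proof.
apply: eq_bigr => alpha _; apply: eq_bigr => j _.
by rewrite dmE mser_pser.
Qed.

(** Triangularity: multiplication by [P] raises the degree by k, and at most k0 < k derivatives
    lower it again. *)
Lemma low_ext u u' m : (forall j, (j < m)%N -> u j = u' j) -> low u m = low u' m.
Proof.
move=> h; rewrite !lowE; apply: eq_bigr => alpha _; apply: eq_bigr => j _.
congr (_ * mderivm _ _); case: leqP => // le; rewrite h//.
have := bmdeg alpha; have := ltn_ord j; lia.
Qed.

Lemma mderivm_homog alpha d (q : M) :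
  homogeneous (d + mdeg alpha) q -> homogeneous d (mderivm alpha q).
Proof.
move=> hq.
(* [q] is viewed as a series with a single term, so that the grading of [dsers] applies. *)
pose u m := if m == (d + mdeg alpha)%N then q else 0 : M.
have gu : graded u by move=> m; rewrite /u; case: eqP => [->//|_]; exact: rpred0.
have gd s (w : nat -> M) : graded w -> graded (dsers s w).
  by move=> gw; elim: s => // i s IH m; exact: homog_deriv.
have := gd (mseq alpha) u gu d; rewrite -/(dm alpha u) dmE /u eqxx.
by [].
Qed.

Lemma low_homog u m : graded u -> homogeneous m (low u m).
Proof.
move=> gu; rewrite lowE; apply: rpred_sum => alpha _; apply: rpred_sum => j _.
have ha : (mdeg alpha <= k0)%N by rewrite -ltnS; exact: bmdeg.
have jm : (j <= m)%N by rewrite -ltnS.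
have h : homogeneous (m - j) (mderivm alpha (if (k <= m - j + mdeg alpha)%N
    then P * u (m - j + mdeg alpha - k)%N else 0)).
  apply: mderivm_homog; case: leqP => [le|_]; last exact: rpred0.
  by have := dhomogM hP (gu (m - j + mdeg alpha - k)%N); rewrite subnKC.
by have := dhomogM (hca ha j) h; rewrite subnKC.
Qed.

Lemma fischer_homog m q : homogeneous m q -> homogeneous m (fischer q).
Proof.
move=> hq; rewrite /fischer /poly_diff big_seq; apply: rpred_sum => alpha /(dhomogP _ _ _ hQ) /= ha.
apply: rpredZ; apply: mderivm_homog; rewrite ha addnC.
exact: dhomogM.
Qed.

(** * Existence and uniqueness of the formal solution *)

Variables (Cst p : R).
Hypotheses (hC : 0 < Cst) (hp : 0 < p).
Hypothesis hest : forall (m : nat) (q : M), homogeneous m q ->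
  Cst * (m%:R `^ p) * real_fischer_norm q <= real_fischer_norm (poly_diff Q (P * q)).
Hypothesis hQP : poly_diff Q P != 0.

Lemma fischer_inj m q : homogeneous m q -> fischer q = 0 -> q = 0.
Proof.
(* In degree 0 the estimate has the factor 0^p and gives nothing; there [q] is a constant c and
   [fischer q] is c times the nonzero polynomial [poly_diff Q P]. *)
move=> hq Fq0; case: m hq => [|m] hq.
  have qE := homog0C hq; move: Fq0; rewrite qE => h.
  suff -> : mcoeff (@mnm0 n) q = 0 by rewrite mpolyC0.
  apply/eqP; have := h; rewrite /fischer mulrC mul_mpolyC.
  have -> : poly_diff Q (mcoeff (@mnm0 n) q *: P) = mcoeff (@mnm0 n) q *: poly_diff Q P.
    rewrite /poly_diff scaler_sumr; apply: eq_bigr => alpha _.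
    by rewrite mderivmZ !scalerA mulrC.
  by move/eqP; rewrite scaler_eq0 (negbTE hQP) orbF.
have := hest hq; rewrite -/(fischer q) Fq0 !real_fischer_normE sq0 sqrtr0.
rewrite pmulr_rle0; last by rewrite mulr_gt0// powR_gt0// ltr0n.
move=> s0; apply: (sq_eq0 hq); apply/eqP; rewrite eq_le sq_ge0 andbT.
by rewrite -sqrtr_eq0 eq_le s0 sqrtr_ge0.
Qed.

HB.instance Definition _ := GRing.isLinear.Build C M M _ fischer fischer_linear.

Lemma fischer_surj m g : homogeneous m g -> exists2 q, homogeneous m q & fischer q = g.
Proof. exact: (@homog_surj _ n m fischer n0 (@fischer_homog m) (@fischer_inj m)). Qed.

Lemma Lser_inj u u' : graded u -> graded u' -> Lser u =1 Lser u' -> u = u'.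
Proof.
move=> gu gu' h; apply/funext => m.
have [d] := ubnP m; elim: d m => // d IH m hm.
have := h m; rewrite /Lser /sser !qpartE (@low_ext u u' m); last first.
  by move=> j jm; apply: IH; exact: leq_trans jm _.
move/addIr => e; apply/eqP; rewrite -subr_eq0; apply/eqP.
apply: (@fischer_inj m); first by apply: rpredB; [exact: gu|exact: gu'].
by rewrite linearB /= e subrr.
Qed.

Lemma Lser_surj f : graded f -> exists2 u, graded u & Lser u =1 f.
Proof.
move=> gf.
have /choice[sol hsol] : forall mg : nat * M, exists q, homogeneous mg.1 mg.2 ->
    homogeneous mg.1 q /\ fischer q = mg.2.
  move=> [m g]; have [hg|hg] := pselect (homogeneous m g); last by exists 0.
  by have [q h1 h2] := fischer_surj hg; exists q.
(* [us N] is the solution in degrees below N, extended by 0. The next degree is solved from it, and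
   the diagonal [us m.+1 m] is the full solution. *)
pose us := fix us N : nat -> M := match N with
  | 0 => fun=> 0
  | N'.+1 => fun m => if m == N' then sol (N', f N' - low (us N') N') else us N' m
  end.
have gus N : graded (us N).
  elim: N => [|N IH] m; first exact: rpred0.
  rewrite /=; case: eqP => [->|_]; last exact: IH.
  have h : homogeneous N (f N - low (us N) N) by apply: rpredB; [exact: gf|exact: low_homog].
  exact: (hsol (N, f N - low (us N) N) h).1.
have coh N m : (m < N)%N -> us N m = us m.+1 m.
  elim: N => // N IH; rewrite ltnS leq_eqVlt => /predU1P[->//|mN].
  by rewrite [LHS]/= (ltn_eqF mN) IH.
exists (fun m => us m.+1 m) => [m|m]; first exact: gus.
rewrite /Lser /sser qpartE (@low_ext _ (us m) m); last by move=> j /coh.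
have h : homogeneous m (f m - low (us m) m) by apply: rpredB; [exact: gf|apply: low_homog; exact: gus].
by rewrite /= eqxx (hsol (m, f m - low (us m) m) h).2 subrK.
Qed.

(** * Growth of the formal solution *)

Lemma nrm_dsers s u d : graded u ->
  nrm d (dsers s u d) <= (2 * (d + size s + n).+1%:R) ^+ size s * nrm (d + size s) (u (d + size s)%N).
Proof.
move=> gu; have gd s' : graded (dsers s' u).
  by elim: s' => // i s' IH m; exact: homog_deriv.
elim: s d => [|i s IH] d; first by rewrite expr0 mul1r addn0.
have h := IH d.+1; rewrite addSnnS in h.
rewrite [dsers _ _]/= /dser (le_trans (nrm_deriv n0 i (gd s d.+1)))//.
rewrite [size (i :: s)]/= exprS -[leRHS]mulrA ler_pM ?mulr_ge0 ?nrm_ge0//.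
by rewrite ler_wpM2l// ler_nat ltnS leq_add2r leq_addr.
Qed.

(** The coefficients contribute [A] and a geometric sum in [r / r1], multiplication by [P]
    contributes [sP], the derivatives the power k0, and the gap of degrees [E]. The parameter [E] is
    left free: any bound serves when k0 < p, while [E] = r is decisive when k0 = p. *)
Lemma nrm_low u m (A sP r r1 B E : R) :
  graded u -> 0 < r < r1 -> 0 <= A -> 0 <= sP -> 0 <= E -> 0 <= B ->
  (forall alpha, (mdeg alpha <= k0)%N -> forall j v,
     normc (ev (ca alpha j) v) <= A * (enorm v / r1) ^+ j) ->
  (forall v, normc (ev P v) <= sP * enorm v ^+ k) ->
  (forall i, (0 < i <= k)%N -> r ^+ i <= E) ->
  (forall j, (j < m)%N -> nrm j (u j) * r ^+ j <= B) ->
  nrm m (low u m) * r ^+ m <=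
    #|{: bmultinom n k0.+1}|%:R * (A * sP * (2 * (m + k0 + n).+1%:R) ^+ k0 * E / (1 - r / r1)) * B.
Proof.
move=> gu /andP[r0 rr1] A0 sP0 E0 B0 hA hsP hE hB.
have r10 : 0 < r1 by exact: lt_trans rr1.
have rm0 j : 0 <= r ^+ j by rewrite exprn_ge0// ltW.
pose q := r / r1; have q0 : 0 <= q by rewrite divr_ge0// ltW.
have q1 : q < 1 by rewrite ltr_pdivrMr// mul1r.
pose D := 2 * (m + k0 + n).+1%:R : R.
have D1 : 1 <= D by rewrite /D -natrM ler1n muln_gt0.
have gm : graded (mser pser u).
  move=> j; rewrite mser_pser; case: leqP => [le|_]; last exact: rpred0.
  by have := dhomogM hP (gu (j - k)%N); rewrite subnKC.
have gdm alpha : graded (dm alpha (mser pser u)).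
  by rewrite /dm; elim: (mseq alpha) => // i s IH j; exact: homog_deriv.
have main alpha j : (mdeg alpha <= k0)%N -> (j <= m)%N ->
    nrm m (ca alpha j * dm alpha (mser pser u) (m - j)%N) * r ^+ m <=
    A * sP * D ^+ k0 * E * B * q ^+ j.
  move=> ha jm.
  have h1 : nrm m (ca alpha j * dm alpha (mser pser u) (m - j)%N) <=
      A / r1 ^+ j * nrm (m - j) (dm alpha (mser pser u) (m - j)%N).
    have := @nrmM R n n0 (m - j) j (A / r1 ^+ j) (ca alpha j) _ _ (gdm alpha (m - j)%N) _.
    rewrite subnK//; apply.
      by rewrite divr_ge0// exprn_ge0// ltW.
    by move=> v; rewrite (le_trans (hA _ ha j v))// expr_div_n mulrAC mulrA.
  have h2 := nrm_dsers (mseq alpha) (m - j) gm; rewrite size_mseq -/(dm alpha _) in h2.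
  set d := (m - j + mdeg alpha)%N in h2.
  have h3 : nrm d (mser pser u d) * r ^+ m <= sP * B * E * r ^+ j.
    rewrite mser_pser; case: leqP => [kd|_]; last first.
      by rewrite nrm0 mul0r !mulr_ge0.
    have [lm mE] := lower_index hk0 ha jm kd; rewrite -/d in lm mE.
    set l := (d - k)%N in lm mE *.
    have h4 : nrm d (P * u l) <= sP * nrm l (u l).
      have := @nrmM R n n0 l k sP P _ sP0 (gu l) hsP.
      by rewrite /l subnK.
    have -> : r ^+ m = r ^+ l * (r ^+ (k - mdeg alpha) * r ^+ j).
      by rewrite -!exprD -mE.
    apply: le_trans (ler_wpM2r _ h4) _; first by rewrite !mulr_ge0.
    rewrite [leLHS](_ : _ = sP * (nrm l (u l) * r ^+ l) * r ^+ (k - mdeg alpha) * r ^+ j); last ring.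
    rewrite ler_wpM2r// ler_pM ?mulr_ge0 ?nrm_ge0//.
      by rewrite ler_wpM2l// hB.
    by apply: hE; rewrite leq_subr subn_gt0 (leq_ltn_trans ha).
  have h5 : (2 * (d + n).+1%:R) ^+ mdeg alpha <= D ^+ k0 :> R.
    apply: le_trans (_ : D ^+ mdeg alpha <= _); last exact: ler_weXn2l.
    rewrite lerXn2r ?nnegrE ?mulr_ge0 ?(le_trans ler01 D1)//.
    by rewrite ler_wpM2l// ler_nat ltnS leq_add2r /d leq_add// leq_subr.
  have c0 : 0 <= A / r1 ^+ j by rewrite divr_ge0// exprn_ge0// ltW.
  apply: le_trans (ler_wpM2r (rm0 m) h1) _; rewrite -[leLHS]mulrA.
  have h6 : nrm (m - j) (dm alpha (mser pser u) (m - j)%N) * r ^+ m <= D ^+ k0 * (sP * B * E * r ^+ j).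
    apply: le_trans (ler_wpM2r (rm0 m) h2) _; rewrite -[leLHS]mulrA.
    apply: ler_pM; [by rewrite exprn_ge0// mulr_ge0|by rewrite mulr_ge0 ?nrm_ge0|exact: h5|exact: h3].
  apply: le_trans (ler_wpM2l c0 h6) _.
  by rewrite /q expr_div_n le_eqVlt; apply/orP; left; apply/eqP; ring.
have geo N : \sum_(j < N) q ^+ j <= (1 - q)^-1.
  have q2 : 0 < 1 - q by rewrite subr_gt0.
  rewrite -[leRHS]mul1r ler_pdivlMr// mulrC.
  have := subrX1 q N; rewrite -(opprB 1 q) mulNr => e.
  have : 0 <= q ^+ N by rewrite exprn_ge0.
  move: e; lra.
have K0 : 0 <= A * sP * D ^+ k0 * E * B.
  by rewrite !mulr_ge0// exprn_ge0// (le_trans ler01 D1).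
rewrite /low; apply: le_trans (ler_wpM2r (rm0 m) (nrm_sum n0 _ _)) _.
  by move=> alpha _; apply: graded_mser; [apply: hca; rewrite -ltnS; exact: bmdeg|exact: gdm].
rewrite mulr_suml.
have -> : #|{: bmultinom n k0.+1}|%:R * (A * sP * D ^+ k0 * E / (1 - q)) * B =
    \sum_(alpha : bmultinom n k0.+1) (A * sP * D ^+ k0 * E * B / (1 - q)).
  by rewrite sumr_const -[RHS]mulr_natl; ring.
apply: ler_sum => alpha _.
have ha : (mdeg alpha <= k0)%N by rewrite -ltnS; exact: bmdeg.
rewrite -[mser (ca alpha) _ m]/(\sum_(j < m.+1) ca alpha j * dm alpha (mser pser u) (m - j)%N).
apply: le_trans (ler_wpM2r (rm0 m) (nrm_sum n0 _ _)) _.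
  move=> j _; have jm : (j <= m)%N by rewrite -ltnS.
  have := dhomogM (hca ha j) (gdm alpha (m - j)%N); rewrite subnKC//; exact.
rewrite mulr_suml; apply: le_trans (ler_wpM2l K0 (geo m.+1)).
by rewrite mulr_sumr; apply: ler_sum => j _; apply: main => //; rewrite -ltnS.
Qed.

(** Both sides have degree m, so the hypothesis is divided by the same weight on either side. *)
Lemma nrm_fischer m (q : M) : homogeneous m q -> Cst * m%:R `^ p * nrm m q <= nrm m (fischer q).
Proof.
move=> hq; have := hest hq; rewrite !real_fischer_normE => h.
have w0 := wt_gt0 m n0.
rewrite /nrm !sqrtrM ?sq_ge0// mulrA ler_wpM2r ?sqrtr_ge0//.
Qed.

Lemma nrm_step u f m (A sP r r1 B E F : R) :
  graded u -> Lser u =1 f -> (0 < m)%N ->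
  0 < r < r1 -> 0 <= A -> 0 <= sP -> 0 <= E -> 0 <= B ->
  (forall alpha, (mdeg alpha <= k0)%N -> forall j v,
     normc (ev (ca alpha j) v) <= A * (enorm v / r1) ^+ j) ->
  (forall v, normc (ev P v) <= sP * enorm v ^+ k) ->
  (forall i, (0 < i <= k)%N -> r ^+ i <= E) ->
  (forall j, (j < m)%N -> nrm j (u j) * r ^+ j <= B) ->
  nrm m (f m) * r ^+ m <= F ->
  Cst * m%:R `^ p * (nrm m (u m) * r ^+ m) <=
    F + #|{: bmultinom n k0.+1}|%:R * (A * sP * (2 * (1 + k0 + n).+1%:R) ^+ k0) *
      (E / (1 - r / r1)) * m%:R ^+ k0 * B.
Proof.
move=> gu hL m0 rr A0 sP0 E0 B0 hA hsP hE hB hF.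
have hlow := nrm_low gu rr A0 sP0 E0 B0 hA hsP hE hB.
have /andP[r0 rr1] := rr.
have rm0 j : 0 <= r ^+ j by rewrite exprn_ge0// ltW.
have q2 : 0 < 1 - r / r1 by rewrite subr_gt0 ltr_pdivrMr ?mul1r// (lt_trans r0).
have eF : fischer (u m) = f m + (- 1) *: low u m.
  by rewrite -(hL m) /Lser /sser qpartE scaleN1r addrK.
have h1 : nrm m (fischer (u m)) <= nrm m (f m) + nrm m (low u m).
  rewrite eF (le_trans (nrmD n0 _ _))//.
    by apply: rpredZ; exact: low_homog.
  by rewrite nrmZ normcN Normc.normc1 mul1r.
rewrite mulrA; apply: le_trans (ler_wpM2r (rm0 m) (nrm_fischer (gu m))) _.
apply: le_trans (ler_wpM2r (rm0 m) h1) _; rewrite mulrDl.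
apply: le_trans (lerD hF hlow) _; rewrite lerD2l.
(* For m >= 1 the factor m + k0 + n + 1 of each derivative is at most (k0 + n + 2) m, which isolates
   the power m^k0. *)
rewrite [leRHS](_ : _ = #|{: bmultinom n k0.+1}|%:R * (A * sP * ((2 * (1 + k0 + n).+1%:R) ^+ k0 * m%:R ^+ k0) * E / (1 - r / r1)) * B); last ring.
rewrite ler_wpM2r// ler_wpM2l// !ler_wpM2r ?invr_ge0 ?(ltW q2)// ler_wpM2l ?mulr_ge0//.
rewrite -exprMn lerXn2r ?nnegrE ?mulr_ge0// -mulrA ler_wpM2l// -natrM ler_nat.
exact: succ_le_mul.
Qed.

Lemma solution_bound u f (A sP r r1 E F : R) (N0 : nat) :
  graded u -> Lser u =1 f -> 0 < r < r1 -> 0 <= A -> 0 <= sP -> 0 <= E -> 0 <= F ->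
  (forall alpha, (mdeg alpha <= k0)%N -> forall j v,
     normc (ev (ca alpha j) v) <= A * (enorm v / r1) ^+ j) ->
  (forall v, normc (ev P v) <= sP * enorm v ^+ k) ->
  (forall i, (0 < i <= k)%N -> r ^+ i <= E) ->
  (forall m, nrm m (f m) * r ^+ m <= F) ->
  (forall m : nat, (0 < m)%N -> (N0 <= m)%N ->
     #|{: bmultinom n k0.+1}|%:R * (A * sP * (2 * (1 + k0 + n).+1%:R) ^+ k0) *
      (E / (1 - r / r1)) * m%:R ^+ k0 <= Cst * m%:R `^ p / 2) ->
  exists2 B, 0 <= B & forall m, nrm m (u m) * r ^+ m <= B.
Proof.
move=> gu hL rr A0 sP0 E0 F0 hA hsP hE hF hK.
have r0 : 0 < r by case/andP: rr.
(* The threshold is at least 1 because degree 0 escapes the estimate; F may be divided by [Cst]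
   alone because m^p >= 1 from there on. *)
apply: (@half_bound _ _ (F / Cst) (maxn 1 N0)) => [m|m B].
  by rewrite mulr_ge0 ?nrm_ge0// exprn_ge0// ltW.
rewrite geq_max => /andP[m0 Nm] B0 hB.
have := nrm_step gu hL m0 rr A0 sP0 E0 B0 hA hsP hE hB (hF m).
have := hK m m0 Nm; set K := (X in X <= _).
have W1 : 1 <= m%:R `^ p.
  have := @ge0_ler_powR R p (ltW hp) 1 m%:R; rewrite powR1 !nnegrE ler01 ler0n ler1n.
  by apply.
have W0 : 0 < m%:R `^ p by exact: lt_le_trans W1.
move=> h1 h2; have CW : 0 < Cst * m%:R `^ p by rewrite mulr_gt0.
rewrite -(ler_pM2l CW); apply: le_trans h2 _.
rewrite [leRHS]mulrDr lerD//.
  rewrite [leRHS](_ : _ = F * m%:R `^ p); last by field; rewrite gt_eqF.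
  by rewrite ler_peMr.
by apply: le_trans (ler_wpM2r B0 h1) _; rewrite mulrAC mulrA.
Qed.

Lemma P_bound : exists2 sP, 0 <= sP & forall v, normc (ev P v) <= sP * enorm v ^+ k.
Proof.
exists (Num.sqrt ((k.+1 ^ n)%:R / gmoment 0 ^+ n) * nrm k P).
  by rewrite mulr_ge0 ?sqrtr_ge0 ?nrm_ge0.
by move=> v; exact: sup_le_nrm.
Qed.

Lemma Gr_of_bound r u B : graded u -> (forall m, nrm m (u m) * r ^+ m <= B) ->
  forall r', r' <= r -> 0 < r' -> exists2 K, 0 <= K & forall m, nrm m (u m) * r' ^+ m <= K.
Proof.
move=> gu hB r' le r'0; exists `|B| => // m.
apply: le_trans (ler_norm _); apply: le_trans (hB m).
rewrite ler_wpM2l ?nrm_ge0// lerXn2r ?nnegrE ?(ltW r'0)//.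
by rewrite (le_trans (ltW r'0)).
Qed.

Lemma ca_bound rho r1 : (forall alpha, (mdeg alpha <= k0)%N -> Gr rho (ca alpha)) ->
  0 < r1 < rho -> exists2 A, 0 <= A & forall alpha, (mdeg alpha <= k0)%N -> forall j v,
     normc (ev (ca alpha j) v) <= A * (enorm v / r1) ^+ j.
Proof.
move=> hGr hr1; have r10 : 0 < r1 by case/andP: hr1.
have /choice[Af hAf] : forall alpha : bmultinom n k0.+1, exists A, 0 <= A /\ forall j v,
    normc (ev (ca alpha j) v) <= A * (enorm v / r1) ^+ j.
  move=> alpha; have ha : (mdeg alpha <= k0)%N by rewrite -ltnS; exact: bmdeg.
  by have [A A0 hA] := Gr_sup n0 (hGr _ ha) hr1; exists A.
exists (\sum_alpha Af alpha) => [|alpha ha j v]; first by apply: sumr_ge0 => alpha _; exact: (hAf _).1.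
have hb : (mdeg alpha < k0.+1)%N by [].
apply: le_trans ((hAf (BMultinom hb)).2 j v) _.
rewrite ler_wpM2r ?exprn_ge0 ?divr_ge0 ?enorm_ge0 ?(ltW r10)//.
by rewrite (bigD1 (BMultinom hb))//= lerDl sumr_ge0// => x _; exact: (hAf _).1.
Qed.

Lemma Lser_surj_lt rho f : k0%:R < p ->
  (forall alpha, (mdeg alpha <= k0)%N -> Gr rho (ca alpha)) ->
  Gr rho f -> exists2 u, Gr rho u & Lser u = f.
Proof.
move=> hkp hGr [gf hf].
have [u gu hL] := Lser_surj gf.
exists u; last exact/funext.
split => // r rr; have /andP[r0 /mid_ex[r1 h1 h2]] := rr.
have rr1 : 0 < r < r1 by rewrite r0.
have hr1 : 0 < r1 < rho by rewrite h2 (lt_trans r0).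
have [A A0 hA] := ca_bound hGr hr1; have [sP sP0 hsP] := P_bound.
have [F F0 hF] := hf r rr.
pose E := \sum_(i < k.+1) r ^+ i.
have rm0 j : 0 <= r ^+ j by rewrite exprn_ge0// ltW.
have E0 : 0 <= E by apply: sumr_ge0.
have hE i : (0 < i <= k)%N -> r ^+ i <= E.
  move=> /andP[_ ik]; have ik' : (i < k.+1)%N by [].
  by rewrite /E (bigD1 (Ordinal ik'))//= lerDl sumr_ge0.
pose K := #|{: bmultinom n k0.+1}|%:R * (A * sP * (2 * (1 + k0 + n).+1%:R) ^+ k0) * (E / (1 - r / r1)).
have q2 : 0 < 1 - r / r1 by rewrite subr_gt0 ltr_pdivrMr ?mul1r// (lt_trans r0).
have K0 : 0 <= K by rewrite /K !mulr_ge0 ?invr_ge0 ?(ltW q2)// exprn_ge0// mulr_ge0.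
(* For m >= t the power m^(p - k0) is at least 2K/Cst, that is, K m^k0 <= Cst m^p / 2. *)
pose t := (2 * K / Cst) `^ (p - k0%:R)^-1.
pose N0 := Num.bound t.
have pk : 0 < p - k0%:R by rewrite subr_gt0.
have [|B B0 hB] := @solution_bound u f A sP r r1 E F N0 gu hL rr1 A0 sP0 E0 F0 hA hsP hE hF.
  move=> m m0 Nm; rewrite -/K.
  have tm : t <= m%:R.
    by rewrite (le_trans (ltW (archi_boundP (powR_ge0 _ _))))// ler_nat.
  have mp : 0 < m%:R :> R by rewrite ltr0n.
  have : 2 * K / Cst <= m%:R `^ (p - k0%:R).
    have := @ge0_ler_powR R (p - k0%:R) (ltW pk) t m%:R.
    rewrite !nnegrE powR_ge0 ler0n => /(_ isT isT tm); apply: le_trans.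
    have e0 : 0 <= 2 * K / Cst by apply: divr_ge0; [exact: mulr_ge0|exact: ltW].
    by rewrite /t -powRrM mulVf ?gt_eqF// powRr1.
  have -> : m%:R `^ p = m%:R `^ (p - k0%:R) * m%:R ^+ k0.
    by rewrite -(powR_mulrn k0 (ltW mp)) -powRD ?subrK// (gt_eqF mp) implybT.
  set W := m%:R `^ _ => h.
  rewrite [leRHS](_ : _ = Cst / 2 * W * m%:R ^+ k0); last by field.
  rewrite ler_wpM2r ?exprn_ge0//.
  by move: h; rewrite ler_pdivrMr// => h; lra.
by exists B.
Qed.

Lemma Lser_surj_eq rho : k0%:R = p -> 0 < rho ->
  (forall alpha, (mdeg alpha <= k0)%N -> Gr rho (ca alpha)) ->
  exists r, [/\ 0 < r, r <= rho & forall f, Gr rho f -> exists2 u, Gr r u & Lser u = f].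
Proof.
move=> hkp rho0 hGr.
(* The coefficients are estimated at a radius fixed beforehand, so that [A] and [K] do not depend on
   the choice of r. *)
pose r1 := rho / 2.
have r10 : 0 < r1 by rewrite divr_gt0.
have hr1 : 0 < r1 < rho by rewrite r10 /r1; lra.
have [A A0 hA] := ca_bound hGr hr1; have [sP sP0 hsP] := P_bound.
pose K := #|{: bmultinom n k0.+1}|%:R * (A * sP * (2 * (1 + k0 + n).+1%:R) ^+ k0).
have K0 : 0 <= K by rewrite /K !mulr_ge0// exprn_ge0// mulr_ge0.
have K1 : 0 < 4 * (K + 1) by rewrite mulr_gt0// ltr_wpDl.
(* The three bounds give, in order: r / (1 - r/r1) <= 2r; r^i <= r for i >= 1; and 2Kr <= Cst/2.
   None of them involves [f]. *)
pose r := Num.min (Num.min (r1 / 2) 1) (Cst / (4 * (K + 1))).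
have r0 : 0 < r by rewrite !lt_min !divr_gt0// ltr01.
have [rr1 rle1 rK] : [/\ r <= r1 / 2, r <= 1 & r <= Cst / (4 * (K + 1))].
  by rewrite /r; split; rewrite !ge_min lexx ?orbT.
exists r; split => //.
  by move: rr1; rewrite /r1; lra.
move=> f [gf hf]; have [u gu hL] := Lser_surj gf.
exists u; last exact/funext.
have rr : 0 < r < r1 by rewrite r0 /=; lra.
have [|F F0 hF] := hf r; first by rewrite r0 /=; move: rr1; rewrite /r1; lra.
have hE i : (0 < i <= k)%N -> r ^+ i <= r.
  by move=> /andP[i0 _]; rewrite -[leRHS]expr1 ler_wiXn2l// ltW.
have [|B B0 hB] := @solution_bound u f A sP r r1 r F 0 gu hL rr A0 sP0 (ltW r0) F0 hA hsP hE hF.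
  move=> m m0 _; rewrite -/K -hkp powR_mulrn//.
  rewrite [leRHS](_ : _ = Cst / 2 * m%:R ^+ k0); last by field.
  rewrite ler_wpM2r ?exprn_ge0//.
  have q : r / r1 <= 2^-1 by rewrite ler_pdivrMr//; lra.
  have h1 : r / (1 - r / r1) <= 2 * r.
    by rewrite ler_pdivrMr; [nra|lra].
  apply: le_trans (ler_wpM2l K0 h1) _.
  have := rK; rewrite ler_pdivlMr// => h; nra.
split => // r' /andP[r'0 r'r]; exact: (Gr_of_bound gu hB (ltW r'r) r'0).
Qed.

End formal_operator.

(** * The operator on functions *)

Section operator.
Context {R : realType} {n : nat} (n0 : (0 < n)%N).
Local Notation C := R[i].
Local Notation M := (mpoly n C).
Variables (k : nat) (P Q : M) (k0 : nat) (a : multinom n -> 'rV[R]_n -> C) (rho : R).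
Hypotheses (hP : homogeneous k P) (rho0 : 0 < rho).
Hypothesis ha : forall alpha : multinom n, (mdeg alpha <= k0)%N -> Aball rho (a alpha).
Implicit Types (u : nat -> M) (alpha : multinom n) (f q : 'rV[R]_n -> C) (r : R).

Local Notation ca := (fun alpha => taylor_poly (a alpha)).
Local Notation L q := (Lop Q k0 a (fun y => polyfun P y * q y)).

Lemma bmdeg_le (alpha : bmultinom n k0.+1) : (mdeg alpha <= k0)%N.
Proof. by rewrite -ltnS; exact: bmdeg. Qed.

Lemma Gr_coef r alpha : r <= rho -> (mdeg alpha <= k0)%N -> Gr r (ca alpha).
Proof. by move=> rr h; apply: Gr_le rr _; exact: (Aball_ser n0 rho0 (ha h)).1. Qed.

Lemma eball_le r (x : 'rV[R]_n) : r <= rho -> eball r x -> eball rho x.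
Proof. by move=> rr h; exact: lt_le_trans h rr. Qed.

Lemma Gr_Lser r u : r <= rho -> Gr r u -> Gr r (Lser k P Q k0 ca u).
Proof.
move=> rr gu; have gm := Gr_mul n0 (Gr_pser hP r) gu.
apply: (GrD n0).
  by apply: (Gr_sum n0) => alpha _; apply: GrZ; exact: Gr_dm.
apply: (Gr_sum n0) => alpha _; apply: (Gr_mul n0); last exact: Gr_dm.
by apply: Gr_coef => //; exact: bmdeg_le.
Qed.

Lemma hasval_Lser r u q : r <= rho -> Gr r u ->
  (forall y, eball r y -> hasval u (y 0) (q y)) ->
  forall x, eball r x -> hasval (Lser k P Q k0 ca u) (x 0) (L q x).
Proof.
move=> rr gu hu x hx; have gm := Gr_mul n0 (Gr_pser hP r) gu.
have hm y : eball r y -> hasval (mser (pser k P) u) (y 0) (polyfun P y * q y).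
  move=> hy; rewrite ev_polyfun.
  by apply: (hasvalM n0 (Gr_pser hP r) gu hy (hasval_pser _ _ _)); exact: hu.
have hd alpha : hasval (dm alpha (mser (pser k P) u)) (x 0)
    (Dmulti alpha (fun y => polyfun P y * q y) x).
  by rewrite Dmulti_foldr; exact: (foldr_pderiv n0 _ gm hm).
apply: hasvalD.
  by apply: hasval_sum => alpha _; apply: hasvalZ; exact: hd.
apply: hasval_sum => alpha _; have hal := bmdeg_le alpha.
apply: (hasvalM n0 (Gr_coef rr hal) (Gr_dm n0 alpha gm) hx _ (hd _)).
by apply: (Aball_ser n0 rho0 (ha hal)).2; exact: eball_le hx.
Qed.

Lemma ser_value r u : Gr r u -> exists q,
  (forall y, eball r y -> hasval u (y 0) (q y)) /\ (forall y, ~ eball r y -> q y = 0).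
Proof.
move=> gu.
have /choice[q hq] : forall y : 'rV[R]_n, exists s,
    (eball r y -> hasval u (y 0) s) /\ (~ eball r y -> s = 0).
  move=> y; have [hy|hy] := pselect (eball r y); last by exists 0.
  by have [s hs] := Gr_hasval n0 gu hy; exists s.
by exists q; split => y; [exact: (hq y).1|exact: (hq y).2].
Qed.

Lemma Aball_inj r q q' : 0 < r -> Aball r q -> Aball r q' ->
  taylor_poly q = taylor_poly q' -> q = q'.
Proof.
move=> r0 hq hq' e; apply/funext => x.
have [hx|hx] := pselect (eball r x).
  have h1 := (Aball_ser n0 r0 hq).2 x hx; have h2 := (Aball_ser n0 r0 hq').2 x hx.
  by move: h2; rewrite -e; exact: is_sum_unique h1.
by case: hq => _ _ ->//; case: hq' => _ _ ->.
Qed.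

(** Transfers the equation from functions to Taylor series, so that uniqueness becomes the formal
    statement [Lser_inj]. *)
Lemma taylor_poly_Lop r q f : 0 < r -> r <= rho -> Aball r q ->
  (forall x, eball r x -> L q x = f x) ->
  taylor_poly f = Lser k P Q k0 ca (taylor_poly q).
Proof.
move=> r0 rr hq hL; have [gq vq] := Aball_ser n0 r0 hq.
apply/funext => m; apply: (ser_taylor_poly n0 m r0 (Gr_Lser rr gq)) => y hy.
by rewrite -hL//; exact: (hasval_Lser rr gq vq).
Qed.

Lemma Lop_solve r u f : 0 < r -> r <= rho -> Gr r u ->
  (forall y, eball r y -> hasval (Lser k P Q k0 ca u) (y 0) (f y)) ->
  exists2 q, Aball r q & forall x, eball r x -> L q x = f x.
Proof.
move=> r0 rr gu hf; have [q [h1 h2]] := ser_value gu.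
exists q; first exact: (ser_Aball n0 r0 gu).
by move=> x hx; apply: is_sum_unique (hf x hx); exact: (hasval_Lser rr gu h1).
Qed.

End operator.

Theorem theorem17 (R : realType) (n : nat) (hn : (0 < n)%N)
    (k : nat) (P Q : mpoly n R[i])
    (hP : homogeneous k P) (hQ : homogeneous k Q)
    (C p : R) (hC : 0 < C) (hp : 0 < p) (hpk : p <= k%:R)
    (hest : forall (m : nat) (q : mpoly n R[i]), homogeneous m q ->
      C * (m%:R `^ p) * real_fischer_norm q <=
      real_fischer_norm (poly_diff Q (P * q)))
    (hQP : poly_diff Q P != 0)
    (k0 : nat) (hk0 : (k0 < k)%N) (rho : R) (hrho : 0 < rho)
    (a : multinom n -> 'rV[R]_n -> R[i])
    (ha : forall alpha : multinom n, (mdeg alpha <= k0)%N -> Aball rho (a alpha)) :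
  (k0%:R < p ->
    set_bij (Aball rho) (Aball rho)
      (fun q => patch (fun=> 0) (eball rho)
        (Lop Q k0 a (fun x => polyfun P x * q x)))) /\
  (k0%:R = p ->
    exists r : R, [/\ 0 < r, r <= rho &
      forall f : 'rV[R]_n -> R[i], Aball rho f ->
        exists! q : 'rV[R]_n -> R[i], Aball r q /\
          forall x, eball r x -> Lop Q k0 a (fun y => polyfun P y * q y) x = f x]).
Proof.
have hca alpha : (mdeg alpha <= k0)%N -> graded (taylor_poly (a alpha)).
  by move=> _ m; exact: taylor_poly_homog.
have hGr alpha : (mdeg alpha <= k0)%N -> Gr rho (taylor_poly (a alpha)).
  exact: (Gr_coef hn hrho ha (lexx rho)).
have inj r f q q' : 0 < r -> r <= rho -> Aball r q -> Aball r q' ->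
    (forall x, eball r x -> Lop Q k0 a (fun y => polyfun P y * q y) x = f x) ->
    (forall x, eball r x -> Lop Q k0 a (fun y => polyfun P y * q' y) x = f x) ->
    q = q'.
  move=> r0 rr hq hq' h h'; apply: (Aball_inj hn r0 hq hq').
  apply: (Lser_inj hn hQ (ca := fun alpha => taylor_poly (a alpha)) hk0 hC hest hQP).
  - by move=> m; exact: taylor_poly_homog.
  - by move=> m; exact: taylor_poly_homog.
  move=> m; rewrite -(taylor_poly_Lop hn hP hrho ha r0 rr hq h).
  by rewrite -(taylor_poly_Lop hn hP hrho ha r0 rr hq' h').
split=> hkp.
  have patchE (g : 'rV[R]_n -> R[i]) x : eball rho x -> patch (fun=> 0) (eball rho) g x = g x.
    by move=> hx; rewrite /patch mem_set.
  have patch0 (g : 'rV[R]_n -> R[i]) x : ~ eball rho x -> patch (fun=> 0) (eball rho) g x = 0.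
    by move=> hx; rewrite /patch memNset.
  split.
  - move=> q hq; have [gq vq] := Aball_ser hn hrho hq.
    have gL := Gr_Lser hn Q hP hrho ha (lexx _) gq.
    refine (ser_Aball hn hrho gL _ (patch0 _)) => y hy.
    have -> := patchE (Lop Q k0 a (fun x => polyfun P x * q x)) y hy.
    exact: (@hasval_Lser R n hn k P Q k0 a rho hP hrho ha rho _ q (lexx _) gq vq y hy).
  - move=> q q' /set_mem hq /set_mem hq' e.
    (* The common right-hand side is the image of [q] itself. *)
    apply: (inj rho (patch (fun=> 0) (eball rho)
      (Lop Q k0 a (fun x => polyfun P x * q x))) q q') => // x hx.
      by rewrite patchE.
    by rewrite e patchE.
  - move=> f hf; have [gf vf] := Aball_ser hn hrho hf.
    have [u gu hL] := Lser_surj_lt hn hP hQ hk0 hca hC hp hest hQP hkp hGr gf.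
    have [|q hq hqf] := @Lop_solve R n hn k P Q k0 a rho hP hrho ha rho u f hrho (lexx _) gu.
      by rewrite hL.
    exists q => //; apply/funext => x.
    have [hx|hx] := pselect (eball rho x); first by rewrite patchE// hqf.
    by rewrite patch0//; case: hf => _ _ ->.
(* The radius is obtained before [f] is introduced, so one [r] serves every right-hand side. *)
have [r [r0 rr hr]] := Lser_surj_eq hn hP hQ hk0 hca hC hp hest hQP hkp hrho hGr.
exists r; split => // f hf; have [gf vf] := Aball_ser hn hrho hf.
have [u gu hL] := hr _ gf.
have [|q hq hqf] := @Lop_solve R n hn k P Q k0 a rho hP hrho ha r u f r0 rr gu.
  by move=> y hy; rewrite hL; apply: vf; exact: eball_le hy.
exists q; split=> // q' [hq' hqf']; exact: (inj r f).
Qed.
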